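(* For any 3-connected planar graph $\Gamma$ which admits a Hamiltonian cycle $\gamma$, there exists a hyperideal AdS polyhedron $P$ whose 1-skeleton is $\Gamma$ with equator $\gamma$ (that is, there is an isomorphism from $\Gamma$ to the 1-skeleton of $P$ carrying $\gamma$ to the equator of $P$).
   Context: A graph is 3-connected if it cannot be disconnected or reduced to a single point by removing 0, 1 or 2 vertices and their incident edges. A Hamiltonian cycle is a closed path following edges and visiting each vertex exactly once. $\mathbb{R}^{2,2}$ is $\mathbb{R}^4$ with the bilinear form $\langle x,y\rangle_{2,2}=x_1y_1+x_2y_2-x_3y_3-x_4y_4$. $\mathrm{AdS}^3=\{[x]\in\mathbb{RP}^3:\langle x,x\rangle_{2,2}<0\}$, with the Lorentzian metric of constant curvature $-1$ induced from the quadric $\{\langle x,x\rangle_{2,2}=-1\}$; it is oriented and time-oriented. Polyhedra in $\mathbb{RP}^3$ are convex: contained in an affine chart and convex there. A hyperideal AdS polyhedron is $P=P'\cap\mathrm{AdS}^3$, where $P'\subset\mathbb{RP}^3$ is a convex polyhedron whose vertices are all outside $\mathrm{AdS}^3$ (i.e. in $\mathbb{RP}^3\setminus\mathrm{AdS}^3$) and whose edges all intersect $\mathrm{AdS}^3$. Vertices, edges, faces and 1-skeleton of $P$ mean those of $P'$. All edges and faces of $P$ are spacelike. A face is future-directed (resp. past-directed) if its outward-pointing unit normal is future-pointing (resp. past-pointing). The edges separating future-directed from past-directed faces form a Hamiltonian cycle of the 1-skeleton, called the equator of $P$. *)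

(* Defs.v *)
(* The real numbers are an arbitrary R : realType. *)
From mathcomp Require Import all_boot all_order all_algebra.
From mathcomp Require Import all_classical all_reals.
From mathcomp Require Import topology normedtype.

Set Implicit Arguments.
Unset Strict Implicit.
Unset Printing Implicit Defensive.

Import Order.TTheory GRing.Theory Num.Theory numFieldNormedType.Exports.

Local Open Scope classical_set_scope.
Local Open Scope ring_scope.

(* A finite simple graph is a symmetric irreflexive relation e on a finType. *)

(* The bound on the number of remaining vertices rules out the single point
   and, by convention, the graph without vertices. *)
Definition three_connected (T : finType) (e : rel T) : Prop :=
  forall S : {set T}, (#|S| <= 2)%N ->
    (1 < #|~: S|)%N /\
    forall x y : T, x \notin S -> y \notin S ->
      connect [rel u v | [&& u \notin S, v \notin S & e u v]] x y.

(* The edge uv is drawn as the simple arc [arc u v], parametrized from u to v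
   by [0, 1]; [arc v u] is the same arc run backwards. *)
Definition plane_drawing (R : realType) (T : finType) (e : rel T)
    (pt : T -> R * R) (arc : T -> T -> R -> R * R) : Prop :=
  [/\ injective pt,
      forall u v, e u v ->
        [/\ {within [set` `[0 : R, 1]], continuous (arc u v)},
            {in `[0 : R, 1] &, injective (arc u v)},
            arc u v 0 = pt u, arc u v 1 = pt v
          & {in `[0 : R, 1], forall t, arc v u t = arc u v (1 - t)}],
      forall u v w, e u v -> {in `]0 : R, 1[, forall t, arc u v t <> pt w}
    & forall u v u' v', e u v -> e u' v' ->
        {in `]0 : R, 1[ &, forall s t, arc u v s = arc u' v' t ->
          (u = u' /\ v = v') \/ (u = v' /\ v = u')}].

Definition planar (R : realType) (T : finType) (e : rel T) : Prop :=
  exists (pt : T -> R * R) (arc : T -> T -> R -> R * R),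
    plane_drawing e pt arc.

(* Without the bound on the size, a single edge run back and forth would be
   a cycle of length 2. *)
Definition hamiltonian_cycle (T : finType) (e : rel T) (c : seq T) : Prop :=
  [/\ (2 < size c)%N, ucycle e c & forall x : T, x \in c].

Definition cycle_edge (T : eqType) (c : seq T) : rel T :=
  [rel u v | [&& u \in c, v \in c & (next c u == v) || (next c v == u)]].

(* The coordinates x_1, ..., x_4 have indices 0, ..., 3. *)
Definition ip22 (R : realType) (x y : 'rV[R]_4) : R :=
  x 0 0 * y 0 0 + x 0 1 * y 0 1 - x 0 2 * y 0 2 - x 0 3 * y 0 3.

Definition RP3 (R : realType) := {L : {vspace 'rV[R]_4} | \dim L == 1%N}.

Definition AdS3 (R : realType) : set (RP3 R) :=
  [set p : RP3 R | exists2 x, x \in val p & ip22 x x < 0].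

(* An affine chart of RP3 is the complement of a projective plane, i.e. of
   the kernel of a linear form phi; it is identified with the affine
   hyperplane phi = 1 of R^4. *)
Definition in_chart (R : realType) (phi : 'Hom('rV[R]_4, R^o)) (X : set (RP3 R))
    : Prop :=
  forall p, X p -> ~~ (val p <= lker phi)%VS.

Definition chart_image (R : realType) (phi : 'Hom('rV[R]_4, R^o))
    (X : set (RP3 R)) : set 'rV[R]_4 :=
  [set x | phi x = 1 /\ exists2 p, X p & x \in val p].

Definition convex_hull (R : realType) (s : seq 'rV[R]_4) : set 'rV[R]_4 :=
  [set x | exists w : 'I_(size s) -> R,
     [/\ forall i, 0 <= w i, \sum_i w i = 1 & x = \sum_i w i *: s`_i]].

Definition spans (R : realType) (X : set (RP3 R)) (V : {vspace 'rV[R]_4}) : Prop :=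
  (forall p, X p -> (val p <= V)%VS) /\
  forall W : {vspace 'rV[R]_4},
    (forall p, X p -> (val p <= W)%VS) -> (V <= W)%VS.

(* Convex polyhedra in RP3 with nonempty interior (equivalently, spanning
   RP3).  The chart is part of the data, but none of the notions below
   depends on which chart containing the polyhedron is used. *)
Record polyhedron (R : realType) := Polyhedron {
  body : set (RP3 R);
  chart : 'Hom('rV[R]_4, R^o);
  body_in_chart : in_chart chart body;
  body_convex : exists s : seq 'rV[R]_4, chart_image chart body = convex_hull s;
  body_solid : spans body fullv
}.

(* Affine functions on the chart are the restrictions of linear forms l on
   R^4, so this says that the plane l = 0 supports P along F. *)
Definition supports (R : realType) (P : polyhedron R)
    (l : 'Hom('rV[R]_4, R^o)) (F : set (RP3 R)) : Prop :=
  (forall x, chart_image (chart P) (body P) x -> 0 <= l x) /\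
  F = [set p : RP3 R | body P p /\ (val p <= lker l)%VS].

Definition face_of_dim (R : realType) (P : polyhedron R) (k : nat)
    (F : set (RP3 R)) : Prop :=
  (exists l, supports P l F) /\ (exists2 V, spans F V & \dim V = k.+1).

Definition is_vertex (R : realType) (P : polyhedron R) (p : RP3 R) : Prop :=
  face_of_dim P 0 [set p].
Definition is_edge (R : realType) (P : polyhedron R) (E : set (RP3 R)) : Prop :=
  face_of_dim P 1 E.
Definition is_face (R : realType) (P : polyhedron R) (F : set (RP3 R)) : Prop :=
  face_of_dim P 2 F.

Definition edge_joins (R : realType) (P : polyhedron R) (E : set (RP3 R))
    (p q : RP3 R) : Prop :=
  [/\ is_edge P E, is_vertex P p /\ is_vertex P q, p <> q & E p /\ E q].

Definition hyperideal_AdS_polyhedron (R : realType) (P' : polyhedron R)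
    (P : set (RP3 R)) : Prop :=
  [/\ P = body P' `&` @AdS3 R,
      forall p, is_vertex P' p -> ~ AdS3 p
    & forall E, is_edge P' E -> E `&` @AdS3 R !=set0].

(* A tangent vector of AdS3 at [x], with ip22 x x = -1, is a vector v with
   ip22 x v = 0, where (x, v) and (- x, - v) are identified.  The time
   orientation is given by the timelike vector field
   x |-> (0, 0, - x_4, x_3), which is compatible with this identification;
   a timelike vector is in the same cone as this field iff their product is
   negative. *)
Definition time_field (R : realType) (x : 'rV[R]_4) : 'rV[R]_4 :=
  x 0 2 *: delta_mx 0 3 - x 0 3 *: delta_mx 0 2.

Definition timelike_tangent (R : realType) (x v : 'rV[R]_4) : Prop :=
  ip22 x v = 0 /\ ip22 v v < 0.

Definition future_pointing (R : realType) (x v : 'rV[R]_4) : Prop :=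
  timelike_tangent x v /\ ip22 v (time_field x) < 0.
Definition past_pointing (R : realType) (x v : 'rV[R]_4) : Prop :=
  timelike_tangent x v /\ 0 < ip22 v (time_field x).

(* The points of F in AdS3, lifted to the quadric on the side of the origin
   on which the chart form is positive; on that side P lies in l >= 0 for
   every supporting form l. *)
Definition quadric_lift (R : realType) (P : polyhedron R) (F : set (RP3 R))
    : set 'rV[R]_4 :=
  [set x | [/\ ip22 x x = -1, 0 < chart P x & exists2 p, F p & x \in val p]].

(* The unit normal of F is the same vector of R^4 at all points of
   quadric_lift P F.  It points out of P when it points out of the
   half-space l >= 0 that is bounded by the plane of F and contains P. *)
Definition outward_unit_normal (R : realType) (P : polyhedron R)
    (F : set (RP3 R)) (n : 'rV[R]_4) : Prop :=
  [/\ ip22 n n = -1,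
      forall p y, F p -> y \in val p -> ip22 n y = 0
    & exists2 l, supports P l F & l n < 0].

Definition future_directed (R : realType) (P : polyhedron R) (F : set (RP3 R))
    : Prop :=
  is_face P F /\ exists2 n, outward_unit_normal P F n &
    forall x, quadric_lift P F x -> future_pointing x n.
Definition past_directed (R : realType) (P : polyhedron R) (F : set (RP3 R))
    : Prop :=
  is_face P F /\ exists2 n, outward_unit_normal P F n &
    forall x, quadric_lift P F x -> past_pointing x n.

Definition equator_edge (R : realType) (P : polyhedron R) (E : set (RP3 R))
    : Prop :=
  is_edge P E /\ exists F1 F2 : set (RP3 R),
    [/\ future_directed P F1, past_directed P F2, E `<=` F1 & E `<=` F2].

Definition skeleton_iso (R : realType) (T : finType) (e : rel T)
    (P : polyhedron R) (f : T -> RP3 R) : Prop :=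
  [/\ injective f,
      range f = [set p : RP3 R | is_vertex P p]
    & forall u v, e u v <-> exists E, edge_joins P E (f u) (f v)].

Definition carries_to_equator (R : realType) (T : finType) (c : seq T)
    (P : polyhedron R) (f : T -> RP3 R) : Prop :=
  forall u v, cycle_edge c u v <->
    exists2 E, equator_edge P E & edge_joins P E (f u) (f v).

(* Main.v *)
Require Import Defs.
From HB Require Import structures.
From mathcomp Require Import all_boot all_order all_algebra.
From mathcomp Require Import all_classical all_reals.
From mathcomp Require Import topology normedtype sequences derive.
From mathcomp Require Import zify ring lra.
From Stdlib Require Import Btauto.

Set Implicit Arguments.
Unset Strict Implicit.
Unset Printing Implicit Defensive.

Import Order.TTheory GRing.Theory Num.Theory numFieldNormedType.Exports.

Local Open Scope classical_set_scope.
Local Open Scope ring_scope.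

(** The polyhedron is built nearly flat, over a convex polygon that is
circumscribed about a conic.  The bilinear form splits as
[bil y y - h ^ 2], with [y] in R^3 and [bil] of signature (2, 1), and the
vertices are [(q_k, h_k)], where the [q_k] are the corners of a polygon whose
sides are tangent to the conic [bil = 0], numbered along the Hamiltonian cycle
gamma.  The convex hull of these points has the polygon as its silhouette, and
its lower and upper boundaries are the convex and concave roofs of the heights
[h_k].  It remains to find heights for which the lower roof is folded along
the edges of the graph on one side of gamma, and the upper roof along those on
the other side.

Planarity enters by counting crossings modulo 2, in the way of the
Hanani-Tutte theorem: the edges off gamma (chords) fall into two classes such
that no two chords of one class interlace along gamma
([hamiltonian_chord_sides]).  The side of a chord is defined from winding
parities of arcs about vertices, and two interlacing chords have different
sides because their arcs are disjoint ([disjoint_arcs_parity],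
[chord_side_crossing]).

For non-crossing chords [A], the function [roof y = sum |det3 q_i q_j y|] over
the chords [ij] of [A] is convex and folded exactly along the chords, so that
heights [h_k = roof (q_k)] have the prescribed lower boundary
([roof_lower_hull]).  If [A] and [B] are the two classes, the heights
[roof_A (q_k)] produce the right lower boundary and the heights
[- roof_B (q_k)] the right upper one.  Both are obtained at once when the roof
of all chords, [roof_A + roof_B], agrees with a linear form at the [q_k]: then
the two families of heights differ by a linear form, which changes neither
boundary ([lower_hull_affine]).

Linearity of the total roof is an equilibrium condition on the polygon, in the
spirit of the Maxwell-Cremona correspondence: the slopes of the roof on
consecutive sides differ by the force that the chords exert at the common
corner, and the roof is linear when these forces are balanced by tensions
along the sides ([roof_equilibrium]).  These are the critical equations of a
function of the contact points [x_0 < ... < x_(n-1)] of the sides, namely the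
sum over the chords [ij] of a cross-ratio, which is
[- (1 + bil q_i q_j) / 2] ([cost], [cost_moved]).  In hyperbolic terms, the
contact points span an ideal polygon, and the summand measures the distance
between its sides [i] and [j].

The function attains a minimum.  Two interlacing pairs of sides have
cross-ratios of product at least 1 ([cratio_crossing]), so no pair of sides
can be close together if it is interlaced by a chord whose cross-ratio is
bounded.  In a 3-connected graph every pair of non-consecutive corners is
interlaced by a chord, as otherwise removing the two corners would disconnect
the graph ([gamma_chord_linked]).  Hence the contact points stay apart where
the cost is bounded, once three of them are fixed ([gap_lower_bound]), and a
minimum exists by compactness ([critical_configuration]).

The polygon being circumscribed has two more effects.  The [q_k] satisfy
[bil q_k q_k = 1], so that the vertices lie outside AdS for small heights, and
[bil q_i q_j <= -1] for distinct [i], [j], so that all edges meet AdS for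
positive heights.  Adding a multiple of the third coordinate to the heights
and scaling them down makes all heights positive and small and all faces
spacelike; the lower faces are then past-directed and the upper faces
future-directed, so that the equator is the silhouette, that is gamma
([equator_of_polytope], [realization]). *)

(** * The two sides of a cycle, from crossing parities *)

Lemma addb_xorb a b : a (+) b = xorb a b.
Proof. by case: a; case: b. Qed.

Section HananiTutte.
Local Open Scope nat_scope.

Variables (n : nat) (E : rel nat) (Y : nat -> nat -> nat -> bool).

Hypothesis E_next : forall i, i.+1 < n -> E i i.+1.
Hypothesis E_wrap : E 0 n.-1.
(* [Y i j k] is the parity with which the edge [ij] sweeps over the vertex [k]
when the drawing is deformed to the one with vertices on a convex curve and
straight edges.  Edges [ij] and [kl] that are disjoint in the drawing cross in
the straight picture with the parity on the left; the right-hand side is 1 iff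
the index pairs interlace. *)
Hypothesis Y_interlace : forall i j k l, i < j < n -> k < l < n ->
  E i j -> E k l -> [&& i != k, i != l, j != k & j != l] ->
  Y i j k (+) Y i j l (+) (Y k l i (+) Y k l j) =
  (k < i) (+) (l < i) (+) ((k < j) (+) (l < j)).

Definition cycle_parity i v := if i.+1 < n then Y i i.+1 v else Y 0 n.-1 v.
Definition cycle_sum v k := \big[addb/false]_(0 <= i < k) cycle_parity i v.
(** As [k] runs along a stretch of the cycle that avoids [p] and [r], the
changes of the two parts of this sum are the two halves of the crossing parity
of the chord [pr] with the edges of the cycle, so the offset stays constant. *)
Definition chord_offset p r k := Y p r k (+) (cycle_sum p k (+) cycle_sum r k).

(** The jump of the offset between the two stretches of the cycle cut out by
the chord, up to the total sum of the cycle at [r].  If [r] is the last index,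
the stretch after [r] is reached at index 0, and [chord_offset_wrap] accounts
for the different correction. *)
Definition chord_side p r :=
  chord_offset p r p.+1 (+)
  (if r.+1 < n then chord_offset p r r.+1 (+) cycle_sum r n
   else chord_offset p r 0 (+) cycle_sum p n).

Lemma cycle_sum0 v : cycle_sum v 0 = false.
Proof. by rewrite /cycle_sum big_geq. Qed.

Lemma cycle_sumS v k : cycle_sum v k.+1 = cycle_sum v k (+) cycle_parity k v.
Proof. by rewrite /cycle_sum big_nat_recr. Qed.

Lemma chord_offset_step p r k : p < r < n -> E p r -> k.+1 < n ->
  [&& p != k, p != k.+1, r != k & r != k.+1] ->
  chord_offset p r k.+1 = chord_offset p r k.
Proof.
move=> pr Epr kn dis.
have kk : k < k.+1 < n by rewrite ltnSn.
have H := Y_interlace pr kk Epr (E_next kn) dis.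
have -> : chord_offset p r k.+1 = chord_offset p r k (+)
    (Y p r k (+) Y p r k.+1 (+) (Y k k.+1 p (+) Y k k.+1 r)).
  rewrite /chord_offset !cycle_sumS /cycle_parity kn.
  by case: (Y p r k); case: (Y p r k.+1); case: (cycle_sum p k);
     case: (cycle_sum r k); case: (Y k k.+1 p); case: (Y k k.+1 r).
have e1 : (k < p) = (k.+1 < p) by lia.
have e2 : (k < r) = (k.+1 < r) by lia.
by rewrite H e1 e2 !addbb addbF.
Qed.

Lemma chord_offset_const p r u w : p < r < n -> E p r -> u <= w -> w < n ->
  (forall k, u <= k <= w -> (k != p) && (k != r)) ->
  chord_offset p r u = chord_offset p r w.
Proof.
move=> pr Epr; elim: w => [|w IH] uw wn H; first by have -> : u = 0 by lia.
move: uw; rewrite leq_eqVlt => /orP[/eqP -> //|uw].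
rewrite IH //; last by move=> k kw; apply: H; lia.
  have /andP[h1 h2] : (w != p) && (w != r) by apply: H; lia.
  have /andP[h3 h4] : (w.+1 != p) && (w.+1 != r) by apply: H; lia.
  by rewrite chord_offset_step //; apply/and4P; split; rewrite eq_sym.
lia.
Qed.

Lemma chord_offset_wrap p r : 0 < p < r -> r.+1 < n -> E p r ->
  chord_offset p r n.-1 = chord_offset p r 0 (+) (cycle_sum p n (+) cycle_sum r n).
Proof.
move=> pr rn Epr.
have h0 : 0 < n.-1 < n by lia.
have prn : p < r < n by lia.
have H := Y_interlace prn h0 Epr E_wrap ltac:(lia).
have e1 : (n.-1 < p) = false by lia.
have e2 : (n.-1 < r) = false by lia.
have e3 : (0 < p) by lia.
have e4 : (0 < r) by lia.
move: H; rewrite e1 e2 e3 e4 /= /chord_offset.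
have en : n = n.-1.+1 by lia.
have eS v : cycle_sum v n = cycle_sum v n.-1 (+) Y 0 n.-1 v.
  by rewrite {1}en cycle_sumS /cycle_parity -en ltnn.
rewrite !eS !cycle_sum0.
case: (Y p r 0); case: (Y p r n.-1); case: (Y 0 n.-1 p); case: (Y 0 n.-1 r);
  by case: (cycle_sum p _); case: (cycle_sum r _).
Qed.

(** Two disjoint edges of the cycle do not interlace, so that their crossing
parity vanishes. *)
Lemma cycle_parity_step i j : i < n -> j.+1 < n ->
  [&& i != j, i != j.+1, i.+1 != j & (i.+1 < n) || (j != 0)] ->
  cycle_parity i j (+) cycle_parity i j.+1 (+) (cycle_parity j i (+) cycle_parity j (if i.+1 < n
    then i.+1 else 0))
  = false.
Proof.
move=> i_n jn dis; rewrite /cycle_parity jn.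
case: ltnP => i1n.
  have H := @Y_interlace i i.+1 j j.+1 ltac:(lia) ltac:(lia) (E_next i1n)
    (E_next jn) ltac:(lia).
  rewrite H.
  have -> : (j < i) = (j < i.+1) by lia.
  have -> : (j.+1 < i) = (j.+1 < i.+1) by lia.
  by case: (_ < _); case: (_ < _).
have H := @Y_interlace 0 n.-1 j j.+1 ltac:(lia) ltac:(lia) E_wrap
    (E_next jn) ltac:(lia).
have ei : i = n.-1 by lia.
move: H; rewrite ei; have -> : (j < n.-1) by lia.
have -> : (j.+1 < n.-1) by lia.
rewrite /=.
by case: (Y 0 n.-1 j); case: (Y 0 n.-1 j.+1); case: (Y j j.+1 0); case: (Y j j.+1 _).
Qed.

Lemma cycle_parity_arc i b c : i < n -> b <= c -> c < n ->
  (forall k, b <= k <= c -> [&& i != k, i.+1 != k & (i.+1 < n) || (k != 0)]) ->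
  cycle_parity i b (+) cycle_parity i c (+) (cycle_sum i b (+) cycle_sum i c (+)
   (cycle_sum (if i.+1 < n then i.+1 else 0) b (+)
    cycle_sum (if i.+1 < n then i.+1 else 0) c)) = false.
Proof.
move=> i_n; elim: c => [|c IH] bc cn H.
  have -> : b = 0 by lia.
  by rewrite !addbb.
move: bc; rewrite leq_eqVlt => /orP[/eqP -> |bc]; first by rewrite !addbb.
have h := IH bc (ltnW cn) ltac:(by move=> k kw; apply: H; lia).
have h1 : [&& i != c, i != c.+1, i.+1 != c & (i.+1 < n) || (c != 0)].
  by move: (H c ltac:(lia)) (H c.+1 ltac:(lia)); clear; lia.
have h2 := cycle_parity_step i_n cn h1.
move: h h2; rewrite !cycle_sumS; set u := if _ then _ else _ => h h2.
rewrite -[RHS]/(false (+) false) -{1}h -h2 !addb_xorb; btauto.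
Qed.

(** The sum over pairs of edges taken from two disjoint stretches of the cycle
telescopes to the corners of the two stretches. *)
Lemma cycle_sum_arcs a b c d : a <= b -> b < c -> c <= d -> d < n ->
  cycle_sum c a (+) cycle_sum c b (+) (cycle_sum d a (+) cycle_sum d b) (+)
  (cycle_sum a c (+) cycle_sum a d (+) (cycle_sum b c (+) cycle_sum b d)) = false.
Proof.
elim: b => [|b IH] ab bc cd dn.
  have -> : a = 0 by lia.
  by rewrite !addbb.
move: ab; rewrite leq_eqVlt => /orP[/eqP -> |ab]; first by rewrite !addbb.
have h1 := IH ab (ltnW bc) cd dn; clear IH.
have b1n : b.+1 < n by clear h1; lia.
have h2 := @cycle_parity_arc b c d ltac:(clear h1; lia) cd dn ltac:(clear h1; lia).
move: h2; rewrite b1n => h2.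
rewrite !cycle_sumS -[RHS]/(false (+) false) -{1}h1 -h2 !addb_xorb; btauto.
Qed.

(** The same relation for the stretch from [d] through the end of the numbering
back to 0. *)
Lemma cycle_sum_wrap b c d : 0 < b -> b <= c -> c < d -> d < n ->
  cycle_sum d b (+) cycle_sum d c (+) (cycle_sum 0 b (+) cycle_sum 0 c) (+)
  (cycle_sum b n (+) cycle_sum b d (+) (cycle_sum c n (+) cycle_sum c d)) = false.
Proof.
move=> b0 bc cd dn.
have en : n.-1.+1 = n by lia.
have eS v : cycle_sum v n = cycle_sum v n.-1 (+) cycle_parity n.-1 v by rewrite -cycle_sumS en.
have h2 := @cycle_parity_arc n.-1 b c ltac:(lia) bc ltac:(lia) ltac:(lia).
move: h2; rewrite en ltnn => h2.
have h1 := @cycle_sum_arcs b c d n.-1 bc cd ltac:(clear h2; lia) ltac:(clear h2; lia).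
rewrite !eS -[RHS]/(false (+) false) -{1}h1 -h2 !addb_xorb; btauto.
Qed.

(** The crossing parity of two interlacing chords is odd.  The sides of the two
chords add up to this parity and to sums along the cycle, and these sums cancel
by the relations between the four stretches that the ends of the chords cut
out. *)
Lemma chord_side_crossing a b c d : a < b -> b < c -> c < d -> d < n ->
  E a c -> E b d -> chord_side a c != chord_side b d.
Proof.
move=> ab bc cd dn Eac Ebd.
have ac : a < c < n by lia.
have bdn : b < d < n by lia.
have [le_ab le_cd] : a <= b /\ c <= d by lia.
have [bn b0] : b < n /\ 0 < b by lia.
have e1 : (b < a) = false by lia.
have e2 : (d < a) = false by lia.
have e3 : (d < c) = false by lia.
have h0 := Y_interlace ac bdn Eac Ebd ltac:(lia).
have side_bd : chord_side b d =
    chord_offset b d c (+) (chord_offset b d a (+) cycle_sum b n).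
  clear h0; rewrite /chord_side.
  rewrite (chord_offset_const bdn Ebd bc (ltn_trans cd dn) ltac:(lia)).
  rewrite -(chord_offset_const bdn Ebd (leq0n a) (ltn_trans ab bn) ltac:(lia)).
  case: ltnP => // dn1.
  rewrite (chord_offset_const bdn Ebd (u := d.+1) (w := n.-1)
    ltac:(lia) ltac:(lia) ltac:(lia)).
  rewrite chord_offset_wrap ?b0 ?(ltn_trans bc cd) //.
  rewrite !addb_xorb; btauto.
have side_ac : chord_side a c =
    chord_offset a c b (+) (chord_offset a c d (+) cycle_sum c n).
  clear h0 side_bd; rewrite /chord_side.
  have -> : c.+1 < n by lia.
  rewrite (chord_offset_const ac Eac ab bn ltac:(lia)).
  by rewrite (chord_offset_const ac Eac cd dn ltac:(lia)).
have h1 := cycle_sum_arcs le_ab bc le_cd dn.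
have h2 := @cycle_sum_arcs 0 a b c isT ab (ltnW bc) (ltn_trans cd dn).
have h3 := cycle_sum_wrap b0 (ltnW bc) cd dn.
move: h0 h2; rewrite e1 e2 e3 bc !cycle_sum0 => h0 h2.
rewrite -negb_add negbK side_ac side_bd /is_true.
rewrite -[RHS]/(false (+) false (+) (false (+) true)) -{1}h1 -{1}h2 -{1}h3.
rewrite -[true in RHS]/(false (+) false (+) (true (+) false)) -h0 /chord_offset.
rewrite !addb_xorb; btauto.
Qed.
End HananiTutte.

(** * Winding numbers modulo 2 *)

Section Winding.
Variable R : realType.
Implicit Types (z w : R * R) (i : bool * bool).

Definition coord_half i z : bool :=
  let x := if i.1 then z.1 else z.2 in if i.2 then 0 < x else x < 0.

(** The half-axes are shared out so that exactly one of [z] and [- z] is upper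
when [z != 0]. *)
Definition upper z : bool := (0 < z.2) || (z.2 == 0) && (0 < z.1).

(** For [z] and [w] in a common coordinate half-plane, this says whether the
segment from [z] to [w] crosses the positive horizontal half-axis; summed along
a closed path of such steps, it is the winding number about 0 modulo 2. *)
Definition crosses z w : bool := (upper z (+) upper w) && (0 < z.1).

Lemma upperN z : z != 0 -> upper (- z) = ~~ upper z.
Proof.
case: z => x y z0; rewrite /upper /= oppr_gt0 oppr_eq0 oppr_gt0.
case: (ltgtP y 0) => //= y0; case: (ltgtP x 0) => //= x0.
by move: z0; rewrite x0 y0 eqxx.
Qed.

Lemma crosses_half i z w : coord_half i z -> coord_half i w ->
  crosses z w = (upper z (+) upper w) && i.1 && i.2.
Proof.
case: z w i => [x y] [x' y'] [[] []]; rewrite /coord_half /crosses /upper /=.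
- by move=> ->; rewrite !andbT.
- by move=> x0 _; rewrite (ltNge 0 x) (ltW x0) !andbF.
- by move=> -> ->.
- by move=> y0 y'0; rewrite (ltNge 0 y) (ltNge 0 y') !ltW // !lt_eqF.
Qed.

(** A closed path inside a half-plane does not wind about the origin. *)
Lemma crosses_cell i z1 z2 z3 z4 :
  coord_half i z1 -> coord_half i z2 -> coord_half i z3 -> coord_half i z4 ->
  crosses z1 z2 (+) crosses z3 z4 = crosses z1 z3 (+) crosses z2 z4.
Proof.
move=> h1 h2 h3 h4; rewrite !(@crosses_half i) //.
by case: (i.1 && i.2) => //; rewrite -?andbA;
  case: i.1; case: i.2; rewrite /= ?andbF ?andbT //;
  case: (upper z1); case: (upper z2); case: (upper z3); case: (upper z4).
Qed.

(** A step between upper and lower points crosses either the positive or the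
negative horizontal half-axis. *)
Lemma crossesN i z w : coord_half i z -> coord_half i w ->
  crosses (- z) (- w) = crosses z w (+) (upper z (+) upper w).
Proof.
have half0 j u : coord_half j u -> u != 0.
  by apply: contraTneq => ->; rewrite /coord_half /=; case: j => [[] []] /=; rewrite ltxx.
have halfN u : coord_half i u -> coord_half (i.1, ~~ i.2) (- u).
  by rewrite /coord_half /=; case: i => [[] []] /=; rewrite ?oppr_gt0 ?oppr_lt0.
move=> hz hw; rewrite (crosses_half (halfN _ hz) (halfN _ hw)) (crosses_half hz hw) /=.
rewrite !upperN ?(half0 _ _ hz) ?(half0 _ _ hw) //; move: hz hw; clear half0 halfN;
  case: i => [[] []] /=; rewrite /coord_half /upper /= ?andbF ?andbT.
- by case: (_ || _); case: (_ || _).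
- by case: (_ || _); case: (_ || _).
- by move=> -> ->.
- by move=> y0 y'0; rewrite (ltNge 0 z.2) (ltNge 0 w.2) !ltW // !lt_eqF.
Qed.

Definition half_cell (N : nat) (z : nat -> nat -> R * R) := forall k l, (k < N)%N -> (l < N)%N ->
  exists i, [/\ coord_half i (z k l), coord_half i (z k.+1 l),
                coord_half i (z k l.+1) & coord_half i (z k.+1 l.+1)].

(** Homotopy invariance in discrete form: the boundary parities of the cells of
a grid add up to the parity of the boundary of the grid. *)
Lemma crosses_grid N (z : nat -> nat -> R * R) : half_cell N z -> (0 < N)%N ->
  \big[addb/false]_(0 <= k < N) crosses (z k 0%N) (z k.+1 0%N) (+)
  \big[addb/false]_(0 <= k < N) crosses (z k N) (z k.+1 N) =
  \big[addb/false]_(0 <= l < N) crosses (z 0%N l) (z 0%N l.+1) (+)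
  \big[addb/false]_(0 <= l < N) crosses (z N l) (z N l.+1).
Proof.
move=> hz N0.
have row l m : (l < N)%N -> (m <= N)%N ->
  \big[addb/false]_(0 <= k < m) crosses (z k l) (z k.+1 l) (+)
  \big[addb/false]_(0 <= k < m) crosses (z k l.+1) (z k.+1 l.+1) =
  crosses (z 0%N l) (z 0%N l.+1) (+) crosses (z m l) (z m l.+1).
  move=> lN; elim: m => [|m IH] mN; first by rewrite !big_geq //= addbb.
  rewrite !big_nat_recr //=.
  have [i [h1 h2 h3 h4]] := hz m l mN lN.
  rewrite addbACA IH ?(ltnW mN) // (crosses_cell h1 h2 h3 h4).
  by rewrite !addb_xorb; btauto.
have cols m : (m <= N)%N ->
  \big[addb/false]_(0 <= k < N) crosses (z k 0%N) (z k.+1 0%N) (+)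
  \big[addb/false]_(0 <= k < N) crosses (z k m) (z k.+1 m) =
  \big[addb/false]_(0 <= l < m) crosses (z 0%N l) (z 0%N l.+1) (+)
  \big[addb/false]_(0 <= l < m) crosses (z N l) (z N l.+1).
  elim: m => [|m IH] mN; first by rewrite addbb !big_geq.
  rewrite !big_nat_recr //= addbACA -IH ?(ltnW mN) // -row //.
  by rewrite !addb_xorb; btauto.
exact: cols.
Qed.

Lemma crosses_sumN N (z : nat -> R * R) :
  (forall k, (k < N)%N -> exists i, coord_half i (z k) && coord_half i (z k.+1)) ->
  \big[addb/false]_(0 <= k < N) crosses (- z k) (- z k.+1) =
  \big[addb/false]_(0 <= k < N) crosses (z k) (z k.+1) (+)
  (upper (z 0%N) (+) upper (z N)).
Proof.
elim: N => [|N IH] hz; first by rewrite !big_geq //= addbb.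
rewrite !big_nat_recr //= IH; last by move=> k kN; apply: hz; apply: ltnW.
have [i /andP[h1 h2]] := hz N (ltnSn N).
rewrite (crossesN h1 h2) !addb_xorb; btauto.
Qed.

Lemma abs_lt (x y : R) : `|x| < y -> - y < x /\ x < y.
Proof. by rewrite ltr_norml => /andP. Qed.

Lemma dist_lt_half (x y z r d e : R) : `|x - y| < d -> d < r -> `|y - z| < r ->
  r + r <= e -> `|x - z| < e.
Proof.
move=> /abs_lt[? ?] ? /abs_lt[? ?] ?; rewrite ltr_norml; apply/andP; split; lra.
Qed.

Let I01 := [set` `[0 : R, 1]].

Lemma arc_delta (phi : R -> R * R) : {within I01, continuous phi} ->
  forall s, I01 s -> forall eps, 0 < eps -> exists2 r, 0 < r &
    forall s', I01 s' -> `|s' - s| < r ->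
      `|(phi s').1 - (phi s).1| < eps /\ `|(phi s').2 - (phi s).2| < eps.
Proof.
move=> /subspace_continuousP cphi s s01 eps eps0.
have /cvg_ballP/(_ _ eps0) := cphi s s01.
rewrite /within /= => -[r /= r0 hr]; exists r => // s' s'01 ss'.
have [] := hr s' _ s'01; first by rewrite /ball /= distrC.
by rewrite /ball /= => h1 h2; split; rewrite distrC.
Qed.

(** The difference of two disjoint arcs is a map of the square into the
punctured plane; by compactness there is a mesh size below which it maps every
cell into one coordinate half-plane. *)
Lemma arcs_mesh (phi psi : R -> R * R) :
  {within I01, continuous phi} -> {within I01, continuous psi} ->
  (forall s t, I01 s -> I01 t -> phi s <> psi t) ->
  exists2 d, 0 < d & forall s t, I01 s -> I01 t -> exists i,
    forall s' t', I01 s' -> I01 t' -> `|s' - s| < d -> `|t' - t| < d ->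
      coord_half i (phi s' - psi t').
Proof.
move=> cphi cpsi dis.
pose P (d : R) (p : R * R) := I01 p.1 -> I01 p.2 -> exists i,
    forall s' t', I01 s' -> I01 t' -> `|s' - p.1| < d -> `|t' - p.2| < d ->
      coord_half i (phi s' - psi t').
have cK : compact (I01 `*` I01) by apply: compact_setX; exact: segment_compact.
move/compact_near_coveringP: cK => /(_ R (0 : R)^'+ P _) [].
  move=> [s t] [/= s01 t01].
  have [i [m m0 hm]] : exists i, exists2 m : R, 0 < m & forall z,
      `|z.1 - (phi s - psi t).1| < m -> `|z.2 - (phi s - psi t).2| < m -> coord_half i z.
    have : phi s - psi t != 0 by rewrite subr_eq0; apply/eqP/dis.
    move: (phi s - psi t) => z0.
    have [z1|z1|z1] := ltgtP z0.1 0 => z00.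
    - by exists (true, false), (- z0.1); [lra|move=> z /abs_lt[? ?] _; rewrite /coord_half /=; lra].
    - by exists (true, true), z0.1 => // z /abs_lt[? ?] _; rewrite /coord_half /=; lra.
    have [z2|z2|z2] := ltgtP z0.2 0.
    - by exists (false, false), (- z0.2); [lra|move=> z _ /abs_lt[? ?]; rewrite /coord_half /=;
      lra].
    - by exists (false, true), z0.2 => // z _ /abs_lt[? ?]; rewrite /coord_half /=; lra.
    by move: z00 z1 z2; rewrite -pair_eqE /= => /[swap] -> /[swap] ->; rewrite eqxx.
  have m20 : 0 < m / 2 by lra.
  have [r1 r10 h1] := arc_delta cphi s01 m20.
  have [r2 r20 h2] := arc_delta cpsi t01 m20.
  pose r := Num.min r1 r2 / 2.
  have r0 : 0 < r by rewrite divr_gt0 // lt_min r10.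
  have [rr1 rr2] : r + r <= r1 /\ r + r <= r2.
    rewrite /r -splitr; split; rewrite ge_min lexx //= orbT //.
  near=> p d => /= p101 p201.
  exists i => s' t' s'01 t'01 ss' tt'.
  have dr : d < r by near: d; exact: nbhs_right_lt.
  have [ps pt] : `|p.1 - s| < r /\ `|p.2 - t| < r.
    have : ball (s, t) r p by near: p; exact: nbhsx_ballx.
    by case=> /=; rewrite /ball /= => *; split; rewrite distrC.
  have [a1 a2] := h1 s' s'01 (dist_lt_half ss' dr ps rr1).
  have [b1 b2] := h2 t' t'01 (dist_lt_half tt' dr pt rr2).
  move: a1 a2 b1 b2 => /abs_lt[? ?] /abs_lt[? ?] /abs_lt[? ?] /abs_lt[? ?].
  by apply: hm; rewrite ltr_norml /=; apply/andP; split; lra.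
move=> d /= d0 hd.
have := hd (d / 2).
have dd : ball 0 d (d / 2) by rewrite /ball /= sub0r normrN gtr0_norm; lra.
move=> /(_ dd ltac:(lra)) sub; exists (d / 2); first by lra.
by move=> s t s01 t01; exact: (sub (s, t)).
Unshelve. all: end_near.
Qed.

End Winding.

(** * Crossing chords lie on different sides of the cycle *)

Lemma next_nth_uniq (T : eqType) (x0 : T) (c : seq T) i : uniq c -> (i < size c)%N ->
  next c (nth x0 c i) = nth x0 c (if (i.+1 < size c)%N then i.+1 else 0%N).
Proof.
move=> uniq_c ic; rewrite next_nth mem_nth // index_uniq //.
case: c uniq_c ic => // y p _ /=; rewrite ltnS leq_eqVlt => /orP[/eqP ->|ip].
  by rewrite nth_default // ltnn.
by rewrite ltnS ip /=; apply: set_nth_default.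
Qed.

Section TwoSides.
Variable R : realType.

Let I01 := [set` `[0 : R, 1]].

Definition crossing_parity N (phi : R -> R * R) (p : R * R) : bool :=
  \big[addb/false]_(0 <= k < N)
     crosses (phi (k%:R / N%:R) - p) (phi (k.+1%:R / N%:R) - p).

(** The map [phi s - psi t] from the square to the punctured plane does not wind
about 0 along the boundary of the square.  Two sides of the square show [phi]
as seen from the ends of [psi]; the other two show [psi] as seen from the ends
of [phi], with the opposite sign, which [crosses_sumN] corrects by the terms on
the right. *)
Lemma disjoint_arcs_parity (phi psi : R -> R * R) :
  {within I01, continuous phi} -> {within I01, continuous psi} ->
  (forall s t, I01 s -> I01 t -> phi s <> psi t) ->
  \forall N \near \oo,
    crossing_parity N phi (psi 0) (+) crossing_parity N phi (psi 1) (+)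
    (crossing_parity N psi (phi 0) (+) crossing_parity N psi (phi 1)) =
    upper (phi 0 - psi 0) (+) upper (phi 0 - psi 1) (+)
    (upper (phi 1 - psi 0) (+) upper (phi 1 - psi 1)).
Proof.
move=> cphi cpsi dis.
have [d d0 hd] := arcs_mesh cphi cpsi dis.
near=> N.
have N0 : (0 < N)%N by near: N; exact: nbhs_infty_gt.
have N0R : 0 < N%:R :> R by rewrite ltr0n.
have Nd : N%:R^-1 < d.
  rewrite invf_plt ?posrE //; near: N; exact: nbhs_infty_gtr.
pose z k l := phi (k%:R / N%:R) - psi (l%:R / N%:R).
have grid01 k : (k <= N)%N -> I01 (k%:R / N%:R).
  move=> kN; rewrite /I01 /= in_itv /= divr_ge0 ?ler0n //=.
  by rewrite ler_pdivrMr // mul1r ler_nat.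
have step k : `|k.+1%:R / N%:R - k%:R / N%:R| < d :> R.
  by rewrite -mulrBl -natrB // subSnn mul1r gtr0_norm ?invr_gt0.
have zero k : `|k%:R / N%:R - k%:R / N%:R| < d :> R by rewrite subrr normr0.
have hz : half_cell N z.
  move=> k l kN lN.
  have [i hi] := hd _ _ (grid01 _ (ltnW kN)) (grid01 _ (ltnW lN)).
  by exists i; split; apply: hi => //; apply: grid01 => //; exact: ltnW.
have := crosses_grid hz N0.
have zN k : z k N = phi (k%:R / N%:R) - psi 1 by rewrite /z divff ?gt_eqF.
have Nz l : z N l = phi 1 - psi (l%:R / N%:R) by rewrite /z divff ?gt_eqF.
have z0 k : z k 0%N = phi (k%:R / N%:R) - psi 0 by rewrite /z mul0r.
have Oz l : z 0%N l = phi 0 - psi (l%:R / N%:R) by rewrite /z mul0r.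
have col0 := @crosses_sumN _ N (fun l => z 0%N l).
have colN := @crosses_sumN _ N (fun l => z N l).
have hcol0 l : (l < N)%N -> exists i, coord_half i (z 0%N l) && coord_half i (z 0%N l.+1).
  by move=> lN; have [i [h1 _ h2 _]] := hz _ _ N0 lN; exists i; rewrite h1.
have hcolN l : (l < N)%N -> exists i, coord_half i (z N l) && coord_half i (z N l.+1).
  move=> lN; have N1 : (N.-1 < N)%N by rewrite prednK.
  have [i [_ h1 _ h2]] := hz _ _ N1 lN; exists i.
  by move: h1 h2; rewrite prednK // => -> ->.
move: (col0 hcol0) (colN hcolN).
rewrite /crossing_parity.
have e1 : \big[addb/false]_(0 <= l < N) crosses (- z 0%N l) (- z 0%N l.+1) =
    \big[addb/false]_(0 <= k < N) crosses (psi (k%:R / N%:R) - phi 0)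
       (psi (k.+1%:R / N%:R) - phi 0).
  by apply: eq_bigr => l _; rewrite !Oz !opprB.
have e2 : \big[addb/false]_(0 <= l < N) crosses (- z N l) (- z N l.+1) =
    \big[addb/false]_(0 <= k < N) crosses (psi (k%:R / N%:R) - phi 1)
       (psi (k.+1%:R / N%:R) - phi 1).
  by apply: eq_bigr => l _; rewrite !Nz !opprB.
have e3 : \big[addb/false]_(0 <= l < N) crosses (z l 0%N) (z l.+1 0%N) =
    \big[addb/false]_(0 <= k < N) crosses (phi (k%:R / N%:R) - psi 0)
       (phi (k.+1%:R / N%:R) - psi 0).
  by apply: eq_bigr => l _; rewrite !z0.
have e4 : \big[addb/false]_(0 <= l < N) crosses (z l N) (z l.+1 N) =
    \big[addb/false]_(0 <= k < N) crosses (phi (k%:R / N%:R) - psi 1)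
       (phi (k.+1%:R / N%:R) - psi 1).
  by apply: eq_bigr => l _; rewrite !zN.
rewrite e1 e2 e3 e4 => -> -> ->.
rewrite !Oz !Nz mul0r divff ?gt_eqF // !addb_xorb; btauto.
Unshelve. all: end_near.
Qed.

Variables (T : finType) (e : rel T).
Hypothesis e_sym : symmetric e.

(** There are finitely many pairs of edges, so one subdivision is fine enough
for all of them. *)
Lemma independent_edges_parity pt arc : @plane_drawing R T e pt arc ->
  \forall N \near \oo, forall u v u' v' : T, e u v -> e u' v' ->
    [&& u != u', u != v', v != u' & v != v'] ->
    crossing_parity N (arc u v) (pt u') (+) crossing_parity N (arc u v) (pt v') (+)
    (crossing_parity N (arc u' v') (pt u) (+) crossing_parity N (arc u' v') (pt v)) =
    upper (pt u - pt u') (+) upper (pt u - pt v') (+)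
    (upper (pt v - pt u') (+) upper (pt v - pt v')).
Proof.
case=> ptI arcP arc_pt arc_arc.
suff H : forall q : T * T * T * T, \forall N \near \oo,
    let: (u, v, u', v') := q in e u v -> e u' v' ->
    [&& u != u', u != v', v != u' & v != v'] ->
    crossing_parity N (arc u v) (pt u') (+) crossing_parity N (arc u v) (pt v') (+)
    (crossing_parity N (arc u' v') (pt u) (+) crossing_parity N (arc u' v') (pt v)) =
    upper (pt u - pt u') (+) upper (pt u - pt v') (+)
    (upper (pt v - pt u') (+) upper (pt v - pt v')).
  have {}H := @filter_forall _ _ _ _ eventually_filter H.
  by apply: (@filterS _ _ eventually_filter _ _ _ H) => N hN u v u' v'; exact: hN (u, v, u', v').
move=> [[[u v] u'] v'].
have [euv|] := boolP (e u v); last by move=> _; apply: nearW.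
have [euv'|] := boolP (e u' v'); last by move=> _; apply: nearW.
have [/and4P[n1 n2 n3 n4]|] := boolP ([&& u != u', u != v', v != u' & v != v'])%B;
  last by move=> _; apply: nearW.
have [c1 _ a0 a1 _] := arcP _ _ euv; have [c2 _ b0 b1 _] := arcP _ _ euv'.
have ends (t : R) : I01 t -> (t \in `]0%R, 1%R[) \/ t = 0 \/ t = 1.
  rewrite /I01 /= in_itv /= => /andP[t0 t1]; rewrite in_itv /=.
  have [t_0|tn0] := eqVneq t 0; first by right; left.
  have [t_1|tn1] := eqVneq t 1; first by right; right.
  by left; rewrite !lt_neqAle t0 t1 eq_sym tn0 tn1.
have dis s t : I01 s -> I01 t -> arc u v s <> arc u' v' t.
  move=> /ends s01 /ends t01.
  case: s01 => [s01|[->|->]]; case: t01 => [t01|[->|->]];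
    rewrite ?a0 ?a1 ?b0 ?b1.
  - move=> /(arc_arc _ _ _ _ euv euv' _ _ s01 t01) [[h1 h2]|[h1 h2]].
      by rewrite h1 eqxx in n1.
    by rewrite h1 eqxx in n2.
  - exact: arc_pt.
  - exact: arc_pt.
  - by move=> /esym; apply: arc_pt.
  - by move/ptI => h; rewrite h eqxx in n1.
  - by move/ptI => h; rewrite h eqxx in n2.
  - by move=> /esym; apply: arc_pt.
  - by move/ptI => h; rewrite h eqxx in n3.
  - by move/ptI => h; rewrite h eqxx in n4.
have := disjoint_arcs_parity c1 c2 dis; rewrite a0 a1 b0 b1 => H.
by apply: (@filterS _ _ eventually_filter _ _ _ H) => N hN _ _ _.
Qed.

(** The parity of the crossings seen by [independent_edges_parity] refers to the
order of the vertices given by [upper]; adding [corr] replaces this order by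
the order along the cycle, and the parity becomes that of straight chords of a
convex polygon, as [chord_side_crossing] requires. *)
Lemma hamiltonian_chord_sides (c : seq T) (x0 : T) :
  planar R e -> hamiltonian_cycle e c ->
  exists side : nat -> nat -> bool, forall i j k l,
    (i < j)%N -> (j < k)%N -> (k < l)%N -> (l < size c)%N ->
    e (nth x0 c i) (nth x0 c k) -> e (nth x0 c j) (nth x0 c l) ->
    side i k != side j l.
Proof.
move=> [pt [arc drawing]] [size_c /andP[cyc uniq_c] all_c].
have [ptI _ _ _] := drawing.
have [N _ hN] := independent_edges_parity drawing.
have {}hN := hN N (leqnn N).
pose v i := nth x0 c i.
have v_neq i j : (i < size c)%N -> (j < size c)%N -> i != j -> v i != v j.
  by move=> ic jc; rewrite nth_uniq.
(* [corr] adds a sweep for each pair of vertices whose order by [upper] is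
not their order along the cycle; a pair is charged to its smaller index. *)
pose above i j := upper (pt (v i) - pt (v j)).
pose corr i j := (i < j)%N && above i j.
pose Y i j k := crossing_parity N (arc (v i) (v j)) (pt (v k)) (+)
  (corr i k (+) corr j k).
have corrP i j : (i < size c)%N -> (j < size c)%N -> i != j ->
    corr i j (+) corr j i = above i j (+) (j < i)%N.
  move=> ic jc ij; rewrite /corr; case: (ltngtP i j) => [||e_ij].
  - by [].
  - rewrite addbT /above -upperN ?opprB // subr_eq0.
    by apply/eqP => /ptI/eqP; apply/negP/v_neq.
  - by rewrite e_ij eqxx in ij.
pose E i j := e (v i) (v j).
have E_next i : (i.+1 < size c)%N -> E i i.+1.
  move=> ic; have := next_cycle cyc (mem_nth x0 (ltnW ic)).
  by rewrite next_nth_uniq ?(ltnW ic) // ic.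
have E_wrap : E 0%N (size c).-1.
  have c0 : (0 < size c)%N by exact: ltn_trans size_c.
  have c1 : ((size c).-1 < size c)%N by rewrite prednK.
  have := next_cycle cyc (mem_nth x0 c1).
  by rewrite next_nth_uniq // prednK // ltnn /E e_sym.
exists (chord_side (size c) Y) => i j k l ij jk kl lc eik ejl.
apply: (@chord_side_crossing _ E) => // {i j k l ij jk kl lc eik ejl}.
move=> i j k l /andP[ij jc] /andP[kl lc] Eij Ekl /and4P[n1 n2 n3 n4].
have [ic kc] := (ltn_trans ij jc, ltn_trans kl lc).
have := hN _ _ _ _ Eij Ekl; rewrite !v_neq // => /(_ isT).
have lt_corr a b : (a < size c)%N -> (b < size c)%N -> a != b ->
    (b < a)%N = corr a b (+) corr b a (+) above a b.
  by move=> ac bc ab; rewrite corrP // addbAC addbb.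
rewrite (lt_corr i k) // (lt_corr i l) // (lt_corr j k) // (lt_corr j l) //.
rewrite -!/(above _ _) /Y.
move: (crossing_parity N (arc (v i) (v j)) (pt (v k)))
  (crossing_parity N (arc (v i) (v j)) (pt (v l)))
  (crossing_parity N (arc (v k) (v l)) (pt (v i)))
  (crossing_parity N (arc (v k) (v l)) (pt (v j))) => X1 X2 X3 X4.
move: (above i k) (above i l) (above j k) (above j l) => a1 a2 a3 a4 hX.
have -> : X1 = X2 (+) (X3 (+) X4) (+) (a1 (+) a2 (+) (a3 (+) a4)).
  by rewrite -hX !addb_xorb; btauto.
rewrite !addb_xorb; btauto.
Qed.
End TwoSides.

(** * Faces cut out by non-crossing chords *)

Section Chords.
Local Open Scope nat_scope.

(** The case analysis behind [unseparated_trans], with all bounds spelled out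
for the decision procedure. *)
Lemma separation_trans_aux i j k l a b n :
  i.+1 < j < n -> (i < k < j) ->  (l < i) || (j < l < n) ->
  ~~ ((a == i) && (b == j)) ->
  ~~ ((a < k < b) && ((i < a) || (b < i))) &&
  ~~ ((a < i < b) && ((k < a) || (b < k))) ->
  ~~ ((a < k < b) && ((j < a) || (b < j))) &&
  ~~ ((a < j < b) && ((k < a) || (b < k))) ->
  ~~ ((a < l < b) && ((i < a) || (b < i))) &&
  ~~ ((a < i < b) && ((l < a) || (b < l))) ->
  ~~ ((a < l < b) && ((j < a) || (b < j))) &&
  ~~ ((a < j < b) && ((l < a) || (b < l))) ->
  a.+1 < b < n ->
  ~~ ((a < k < b) && ((l < a) || (b < l))) &&
  ~~ ((a < l < b) && ((k < a) || (b < k))).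
Proof.
move=> ijn ikj lij nij hki hkj hli hlj abn.
case: (ltngtP a i) => ai; case: (ltngtP b j) => bj; case: (ltngtP b i) => bi;
  case: (ltngtP a j) => aj; lia.
Qed.

Variables (n : nat) (A : rel nat).

Definition is_chord i j := (i.+1 < j < n) && ~~ ((i == 0) && (j == n.-1)).
Definition noncrossing := forall i j k l, A i j -> A k l -> ~~ [&& i < k, k < j & j < l].

Hypothesis A_chord : forall i j, A i j -> is_chord i j.
Hypothesis A_noncross : noncrossing.

(** No chord of [A] has [k] and [l] strictly on different sides; equivalently,
[k] and [l] lie on a common face of the subdivision of the polygon by [A]. *)
Definition unseparated k l := forall a b, A a b ->
  ~~ ((a < k < b) && ((l < a) || (b < l))) &&
  ~~ ((a < l < b) && ((k < a) || (b < k))).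

Definition uncrossed i j := forall a b, A a b ->
  ~~ [&& a < i, i < b & b < j] && ~~ [&& i < a, a < j & j < b].

Lemma uncrossed_unseparated i j : i < j -> uncrossed i j -> unseparated i j.
Proof.
move=> ij unc a b Aab; move: (unc _ _ Aab) (A_chord Aab); rewrite /is_chord; lia.
Qed.

(** The face next to the uncrossed segment [ij], on the side between [i] and
[j], has a further corner: the farthest neighbour of [i] before [j], or else
[i.+1]. *)
Lemma unseparated_inside i j : i.+1 < j < n -> ~~ A i j -> uncrossed i j ->
  exists k, [/\ i < k < j, unseparated k i & unseparated k j].
Proof.
move=> /andP[ij jn] nA unc.
pose P k := (i < k < j) && ((k == i.+1) || A i k).
have exP : exists k, P k by exists i.+1; rewrite /P; lia.
have bP k : P k -> k <= j by rewrite /P => /andP[/andP[_ /ltnW]].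
case: (ex_maxnP exP bP) => k /andP[ikj Pk] maxk.
have Pab a b : A a b -> [&& a < k, k < b & b < j] -> i < a.
  move=> Aab kb; case: (ltngtP i a) => // ia.
    by have := unc _ _ Aab; lia.
  by subst a; have := maxk b; rewrite /P Aab orbT; lia.
have kab a b : A a b -> ~~ [&& i < a, a < k & k < b].
  by move=> Aab; case/orP: Pk => [|Aik]; [lia | exact: A_noncross Aik Aab].
have Aj a b : A a b -> a = i -> b != j.
  by move=> Aab eai; apply/eqP => ebj; move: Aab; rewrite eai ebj (negPf nA).
exists k; split=> // a b Aab.
  by have := unc _ _ Aab; have := kab _ _ Aab; lia.
have := unc _ _ Aab; have := kab _ _ Aab; have := Pab _ _ Aab; have := Aj _ _ Aab.
by have := A_chord Aab; rewrite /is_chord; lia.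
Qed.

(** The face on the other side of [ij].  Its further corner is the nearest
neighbour of [j] below [i], or else the farthest neighbour of [j] above it, the
side of the polygon that closes the numbering counting as an edge. *)
Lemma unseparated_outside i j : i < j < n -> ~~ ((i == 0) && (j == n.-1)) ->
  uncrossed i j ->
  exists k, [/\ (k < i) || (j < k < n), unseparated k i & unseparated k j].
Proof.
move=> /andP[ij jn] nwrap unc.
pose P k := (k < i) && (A k j || ((j == n.-1) && (k == 0))).
have bP k : P k -> k <= i by rewrite /P => /andP[/ltnW].
have [/existsP[k0 Pk0]|noP] := boolP [exists k : 'I_n, P k].
  have exP : exists k, P k by exists k0.
  case: (ex_maxnP exP bP) => k /andP[ki Pk] maxk.
  have kab a b : A a b -> ~~ [&& a < k, k < b & b < j] && ~~ [&& k < a, a < j & j < b].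
    move=> Aab; have := A_chord Aab; rewrite /is_chord.
    case/orP: Pk => [Akj|]; last by lia.
    by move: (A_noncross Aab Akj) (A_noncross Akj Aab); lia.
  have ka a b : A a b -> b = j -> a < i -> a <= k.
    by move=> Aab ebj ai; apply: maxk; rewrite /P ai -ebj Aab.
  exists k; split; first by rewrite ki.
    move=> a b Aab; move: (unc _ _ Aab) (kab _ _ Aab) (ka _ _ Aab) (A_chord Aab).
    by rewrite /is_chord; lia.
  move=> a b Aab; move: (unc _ _ Aab) (kab _ _ Aab) (A_chord Aab).
  by rewrite /is_chord; lia.
have {}noP k : ~~ P k.
  apply: contra noP => Pk; have kn : k < n by move: (bP _ Pk); lia.
  by apply/existsP; exists (Ordinal kn).
pose Q k := (j < k < n) && ((k == j.+1) || A j k).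
have j1n : j.+1 < n by have := noP 0; rewrite /P; lia.
have exQ : exists k, Q k by exists j.+1; rewrite /Q; lia.
have bQ k : Q k -> k <= n by rewrite /Q => /andP[/andP[_ /ltnW]].
case: (ex_maxnP exQ bQ) => k /andP[jkn Qk] maxk.
have kab a b : A a b -> ~~ [&& a < j, j < b & b < k] && ~~ [&& j < a, a < k & k < b].
  move=> Aab; case/orP: Qk => [|Ajk]; first by lia.
  by move: (A_noncross Aab Ajk) (A_noncross Ajk Aab); lia.
have ka a b : A a b -> a = j -> b <= k.
  move=> Aab eaj; apply: maxk; move: (A_chord Aab).
  by rewrite /Q /is_chord -eaj Aab orbT; lia.
have na a b : A a b -> b = j -> ~~ (a < i).
  by move=> Aab ebj; have := noP a; rewrite /P -ebj Aab andbT.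
exists k; split; first by rewrite jkn orbT.
  move=> a b Aab; move: (unc _ _ Aab) (kab _ _ Aab) (ka _ _ Aab) (na _ _ Aab) (A_chord Aab).
  by rewrite /is_chord; lia.
move=> a b Aab; move: (unc _ _ Aab) (kab _ _ Aab) (A_chord Aab).
by rewrite /is_chord; lia.
Qed.

(** Corners of the two faces on either side of [ij] are separated by [ij]
alone, so they share a face when [ij] is not a chord of [A]. *)
Lemma unseparated_trans i j k l : i.+1 < j < n -> i < k < j ->
  (l < i) || (j < l < n) -> ~~ A i j -> unseparated k i -> unseparated k j ->
  unseparated l i -> unseparated l j -> unseparated k l.
Proof.
move=> ijn ikj lij nA ki kj li lj a b Aab.
have nij : ~~ ((a == i) && (b == j)).
  by apply: contra nA => /andP[/eqP <- /eqP <-].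
apply: (separation_trans_aux ijn ikj lij nij) (ki _ _ Aab) (kj _ _ Aab)
  (li _ _ Aab) (lj _ _ Aab) _.
by have := A_chord Aab; rewrite /is_chord => /andP[].
Qed.

End Chords.

(** * Vectors and linear forms in dimension 3 *)

Section Vec3.
Variable R : realFieldType.
Implicit Types (u v w m y : 'rV[R]_3) (a b c : R).

Definition vec3 a b c : 'rV[R]_3 := \row_(i < 3) [:: a; b; c]`_i.

Lemma row3P u v : u 0 0 = v 0 0 -> u 0 1 = v 0 1 -> u 0 2 = v 0 2 -> u = v.
Proof.
move=> h0 h1 h2; apply/rowP => -[[|[|[|//]]] i3].
- by rewrite (_ : Ordinal i3 = 0) //; apply/val_inj.
- by rewrite (_ : Ordinal i3 = 1) //; apply/val_inj.
- by rewrite (_ : Ordinal i3 = 2) //; apply/val_inj.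
Qed.

Lemma vec3E a b c : (vec3 a b c 0 0 = a) * (vec3 a b c 0 1 = b) * (vec3 a b c 0 2 = c).
Proof. by rewrite !mxE. Qed.

(** A row vector doubles as a linear form, whose value is the dot product. *)
Definition dot m y : R := m 0 0 * y 0 0 + m 0 1 * y 0 1 + m 0 2 * y 0 2.
Definition cross u v : 'rV[R]_3 :=
  vec3 (u 0 1 * v 0 2 - u 0 2 * v 0 1) (u 0 2 * v 0 0 - u 0 0 * v 0 2)
       (u 0 0 * v 0 1 - u 0 1 * v 0 0).
Definition det3 u v w : R := dot (cross u v) w.

Lemma dotDl m1 m2 y : dot (m1 + m2) y = dot m1 y + dot m2 y.
Proof. by rewrite /dot !mxE; ring. Qed.
Lemma dotDr m y1 y2 : dot m (y1 + y2) = dot m y1 + dot m y2.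
Proof. by rewrite /dot !mxE; ring. Qed.
Lemma dotZl a m y : dot (a *: m) y = a * dot m y.
Proof. by rewrite /dot !mxE; ring. Qed.
Lemma dotZr a m y : dot m (a *: y) = a * dot m y.
Proof. by rewrite /dot !mxE; ring. Qed.
Lemma dotC m y : dot m y = dot y m.
Proof. by rewrite /dot; ring. Qed.
Lemma dot0l y : dot 0 y = 0.
Proof. by rewrite /dot !mxE; ring. Qed.
Lemma dot0r m : dot m 0 = 0.
Proof. by rewrite dotC dot0l. Qed.
Lemma dot_suml (I : Type) (r : seq I) (P : pred I) (F : I -> 'rV[R]_3) y :
  dot (\sum_(i <- r | P i) F i) y = \sum_(i <- r | P i) dot (F i) y.
Proof. exact: (big_morph (dot^~ y) (fun u v => dotDl u v y) (dot0l y)). Qed.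
Lemma dot_sumr (I : Type) (r : seq I) (P : pred I) (F : I -> 'rV[R]_3) m :
  dot m (\sum_(i <- r | P i) F i) = \sum_(i <- r | P i) dot m (F i).
Proof. by rewrite dotC dot_suml; apply: eq_bigr => i _; rewrite dotC. Qed.

Lemma det3E u v w : det3 u v w =
  (u 0 1 * v 0 2 - u 0 2 * v 0 1) * w 0 0 + (u 0 2 * v 0 0 - u 0 0 * v 0 2) * w 0 1
  + (u 0 0 * v 0 1 - u 0 1 * v 0 0) * w 0 2.
Proof. by rewrite /det3 /dot /cross !vec3E. Qed.

Lemma det3_rot u v w : det3 u v w = det3 v w u.
Proof. by rewrite !det3E; ring. Qed.
Lemma det3_swap u v w : det3 u v w = - det3 u w v.
Proof. by rewrite !det3E; ring. Qed.
Lemma det3_swapl u v w : det3 u v w = - det3 v u w.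
Proof. by rewrite !det3E; ring. Qed.
Lemma det3_first u v : det3 u v u = 0.
Proof. by rewrite !det3E; ring. Qed.
Lemma det3_second u v : det3 u v v = 0.
Proof. by rewrite !det3E; ring. Qed.

Lemma det3_sum2 (I : Type) (r : seq I) (P : pred I) (F : I -> 'rV[R]_3) u y :
  det3 u (\sum_(i <- r | P i) F i) y = \sum_(i <- r | P i) det3 u (F i) y.
Proof. by rewrite -det3_rot /det3 dot_sumr; apply: eq_bigr => i _;
  rewrite -/(det3 _ _ _) det3_rot. Qed.
Lemma det3D2 u v1 v2 y : det3 u (v1 + v2) y = det3 u v1 y + det3 u v2 y.
Proof. by rewrite !det3E !mxE; ring. Qed.

Lemma cramer3 (a b c d : 'rV[R]_3) : det3 b c d *: a - det3 a c d *: b + det3 a b d *: c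
  - det3 a b c *: d = 0.
Proof. by apply: row3P; rewrite !mxE !det3E; ring. Qed.

Lemma cramer3_expand (a b c u : 'rV[R]_3) :
  det3 a b c *: u = det3 u b c *: a + det3 a u c *: b + det3 a b u *: c.
Proof. by apply: row3P; rewrite !mxE !det3E; ring. Qed.

Lemma dot_three_eq0 m u v w : det3 u v w != 0 -> dot m u = 0 -> dot m v = 0 ->
  dot m w = 0 -> m = 0.
Proof.
move=> d0 hu hv hw.
have E : det3 u v w *: m = dot m u *: cross v w + dot m v *: cross w u + dot m w *: cross u v.
  by apply: row3P; rewrite !mxE !det3E /dot /=; ring.
apply/eqP; move: E; rewrite hu hv hw !scale0r !addr0 => /eqP.
by rewrite scaler_eq0 (negPf d0).
Qed.

Lemma interpolation3 (h1 h2 h3 : R) m u v w : det3 u v w != 0 -> dot m u = h1 ->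
  dot m v = h2 -> dot m w = h3 ->
  m = (det3 u v w)^-1 *: (h1 *: cross v w + h2 *: cross w u + h3 *: cross u v).
Proof.
move=> d0 <- <- <-; apply: (scalerI d0); rewrite scalerA divff // scale1r.
by apply: row3P; rewrite !mxE !det3E /dot /=; ring.
Qed.

End Vec3.

Section Roof.
Variables (R : realFieldType) (n : nat) (q : nat -> 'rV[R]_3).
Hypothesis q_convex : forall i j k, (i < j)%N -> (j < k)%N -> (k < n)%N ->
  0 < det3 (q i) (q j) (q k).

Lemma det3_outside i j k : (i < j)%N -> (j < n)%N -> (k < n)%N ->
  (k < i)%N || (j < k)%N -> 0 < det3 (q i) (q j) (q k).
Proof.
move=> ij jn kn /orP[ki|jk]; last exact: q_convex.
by rewrite -det3_rot; exact: q_convex.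
Qed.

Lemma det3_inside i j k : (j < n)%N -> (i < k)%N -> (k < j)%N ->
  det3 (q i) (q j) (q k) < 0.
Proof. by move=> jn ik kj; rewrite det3_swap oppr_lt0; exact: q_convex. Qed.

Lemma det3_neq0 i j k : (i < n)%N -> (j < n)%N -> (k < n)%N ->
  i != j -> i != k -> j != k -> det3 (q i) (q j) (q k) != 0.
Proof.
wlog ij : i j / (i < j)%N.
  move=> W iN jN kN ij ik jk; case: (ltngtP i j) => h; first exact: W.
    by rewrite det3_swapl oppr_eq0; apply: W => //; rewrite eq_sym.
  by rewrite h eqxx in ij.
move=> iN jN kN _ ik jk; have [ki|] := boolP ((k < i)%N || (j < k)%N).
  by rewrite gt_eqF // det3_outside.
by move=> h; rewrite lt_eqF // det3_inside //; lia.
Qed.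

(** The diagonals of a convex quadrilateral meet. *)
Lemma crossing_point a b c d : (a < b)%N -> (b < c)%N -> (c < d)%N -> (d < n)%N ->
  exists s t s' t' : R, [/\ 0 < s, 0 < t, 0 < s' & 0 < t'] /\
    s *: q a + t *: q c = s' *: q b + t' *: q d.
Proof.
move=> ab bc cd dn.
exists (det3 (q b) (q c) (q d)), (det3 (q a) (q b) (q d)),
  (det3 (q a) (q c) (q d)), (det3 (q a) (q b) (q c)); split.
  by split; apply: q_convex; lia.
by apply/eqP; rewrite -subr_eq0 opprD addrA [X in X - _]addrAC cramer3.
Qed.

Lemma crossing_point_sym i j k l : (i < k)%N -> (k < j)%N -> (j < n)%N -> (l < n)%N ->
  (l < i)%N || (j < l)%N ->
  exists s t s' t' : R, [/\ 0 < s, 0 < t, 0 < s' & 0 < t'] /\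
    s *: q i + t *: q j = s' *: q k + t' *: q l.
Proof.
move=> ik kj jn ln /orP[li|jl]; last exact: crossing_point.
have [s [t [s' [t' [[s0 t0 s'0 t'0] E]]]]] := crossing_point li ik kj jn.
by exists s', t', t, s; split => //; rewrite -E addrC.
Qed.

Variable A : rel nat.
Hypothesis A_chord : forall i j, A i j -> is_chord n i j.
Hypothesis A_noncross : noncrossing A.

(** Each summand is convex and linear on either side of its chord. *)
Definition roof y : R :=
  \sum_(p : 'I_n * 'I_n | A p.1 p.2) `|det3 (q p.1) (q p.2) y|.
(** A subgradient of the roof at [z]. *)
Definition roof_slope z : 'rV[R]_3 :=
  \sum_(p : 'I_n * 'I_n | A p.1 p.2)
     Num.sg (det3 (q p.1) (q p.2) z) *: cross (q p.1) (q p.2).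

Lemma dot_roof_slope z y : dot (roof_slope z) y =
  \sum_(p : 'I_n * 'I_n | A p.1 p.2)
    Num.sg (det3 (q p.1) (q p.2) z) * det3 (q p.1) (q p.2) y.
Proof. by rewrite dot_suml; apply: eq_bigr => p _; rewrite dotZl. Qed.

Lemma sg_mul_le_norm (x y : R) : Num.sg x * y <= `|y|.
Proof.
by rewrite (le_trans (ler_norm _)) // normrM -{2}[`|y|]mul1r ler_wpM2r // normr_sg; case: (x != 0).
Qed.

Lemma roof_slope_le z y : dot (roof_slope z) y <= roof y.
Proof. by rewrite dot_roof_slope; apply: ler_sum => p _; exact: sg_mul_le_norm. Qed.

Lemma roof_slope_lt z y i j : A i j -> det3 (q i) (q j) z = 0 ->
  det3 (q i) (q j) y != 0 -> dot (roof_slope z) y < roof y.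
Proof.
move=> Aij z0 y0; have := A_chord Aij; rewrite /is_chord => ijn.
have [i_n jn] : (i < n)%N /\ (j < n)%N by lia.
pose p0 : 'I_n * 'I_n := (Ordinal i_n, Ordinal jn).
rewrite dot_roof_slope /roof [ltLHS](bigD1 p0) //= [ltRHS](bigD1 p0) //=.
rewrite z0 sgr0 mul0r add0r -[X in X < _]add0r ltr_leD ?normr_gt0 //.
by apply: ler_sum => p _; exact: sg_mul_le_norm.
Qed.

Lemma roof_slope_eq z y :
  (forall i j, A i j -> Num.sg (det3 (q i) (q j) z) * det3 (q i) (q j) y
    = `|det3 (q i) (q j) y|) ->
  dot (roof_slope z) y = roof y.
Proof. by move=> h; rewrite dot_roof_slope; apply: eq_bigr => p Ap; exact: h. Qed.

Lemma roof_convex s t u v : 0 <= s -> 0 <= t ->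
  roof (s *: u + t *: v) <= s * roof u + t * roof v.
Proof.
move=> s0 t0; rewrite /roof !mulr_sumr -big_split /=; apply: ler_sum => p _.
rewrite /det3 dotDr !dotZr (le_trans (ler_normD _ _)) // !normrM.
by rewrite (ger0_norm s0) (ger0_norm t0).
Qed.

Lemma roof_strictly_convex s t u v i j : A i j -> 0 < s -> 0 < t ->
  det3 (q i) (q j) u < 0 -> 0 < det3 (q i) (q j) v ->
  roof (s *: u + t *: v) < s * roof u + t * roof v.
Proof.
move=> Aij s0 t0 u0 v0; have := A_chord Aij; rewrite /is_chord => ijn.
have [i_n jn] : (i < n)%N /\ (j < n)%N by lia.
pose p0 : 'I_n * 'I_n := (Ordinal i_n, Ordinal jn).
rewrite /roof !mulr_sumr -big_split /= [ltLHS](bigD1 p0) //= [ltRHS](bigD1 p0) //=.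
apply: ltr_leD; last first.
  apply: ler_sum => p _; rewrite /det3 dotDr !dotZr (le_trans (ler_normD _ _)) // !normrM.
  by rewrite (gtr0_norm s0) (gtr0_norm t0).
rewrite {1}/det3 dotDr !dotZr -!/(det3 _ _ _).
rewrite (ltr0_norm u0) (gtr0_norm v0).
have hu : 0 < s * - det3 (q i) (q j) u by rewrite mulr_gt0 // oppr_gt0.
have hv : 0 < t * det3 (q i) (q j) v by rewrite mulr_gt0.
by rewrite ltr_norml; apply/andP; split; lra.
Qed.

Lemma det3_unseparated a b k l : A a b -> (k < n)%N -> (l < n)%N ->
  unseparated A k l -> 0 <= det3 (q a) (q b) (q k) * det3 (q a) (q b) (q l).
Proof.
move=> Aab kn ln /(_ _ _ Aab) sep; have := A_chord Aab; rewrite /is_chord => abn.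
have sgn x : (x < n)%N -> [\/ (a < x < b)%N /\ det3 (q a) (q b) (q x) < 0,
    ((x < a) || (b < x))%N /\ 0 < det3 (q a) (q b) (q x) |
    det3 (q a) (q b) (q x) = 0].
  move=> xn; have [->|xa] := eqVneq x a; first by constructor 3; rewrite det3_first.
  have [->|xb] := eqVneq x b; first by constructor 3; rewrite det3_second.
  have [axb|axb] := boolP (a < x < b)%N.
    by constructor 1; split=> //; apply: det3_inside; lia.
  have h : ((x < a) || (b < x))%N by lia.
  by constructor 2; split=> //; apply: det3_outside; lia.
case: (sgn _ kn) => [[h1 dk]|[h1 dk]|->]; last by rewrite mul0r.
  case: (sgn _ ln) => [[h2 dl]|[h2 dl]|->]; last by rewrite mulr0.
    by rewrite nmulr_lge0 // ltW.
  by move: sep; rewrite h1 h2.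
case: (sgn _ ln) => [[h2 dl]|[h2 dl]|->]; last by rewrite mulr0.
  by move: sep; rewrite h1 h2 andbF.
by rewrite mulr_ge0 // ltW.
Qed.

Lemma sg_sum_mul (x y : R) : 0 <= x * y -> Num.sg (x + y) * x = `|x|.
Proof.
move=> xy; have [x0|x0|->] := ltgtP x 0; last by rewrite mulr0 normr0.
  have y0 : y <= 0 by rewrite -(nmulr_rge0 _ x0).
  by rewrite ltr0_sg ?ltr0_norm ?mulN1r //; lra.
have y0 : 0 <= y by rewrite -(pmulr_rge0 _ x0).
by rewrite gtr0_sg ?gtr0_norm ?mul1r //; lra.
Qed.

End Roof.

(** * The convex roof over a family of chords *)

(** Sides of the polygon, written with the smaller index first. *)
Definition cyclic_next n i j := (i < j < n)%N && ((j == i.+1) || ((i == 0%N) && (j == n.-1))).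

(** The lower boundary of the convex hull of the points [(q_k, h_k)] is folded
exactly along the chords of [A].  Everything is said in terms of linear
functions that touch the heights from below or above, so that adding a linear
function to the heights changes nothing. *)
Record lower_hull (R : realFieldType) (n : nat) (q : nat -> 'rV[R]_3) (A : rel nat)
    (h : nat -> R) : Prop := LowerHull {
  hull_edge : forall i j, A i j -> exists m,
    [/\ dot m (q i) = h i, dot m (q j) = h j &
        forall k, (k < n)%N -> k != i -> k != j -> dot m (q k) < h k];
  hull_no_edge : forall i j m, is_chord n i j -> ~~ A i j ->
    (forall k, (k < n)%N -> dot m (q k) <= h k) ->
    dot m (q i) = h i -> dot m (q j) = h j ->
    exists k, [/\ (k < n)%N, k != i, k != j & dot m (q k) = h k];
  hull_edge_lower : forall i j m, A i j ->
    (forall k, (k < n)%N -> h k <= dot m (q k)) ->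
    dot m (q i) = h i -> dot m (q j) = h j -> False;
  hull_side_face : forall i j, cyclic_next n i j -> exists m k,
    [/\ (k < n)%N, k != i & k != j] /\
    [/\ forall k, (k < n)%N -> dot m (q k) <= h k,
        dot m (q i) = h i, dot m (q j) = h j & dot m (q k) = h k]
}.

Lemma lower_hull_affine (R : realFieldType) n (q : nat -> 'rV[R]_3) (A : rel nat)
    (h h' : nat -> R) (c : R) (m0 : 'rV[R]_3) :
  0 < c -> (forall k, (k < n)%N -> h' k = c * (h k + dot m0 (q k))) ->
  (forall i j, A i j -> is_chord n i j) ->
  lower_hull n q A h -> lower_hull n q A h'.
Proof.
move=> c0 hh' Ac [H1 H2 H3 H4].
have up m k : (k < n)%N -> dot (c *: (m + m0)) (q k) - h' k = c * (dot m (q k) - h k).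
  by move=> kn; rewrite hh' // dotZl dotDl; ring.
have down m k : (k < n)%N -> dot (c^-1 *: m - m0) (q k) - h k = c^-1 * (dot m (q k) - h' k).
  move=> kn; rewrite hh' // dotDl dotZl -scaleN1r dotZl mulrBr mulKf ?gt_eqF //; ring.
have ci0 : 0 < c^-1 by rewrite invr_gt0.
have eq_up m k : (k < n)%N -> dot m (q k) = h k -> dot (c *: (m + m0)) (q k) = h' k.
  by move=> kn e; apply/eqP; rewrite -subr_eq0 up // e subrr mulr0.
have eq_down m k : (k < n)%N -> dot m (q k) = h' k -> dot (c^-1 *: m - m0) (q k) = h k.
  by move=> kn e; apply/eqP; rewrite -subr_eq0 down // e subrr mulr0.
have le_up m k : (k < n)%N -> dot m (q k) <= h k -> dot (c *: (m + m0)) (q k) <= h' k.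
  by move=> kn e; rewrite -subr_le0 up // pmulr_rle0 // subr_le0.
have le_down m k : (k < n)%N -> dot m (q k) <= h' k -> dot (c^-1 *: m - m0) (q k) <= h k.
  by move=> kn e; rewrite -subr_le0 down // pmulr_rle0 // subr_le0.
split.
- move=> i j Aij; have [m [mi mj mk]] := H1 i j Aij.
  have := Ac _ _ Aij; rewrite /is_chord => ijn.
  exists (c *: (m + m0)); split; [apply: eq_up => //; lia|apply: eq_up => //; lia|].
  by move=> k kn ki kj; rewrite -subr_lt0 up // pmulr_rlt0 // subr_lt0; exact: mk.
- move=> i j m ij nA mle mi mj; have := ij; rewrite /is_chord => ijn.
  have [||| k [kn ki kj ek]] := H2 i j (c^-1 *: m - m0) ij nA.
  + by move=> k kn; apply: le_down => //; exact: mle.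
  + by apply: eq_down => //; lia.
  + by apply: eq_down => //; lia.
  exists k; split=> //; apply/eqP; rewrite -subr_eq0.
  have := down m k kn; rewrite ek subrr => /esym/eqP.
  by rewrite mulf_eq0 gt_eqF.
- move=> i j m Aij mge mi mj; have := Ac _ _ Aij; rewrite /is_chord => ijn.
  apply: (H3 i j (c^-1 *: m - m0) Aij).
  + move=> k kn; rewrite -subr_ge0 down // pmulr_rge0 // subr_ge0; exact: mge.
  + by apply: eq_down => //; lia.
  + by apply: eq_down => //; lia.
- move=> i j ij; have [m [k [[kn ki kj] [mle mi mj mk]]]] := H4 i j ij.
  move: ij; rewrite /cyclic_next => ij.
  exists (c *: (m + m0)), k; split=> //; split.
  + by move=> l ln; apply: le_up => //; exact: mle.
  + by apply: eq_up => //; lia.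
  + by apply: eq_up => //; lia.
  + exact: eq_up.
Qed.

Section RoofHull.
Variables (R : realFieldType) (n : nat) (q : nat -> 'rV[R]_3) (A : rel nat).
Hypothesis n_gt2 : (2 < n)%N.
Hypothesis q_convex : forall i j k, (i < j)%N -> (j < k)%N -> (k < n)%N ->
  0 < det3 (q i) (q j) (q k).
Hypothesis A_chord : forall i j, A i j -> is_chord n i j.
Hypothesis A_noncross : noncrossing A.

Let h k := roof n q A (q k).

(** No chord separates [q k] from [q l], so every summand of the roof is linear
on the segment between them. *)
Lemma roof_linear s t k l : 0 <= s -> 0 <= t -> (k < n)%N -> (l < n)%N ->
  unseparated A k l -> roof n q A (s *: q k + t *: q l) = s * h k + t * h l.
Proof.
move=> s0 t0 kn ln sep; rewrite /h /roof !mulr_sumr -big_split /=.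
apply: eq_bigr => p Ap; rewrite /det3 dotDr !dotZr -!/(det3 _ _ _).
have := det3_unseparated q_convex A_chord Ap kn ln sep.
set x := det3 _ _ _; set y := det3 _ _ (q l) => xy.
have [x0|x0|->] := ltgtP x 0; last by rewrite mulr0 normr0 mulr0 !add0r normrM ger0_norm.
  have y0 : y <= 0 by rewrite -(nmulr_rge0 _ x0).
  rewrite (ltr0_norm x0) (ler0_norm y0) ler0_norm; first by ring.
  by rewrite -[leRHS]addr0 lerD // mulr_ge0_le0 // ltW.
have y0 : 0 <= y by rewrite -(pmulr_rge0 _ x0).
rewrite (gtr0_norm x0) (ger0_norm y0) ger0_norm //.
by rewrite addr_ge0 // mulr_ge0 // ltW.
Qed.

Lemma chord_uncrossed i j : A i j -> uncrossed A i j.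
Proof.
move=> Aij a b Aab; move: (A_noncross Aij Aab) (A_noncross Aab Aij).
by case: (a < i)%N; case: (i < b)%N; case: (b < j)%N; case: (i < a)%N;
   case: (a < j)%N; case: (j < b)%N.
Qed.

(** The subgradient at the midpoint of a chord touches the roof at its ends; the
summand of the chord itself makes all other contacts strict. *)
Lemma roof_edge i j : A i j -> exists m,
    [/\ dot m (q i) = h i, dot m (q j) = h j &
        forall k, (k < n)%N -> k != i -> k != j -> dot m (q k) < h k].
Proof.
move=> Aij; have := A_chord Aij; rewrite /is_chord => ijn.
have sep : unseparated A i j.
  by apply: (uncrossed_unseparated A_chord); [lia|exact: chord_uncrossed].
have i_n : (i < n)%N by lia.
have jn : (j < n)%N by lia.
exists (roof_slope n q A (q i + q j)); split.
- apply: roof_slope_eq => a b Aab; rewrite /det3 dotDr.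
  by apply: sg_sum_mul; exact: (det3_unseparated q_convex A_chord Aab).
- apply: roof_slope_eq => a b Aab; rewrite /det3 dotDr addrC.
  by apply: sg_sum_mul; rewrite mulrC; exact: (det3_unseparated q_convex A_chord Aab).
- move=> k kn ki kj; apply: (roof_slope_lt A_chord Aij).
    by rewrite /det3 dotDr -!/(det3 _ _ _) det3_first det3_second addr0.
  by apply: (det3_neq0 q_convex) => //; lia.
Qed.

(** Either a chord of [A] crosses [ij], and its ends share a face, or [ij] is
the segment between two faces that are in fact one. *)
Lemma unseparated_pair i j : is_chord n i j -> ~~ A i j ->
  exists k l, [/\ (i < k < j)%N, (l < i)%N || (j < l < n)%N & unseparated A k l].
Proof.
move=> ijn nA; move: (ijn); rewrite /is_chord => ijn'.
have [/existsP[[a b]]|] := boolP [exists p : 'I_n * 'I_n, A p.1 p.2 &&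
   ([&& p.1 < i, i < p.2 & p.2 < j]%N || [&& i < p.1, p.1 < j & j < p.2]%N)].
  move=> /= /andP[Aab /orP[cr|cr]].
    exists b, a; split; [lia|lia|] => c d Acd.
    move: (chord_uncrossed Aab Acd) (A_chord Acd) (A_chord Aab); rewrite /is_chord; lia.
  exists a, b; split; [lia| |] => [|c d Acd]; first by rewrite ltn_ord; lia.
  move: (chord_uncrossed Aab Acd) (A_chord Acd) (A_chord Aab); rewrite /is_chord; lia.
move=> /existsPn H.
have unc : uncrossed A i j.
  move=> a b Aab; have := A_chord Aab; rewrite /is_chord => abn.
  have aN : (a < n)%N by lia.
  have bN : (b < n)%N by lia.
  by have := H (Ordinal aN, Ordinal bN); rewrite /= Aab /= negb_or.
have [k [ikj ki kj]] := unseparated_inside A_chord A_noncross (i := i) (j := j)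
  ltac:(lia) nA unc.
have [l [lij li lj]] := unseparated_outside A_chord A_noncross (i := i) (j := j)
  ltac:(lia) ltac:(lia) unc.
exists k, l; split=> //.
by apply: (unseparated_trans A_chord _ ikj lij nA) => //; lia.
Qed.

(** The segment [kl] crosses [ij], and the roof is linear along [kl].  At the
crossing point convexity along [ij] bounds the roof by the value of the linear
function, and linearity along [kl] turns this into equality at [k] and [l]. *)
Lemma roof_no_edge i j m : is_chord n i j -> ~~ A i j ->
    (forall k, (k < n)%N -> dot m (q k) <= h k) ->
    dot m (q i) = h i -> dot m (q j) = h j ->
    exists k, [/\ (k < n)%N, k != i, k != j & dot m (q k) = h k].
Proof.
move=> ijn nA mle mi mj; move: (ijn); rewrite /is_chord => ijn'.
have [k [l [ikj lij sep]]] := unseparated_pair ijn nA.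
have kn : (k < n)%N by lia.
have ln : (l < n)%N by lia.
have [s [t [s' [t' [[s0 t0 s'0 t'0] E]]]]] :=
  crossing_point_sym q_convex (i := i) (j := j) (k := k) (l := l)
   ltac:(lia) ltac:(lia) ltac:(lia) ln ltac:(lia).
exists k; split; [by []|lia|lia|].
have : roof n q A (s *: q i + t *: q j) <= dot m (s *: q i + t *: q j).
  by rewrite dotDr !dotZr mi mj; apply: roof_convex; exact: ltW.
rewrite E (roof_linear (ltW s'0) (ltW t'0) kn ln sep) dotDr !dotZr => cvx.
have k0 : 0 <= s' * (h k - dot m (q k)) by rewrite mulr_ge0 ?subr_ge0 ?mle // ltW.
have l0 : 0 <= t' * (h l - dot m (q l)) by rewrite mulr_ge0 ?subr_ge0 ?mle // ltW.
have : s' * (h k - dot m (q k)) = 0 by apply/eqP; rewrite eq_le k0 andbT; lra.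
by move/eqP; rewrite mulf_eq0 gt_eqF //= subr_eq0 => /eqP.
Qed.

(** A chord is a genuine fold, so the roof is strictly below its
interpolation on a segment that crosses the chord. *)
Lemma roof_edge_lower i j m : A i j ->
    (forall k, (k < n)%N -> h k <= dot m (q k)) ->
    dot m (q i) = h i -> dot m (q j) = h j -> False.
Proof.
move=> Aij mge mi mj; have := A_chord Aij; rewrite /is_chord => ijn.
have [l lP] : exists l, (l < n)%N && ((l < i)%N || (j < l)%N).
  by case: (ltnP 0 i) => i0; [exists 0%N|exists j.+1]; lia.
have [s [t [s' [t' [[s0 t0 s'0 t'0] E]]]]] :=
  crossing_point_sym q_convex (i := i) (j := j) (k := i.+1) (l := l)
   ltac:(lia) ltac:(lia) ltac:(lia) ltac:(lia) ltac:(lia).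
have sep : unseparated A i j.
  by apply: (uncrossed_unseparated A_chord); [lia|exact: chord_uncrossed].
have := roof_strictly_convex A_chord Aij s'0 t'0
  (det3_inside q_convex (i := i) (j := j) (k := i.+1) ltac:(lia) ltac:(lia) ltac:(lia))
  (det3_outside q_convex (i := i) (j := j) (k := l) ltac:(lia) ltac:(lia) ltac:(lia) ltac:(lia)).
have : roof n q A (s *: q i + t *: q j) = dot m (s *: q i + t *: q j).
  by rewrite dotDr !dotZr mi mj roof_linear ?ltW //; lia.
rewrite E dotDr !dotZr => -> lt_roof.
have k0 : s' * h i.+1 <= s' * dot m (q i.+1) by apply: ler_wpM2l; [exact: ltW|apply: mge; lia].
have l0 : t' * h l <= t' * dot m (q l) by apply: ler_wpM2l; [exact: ltW|apply: mge; lia].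
by move: lt_roof; rewrite -!/(h _); lra.
Qed.

(** The subgradient at the centre of three mutually unseparated corners touches
the roof at all three. *)
Lemma roof_side_face i j : cyclic_next n i j -> exists m k,
    [/\ (k < n)%N, k != i & k != j] /\
    [/\ forall k, (k < n)%N -> dot m (q k) <= h k,
        dot m (q i) = h i, dot m (q j) = h j & dot m (q k) = h k].
Proof.
move=> ijn; move: (ijn); rewrite /cyclic_next => ijn'.
have unc : uncrossed A i j.
  by move=> a b Aab; have := A_chord Aab; rewrite /is_chord; lia.
have [k [kn ki kj ski skj]] : exists k, [/\ (k < n)%N, k != i, k != j,
    unseparated A k i & unseparated A k j].
  have [ij1|ij1] := eqVneq j i.+1.
    have [k [kij ki kj]] := unseparated_outside A_chord A_noncross (i := i) (j := j)
      ltac:(lia) ltac:(lia) unc.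
    by exists k; split=> //; lia.
  have nA : ~~ A i j by apply/negP => /A_chord; rewrite /is_chord; lia.
  have [k [kij ki kj]] := unseparated_inside A_chord A_noncross (i := i) (j := j)
    ltac:(lia) nA unc.
  by exists k; split=> //; lia.
have sij : unseparated A i j by apply: (uncrossed_unseparated A_chord) => //; lia.
exists (roof_slope n q A (q i + q j + q k)), k; split=> //.
have i_n : (i < n)%N by lia.
have jn : (j < n)%N by lia.
have sgn a b : A a b -> [/\ 0 <= det3 (q a) (q b) (q i) * det3 (q a) (q b) (q j),
   0 <= det3 (q a) (q b) (q i) * det3 (q a) (q b) (q k) &
   0 <= det3 (q a) (q b) (q j) * det3 (q a) (q b) (q k)].
  move=> Aab; split; [|rewrite mulrC|rewrite mulrC];
  exact: (det3_unseparated q_convex A_chord Aab).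
split; first by move=> l ln; exact: roof_slope_le.
- apply: roof_slope_eq => a b Aab; have [h1 h2 h3] := sgn _ _ Aab.
  rewrite /det3 !dotDr -!/(det3 _ _ _) -addrA sg_sum_mul // mulrDr; exact: addr_ge0.
- apply: roof_slope_eq => a b Aab; have [h1 h2 h3] := sgn _ _ Aab.
  rewrite /det3 !dotDr -!/(det3 _ _ _) addrAC addrC sg_sum_mul // mulrDr addr_ge0 //.
  by rewrite mulrC.
- apply: roof_slope_eq => a b Aab; have [h1 h2 h3] := sgn _ _ Aab.
  rewrite /det3 !dotDr -!/(det3 _ _ _) addrC sg_sum_mul // mulrDr addr_ge0 //.
    by rewrite mulrC.
  by rewrite mulrC.
Qed.

Lemma roof_lower_hull : lower_hull n q A h.
Proof.
split; [exact: roof_edge|exact: roof_no_edge|exact: roof_edge_lower|exact: roof_side_face].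
Qed.

End RoofHull.

(** * Polygons circumscribed about a conic *)

Section Circumscribed.
Variable R : realFieldType.
Implicit Types (u v s t : R) (y z : 'rV[R]_3).

(** A vector stands for a binary quadratic form, with [bil] the polarization of
the discriminant (see [quad_eval]), and [pole u v] is the form
[(X - u) (X - v) / (v - u)].  In the projective plane it is the intersection of
the tangents to the conic [bil y y = 0] at the points of parameter [u] and
[v]. *)
Definition pole u v : 'rV[R]_3 :=
  vec3 (- (u + v) / (v - u)) ((1 - u * v) / (v - u)) ((1 + u * v) / (v - u)).

Definition bil y z : R := y 0 0 * z 0 0 + y 0 1 * z 0 1 - y 0 2 * z 0 2.

(** The quadratic form attached to [y], evaluated at [t]; up to a factor, this
is [bil] of [y] with the point of the conic of parameter [t]. *)
Definition quad_eval y t : R := (y 0 1 + y 0 2) / 2 * t ^+ 2 + y 0 0 * t + (y 0 2 - y 0 1) / 2.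

(** In the hyperbolic plane this is [(cosh d - 1) / 2], where [d] is the
distance between the disjoint geodesics with ends [u, v] and [s, t]. *)
Definition cratio u v s t : R := (s - v) * (t - u) / ((v - u) * (t - s)).

Lemma bilC y z : bil y z = bil z y.
Proof. by rewrite /bil; ring. Qed.
Lemma bilDl y1 y2 z : bil (y1 + y2) z = bil y1 z + bil y2 z.
Proof. by rewrite /bil !mxE; ring. Qed.
Lemma bil0l z : bil 0 z = 0.
Proof. by rewrite /bil !mxE; ring. Qed.
Lemma bilBl y1 y2 z : bil (y1 - y2) z = bil y1 z - bil y2 z.
Proof. by rewrite /bil !mxE; ring. Qed.
Lemma bil_sumr (I : Type) (r : seq I) (P : pred I) (F : I -> 'rV[R]_3) y :
  bil y (\sum_(i <- r | P i) F i) = \sum_(i <- r | P i) bil y (F i).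
Proof.
rewrite bilC (big_morph (bil^~ y) (fun z1 z2 => bilDl z1 z2 y) (bil0l y)).
by apply: eq_bigr => i _; rewrite bilC.
Qed.

Lemma bil_pole u v : u != v -> bil (pole u v) (pole u v) = 1.
Proof.
move=> uv; have d0 : v - u != 0 by rewrite subr_eq0 eq_sym.
by rewrite /bil /pole !vec3E; field.
Qed.

Lemma bil_pole2 u v s t : u != v -> s != t ->
  - bil (pole u v) (pole s t) = 1 + 2 * cratio u v s t.
Proof.
move=> uv st; have d0 : v - u != 0 by rewrite subr_eq0 eq_sym.
have d1 : t - s != 0 by rewrite subr_eq0 eq_sym.
by rewrite /bil /pole /cratio !vec3E; field; rewrite d0 d1.
Qed.

(** Moving one contact point moves the pole along the tangent at the other one,
so that it changes by a multiple of the isotropic vector there, against which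
[bil] evaluates the quadratic form. *)
Lemma bil_pole_right u v v' y : u != v -> u != v' ->
  bil (pole u v') y - bil (pole u v) y = - 2 * quad_eval y u * ((v' - u)^-1 - (v - u)^-1).
Proof.
move=> uv uv'; have d0 : v - u != 0 by rewrite subr_eq0 eq_sym.
have d1 : v' - u != 0 by rewrite subr_eq0 eq_sym.
by rewrite /bil /pole /quad_eval !vec3E; field; rewrite d0 d1.
Qed.

Lemma bil_pole_left u u' v y : u != v -> u' != v ->
  bil (pole u' v) y - bil (pole u v) y = - 2 * quad_eval y v * ((v - u')^-1 - (v - u)^-1).
Proof.
move=> uv uv'; have d0 : v - u != 0 by rewrite subr_eq0 eq_sym.
have d1 : v - u' != 0 by rewrite subr_eq0 eq_sym.
by rewrite /bil /pole /quad_eval !vec3E; field; rewrite d0 d1.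
Qed.

Lemma det3_pole u1 v1 u2 v2 u3 v3 : u1 != v1 -> u2 != v2 -> u3 != v3 ->
  det3 (pole u1 v1) (pole u2 v2) (pole u3 v3) =
  2 * ((u2 - v1) * (u3 - v2) * (v3 - u1) + (v2 - u1) * (v3 - u2) * (u3 - v1))
  / ((v1 - u1) * (v2 - u2) * (v3 - u3)).
Proof.
move=> h1 h2 h3; have d1 : v1 - u1 != 0 by rewrite subr_eq0 eq_sym.
have d2 : v2 - u2 != 0 by rewrite subr_eq0 eq_sym.
have d3 : v3 - u3 != 0 by rewrite subr_eq0 eq_sym.
by rewrite det3E /pole !vec3E; field; rewrite d1 d2 d3.
Qed.

(** The determinant sees [y] modulo [pole u v].  In the basis of three
consecutive poles the remaining two coordinates of [y] are values of its
quadratic form at the contact points [u] and [v]: [pole u v] vanishes at both,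
[pole v t] vanishes at [v], and [pole s u] at [u]. *)
Lemma det3_pole_decomp s u v t y w : s != u -> u != v -> v != t -> s != v -> u != t ->
  det3 (pole u v) y w =
  quad_eval y u * ((t - v) / ((v - u) * (t - u))) * det3 (pole u v) (pole v t) w -
  quad_eval y v * ((u - s) / ((v - s) * (v - u))) * det3 (pole s u) (pole u v) w.
Proof.
move=> su uv vt sv ut.
have d1 : u - s != 0 by rewrite subr_eq0 eq_sym.
have d2 : v - u != 0 by rewrite subr_eq0 eq_sym.
have d3 : t - v != 0 by rewrite subr_eq0 eq_sym.
have d4 : v - s != 0 by rewrite subr_eq0 eq_sym.
have d5 : t - u != 0 by rewrite subr_eq0 eq_sym.
by rewrite !det3E /pole /quad_eval !vec3E; field; rewrite d1 d2 d3 d4 d5.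
Qed.

End Circumscribed.

Section Polygon.
Variables (R : realFieldType) (n : nat) (x : nat -> R).
Hypothesis n_gt2 : (2 < n)%N.
Hypothesis x_incr : forall i, (i.+1 < n)%N -> x i < x i.+1.

(** The contact points are in cyclic order on the projective line, so the last
one is followed by the first. *)
Definition next_point i := if (i.+1 < n)%N then x i.+1 else x 0%N.
(** The poles of the sides of the ideal polygon inscribed in the conic are the
corners of the polygon circumscribed at the same points. *)
Definition side_pole i := pole (x i) (next_point i).

Lemma point_lt i j : (i < j)%N -> (j < n)%N -> x i < x j.
Proof.
elim: j => // j IH; rewrite ltnS leq_eqVlt => /orP[/eqP ->|ij] jn; first exact: x_incr.
by rewrite (lt_trans (IH ij (ltnW jn))) // x_incr.
Qed.

Lemma point_le i j : (i <= j)%N -> (j < n)%N -> x i <= x j.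
Proof. by rewrite leq_eqVlt => /orP[/eqP -> //|ij] jn; rewrite ltW // point_lt. Qed.

Lemma point_neq_next i : (i < n)%N -> x i != next_point i.
Proof.
move=> i_n; rewrite /next_point; case: ltnP => i1; first by rewrite lt_eqF // x_incr.
by rewrite gt_eqF // point_lt //; lia.
Qed.

Lemma side_pole_convex i j k : (i < j)%N -> (j < k)%N -> (k < n)%N ->
  0 < det3 (side_pole i) (side_pole j) (side_pole k).
Proof.
move=> ij jk kn; rewrite det3_pole ?point_neq_next //; try lia.
have i1 : (i.+1 < n)%N by lia.
have j1 : (j.+1 < n)%N by lia.
have hi := x_incr i1; have hj := x_incr j1.
have hij := point_le ij (ltn_trans jk kn); have hjk := point_le jk kn.
rewrite /next_point i1 j1; case: ltnP => k1.
  have hk := x_incr k1.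
  rewrite divr_gt0 ?mulr_gt0 ?subr_gt0 // ltr_wpDl //.
    by rewrite !mulr_ge0 // ?subr_ge0 //; lra.
  by rewrite !mulr_gt0 // ?subr_gt0 //; lra.
have h0 : x 0%N <= x i by apply: point_le; lia.
have hx : 0 <= (x j - x i.+1) * (x k - x j.+1) * (x i - x 0%N).
  by rewrite !mulr_ge0 // subr_ge0.
have hy : 0 < (x j.+1 - x i) * (x j - x 0%N) * (x k - x i.+1).
  by rewrite !mulr_gt0 // subr_gt0; lra.
have hz : 0 < (x i.+1 - x i) * (x j.+1 - x j) * (x k - x 0%N).
  by rewrite !mulr_gt0 // subr_gt0; lra.
rewrite (_ : _ / _ = 2 * ((x j - x i.+1) * (x k - x j.+1) * (x i - x 0%N) +
  (x j.+1 - x i) * (x j - x 0%N) * (x k - x i.+1)) /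
  ((x i.+1 - x i) * (x j.+1 - x j) * (x k - x 0%N))).
  by rewrite divr_gt0 // mulr_gt0 // ltr_wpDl.
rewrite -[RHS]mulrNN -invrN; congr (_ / _); ring.
Qed.

(** The cross-ratio vanishes only for consecutive sides, which share an end. *)
Lemma cratio_gt0 i j : is_chord n i j -> 0 < cratio (x i) (next_point i) (x j) (next_point j).
Proof.
rewrite /is_chord => ijn; have i1 : (i.+1 < n)%N by lia.
have hi := x_incr i1.
have hij : x i.+1 < x j by apply: point_lt; lia.
rewrite /cratio /next_point i1; case: ltnP => j1.
  by have hj := x_incr j1; rewrite divr_gt0 ?mulr_gt0 // subr_gt0; lra.
have h0 : x 0%N < x i by apply: point_lt; lia.
rewrite -mulrNN -invrN -mulrN -[X in _ / X]mulrN !opprB.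
by rewrite divr_gt0 ?mulr_gt0 // subr_gt0; lra.
Qed.

Lemma bil_side_pole i : (i < n)%N -> bil (side_pole i) (side_pole i) = 1.
Proof. by move=> i_n; rewrite bil_pole // point_neq_next. Qed.

Lemma bil_side_pole_le i j : (i < j)%N -> (j < n)%N -> bil (side_pole i) (side_pole j) <= -1.
Proof.
move=> ij jn; rewrite -lerN2 opprK bil_pole2 ?point_neq_next //; last by lia.
rewrite lerDl pmulr_rge0 //.
have [ch|nch] := boolP (is_chord n i j); first exact/ltW/cratio_gt0.
rewrite /cratio (_ : (_ - _) * _ = 0) ?mul0r //.
have [e|e] := eqVneq j i.+1; first by rewrite e /next_point -e jn subrr mul0r.
have -> : i = 0%N by move: nch; rewrite /is_chord; lia.
have ej : j = n.-1 by move: nch; rewrite /is_chord; lia.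
by rewrite {2}/next_point ej prednK ?ltnn ?subrr ?mulr0 //; lia.
Qed.

(** The product is 1 for four sides that follow each other all around the
conic, and each factor increases when gaps are opened between them. *)
Lemma cratio_crossing a i b j : (a < i)%N -> (i < b)%N -> (b < j)%N -> (j < n)%N ->
  1 <= cratio (x a) (next_point a) (x b) (next_point b) *
    cratio (x i) (next_point i) (x j) (next_point j).
Proof.
move=> ai ib bj jn.
have a1 : (a.+1 < n)%N by lia.
have i1 : (i.+1 < n)%N by lia.
have b1 : (b.+1 < n)%N by lia.
have ha := x_incr a1; have hi := x_incr i1; have hb := x_incr b1.
have hai : x a.+1 <= x i by apply: point_le; lia.
have hib : x i.+1 <= x b by apply: point_le; lia.
have hbj : x b.+1 <= x j by apply: point_le; lia.
have h0a : x 0%N <= x a by apply: point_le; lia.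
rewrite /cratio /next_point a1 i1 b1.
set A0 := x a in ha hai h0a *; set A1 := x a.+1 in ha hai *; set I0 := x i in hi hai *.
set I1 := x i.+1 in hi hib *; set B0 := x b in hb hib *; set B1 := x b.+1 in hb hbj *.
set J0 := x j in hbj *.
set J1 := if _ then _ else _.
have hJ : (I0 - A0) / (J0 - A0) <= (J1 - I0) / (J1 - J0).
  have JA : 0 < J0 - A0 by lra.
  rewrite /J1; case: ltnP => j1.
    have := x_incr j1; rewrite -/J0 => hj.
    rewrite (@le_trans _ _ 1) //; first by rewrite ler_pdivrMr // mul1r; lra.
    by rewrite ler_pdivlMr ?subr_gt0 // mul1r; lra.
  rewrite -[leRHS]mulrNN -invrN !opprB.
  rewrite ler_pdivrMr // mulrAC ler_pdivlMr; last by lra.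
  have : 0 <= (A0 - x 0%N) * (J0 - I0) by rewrite mulr_ge0; lra.
  nra.
have E : (B0 - A1) * (B1 - A0) / ((A1 - A0) * (B1 - B0)) *
   ((J0 - I1) * (J1 - I0) / ((I1 - I0) * (J1 - J0))) =
   (B0 - A1) * (B1 - A0) * (J0 - I1) / ((A1 - A0) * (B1 - B0) * (I1 - I0)) *
   ((J1 - I0) / (J1 - J0)).
  by rewrite !invfM; ring.
rewrite E.
apply: (@le_trans _ _ ((B0 - A1) * (B1 - A0) * (J0 - I1) /
   ((A1 - A0) * (B1 - B0) * (I1 - I0)) * ((I0 - A0) / (J0 - A0)))); last first.
  apply: ler_wpM2l hJ; rewrite divr_ge0 // !mulr_ge0 //; lra.
have E2 : (B0 - A1) * (B1 - A0) * (J0 - I1) / ((A1 - A0) * (B1 - B0) * (I1 - I0)) *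
    ((I0 - A0) / (J0 - A0)) =
  ((B0 - A1) / (I1 - I0)) * ((I0 - A0) / (A1 - A0)) *
    (((B1 - A0) * (J0 - I1)) / ((B1 - B0) * (J0 - A0))).
  by rewrite !invfM; ring.
rewrite E2.
have g1 : 1 <= (B0 - A1) / (I1 - I0) by rewrite ler_pdivlMr ?mul1r; lra.
have g2 : 1 <= (I0 - A0) / (A1 - A0) by rewrite ler_pdivlMr ?mul1r; lra.
have g3 : 1 <= ((B1 - A0) * (J0 - I1)) / ((B1 - B0) * (J0 - A0)).
  rewrite ler_pdivlMr ?mul1r; last by rewrite mulr_gt0; lra.
  have : 0 <= (J0 - B1) * (B0 - A0) by rewrite mulr_ge0; lra.
  have : 0 <= (B1 - A0) * (B0 - I1) by rewrite mulr_ge0; lra.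
  nra.
by rewrite -[1]mulr1 ler_pM // -[1]mulr1 ler_pM.
Qed.

End Polygon.

(** * Equilibrium makes the total roof linear *)

Section Neighbours.
Variables (R : realFieldType) (n : nat) (q : nat -> 'rV[R]_3) (c : rel nat).

(** Up to the component along [q k], the force at the corner [k] when each chord
pulls with unit stress. *)
Definition neighbour_sum k : 'rV[R]_3 := \sum_(j < n | c k j) q j + \sum_(j < n | c j k) q j.

Lemma sum_chords (V : zmodType) (F : nat -> nat -> V) :
  \sum_(p : 'I_n * 'I_n | c p.1 p.2) F p.1 p.2 =
  \sum_(i < n) \sum_(j < n | c i j) F i j.
Proof.
by rewrite (pair_big_dep xpredT (fun i j : 'I_n => c i j) (fun i j : 'I_n => F i j)).
Qed.

Hypothesis c_chord : forall i j, c i j -> is_chord n i j.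
Hypothesis q_convex : forall i j k, (i < j)%N -> (j < k)%N -> (k < n)%N ->
  0 < det3 (q i) (q j) (q k).

(** The determinant of a chord [ij] is negative at the corners between [i] and
[j] and positive at those outside, so this is the linear function that agrees
with the roof along the side from [q k] to [q k.+1]. *)
Definition side_slope k : 'rV[R]_3 :=
  \sum_(p : 'I_n * 'I_n | c p.1 p.2)
    (if (p.1 <= k < p.2)%N then -1 else 1) *: cross (q p.1) (q p.2).

Lemma roof_side_slope k : (k < n)%N -> roof n q c (q k) = dot (side_slope k) (q k).
Proof.
move=> kn; rewrite dot_suml; apply: eq_bigr => -[[i i_n] [j jn]] /= cij.
have := c_chord cij; rewrite /is_chord => ijn; rewrite dotZl -/(det3 _ _ _).
have [->|ki] := eqVneq k i; first by rewrite det3_first mulr0 normr0.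
have [->|kj] := eqVneq k j; first by rewrite det3_second mulr0 normr0.
case: ifP => h.
  by rewrite mulN1r ltr0_norm // (det3_inside q_convex) //; lia.
by rewrite mul1r gtr0_norm // (det3_outside q_convex) //; lia.
Qed.

Lemma roof_side_slope_pred k : (k.+1 < n)%N ->
  roof n q c (q k.+1) = dot (side_slope k) (q k.+1).
Proof.
move=> kn; rewrite dot_suml; apply: eq_bigr => -[[i i_n] [j jn]] /= cij.
have := c_chord cij; rewrite /is_chord => ijn; rewrite dotZl -/(det3 _ _ _).
have [->|ki] := eqVneq k.+1 i; first by rewrite det3_first mulr0 normr0.
have [->|kj] := eqVneq k.+1 j; first by rewrite det3_second mulr0 normr0.
case: ifP => h.
  by rewrite mulN1r ltr0_norm // (det3_inside q_convex) //; lia.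
by rewrite mul1r gtr0_norm // (det3_outside q_convex) //; lia.
Qed.

(** Passing the corner [k.+1] changes the sign of the chords that end there. *)
Lemma side_slope_step k y : (k.+1 < n)%N ->
  dot (side_slope k.+1) y - dot (side_slope k) y = - 2 * det3 (q k.+1) (neighbour_sum k.+1) y.
Proof.
move=> kn; rewrite !dot_suml -sumrB.
pose F i j := (if i == k.+1 then - 2 else 0) * det3 (q i) (q j) y +
  (if j == k.+1 then 2 else 0) * det3 (q i) (q j) y.
rewrite (eq_bigr (fun p : 'I_n * 'I_n => F p.1 p.2)); last first.
  move=> [[i i_n] [j jn]] /= cij; have := c_chord cij; rewrite /is_chord => ijn.
  rewrite !dotZl -/(det3 _ _ _) -mulrBl /F -mulrDl; congr (_ * _).
  have [e1|e1] := eqVneq i k.+1.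
    rewrite e1 leqnn ltnn /=.
    have -> : (j == k.+1) = false by lia.
    have -> : (k.+1 < j)%N by lia.
    by rewrite addr0 -opprD.
  have [e2|e2] := eqVneq j k.+1.
    rewrite e2 ltnn andbF leqnn andbT.
    have -> : (i <= k)%N by lia.
    by rewrite add0r opprK.
  have -> : (i <= k.+1 < j)%N = (i <= k < j)%N by lia.
  by rewrite subrr addr0.
rewrite (sum_chords F) /F.
under eq_bigr => i _ do rewrite big_split /=.
rewrite big_split /=.
pose k1 := Ordinal kn.
have -> : \sum_(i < n) \sum_(j < n | c i j)
    (if i == k.+1 :> nat then - 2 else 0) * det3 (q i) (q j) y =
    - 2 * \sum_(j < n | c k.+1 j) det3 (q k.+1) (q j) y.
  rewrite (bigD1 k1) //= eqxx -mulr_sumr [X in _ + X]big1 ?addr0 // => i.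
  rewrite -val_eqE /= => ik; rewrite (negPf ik).
  by rewrite big1 // => j _; rewrite mul0r.
have -> : \sum_(i < n) \sum_(j < n | c i j)
    (if j == k.+1 :> nat then 2 else 0) * det3 (q i) (q j) y =
    2 * \sum_(i < n | c i k.+1) det3 (q i) (q k.+1) y.
  rewrite (exchange_big_dep xpredT) //= (bigD1 k1) //= eqxx -mulr_sumr [X in _ + X]big1 ?addr0 //
    => j.
  rewrite -val_eqE /= => jk; rewrite (negPf jk).
  by rewrite big1 // => i _; rewrite mul0r.
rewrite /neighbour_sum det3D2 !det3_sum2 mulrDr; congr (_ + _).
rewrite mulNr -mulrN -sumrN; congr (_ * _); apply: eq_bigr => i _.
by rewrite det3_swapl.
Qed.

End Neighbours.

Section Equilibrium.
Variables (R : realFieldType) (n : nat) (x : nat -> R) (c : rel nat).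
Hypothesis n_gt3 : (3 < n)%N.
Hypothesis x_incr : forall i, (i.+1 < n)%N -> x i < x i.+1.
Hypothesis c_chord : forall i j, c i j -> is_chord n i j.
Let q := side_pole n x.
Let S k := neighbour_sum n q c k.

Hypothesis x_critical : forall k, (1 < k)%N -> (k.+1 < n)%N ->
  quad_eval (S k.-1) (x k.-1) / (x k - x k.-1) ^+ 2 =
    quad_eval (S k) (x k.+1) / (x k.+1 - x k) ^+ 2.

(** The stress of the side [k] that balances the force of the chords at its
first end. *)
Definition rim_tension k : R := let t := next_point n x k.+1 in
  quad_eval (S k) (x k) * ((t - x k.+1) / ((x k.+1 - x k) * (t - x k))).
(** The added term vanishes along the side [k], so [face_slope k] also agrees
with the roof there. *)
Definition face_slope k : 'rV[R]_3 :=
  side_slope n q c k + (2 * rim_tension k) *: cross (q k) (q k.+1).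

Lemma next_point_neq k : (0 < k)%N -> (k.+1 < n)%N -> x k != next_point n x k.+1.
Proof.
move=> k0 kn; rewrite /next_point; case: ltnP => k2.
  by rewrite lt_eqF // (point_lt x_incr) //.
by rewrite gt_eqF // (point_lt x_incr) //; lia.
Qed.

Let q_convex := side_pole_convex (ltnW n_gt3) x_incr.

Lemma det3_neighbour_sum k y : (k.+2 < n)%N -> det3 (q k.+1) (S k.+1) y =
  rim_tension k.+1 * det3 (q k.+1) (q k.+2) y -
  quad_eval (S k.+1) (x k.+2) * ((x k.+1 - x k) / ((x k.+2 - x k) * (x k.+2 - x k.+1)))
   * det3 (q k) (q k.+1) y.
Proof.
move=> kn; have kn1 := ltnW kn.
have q0 : q k = pole (x k) (x k.+1) by rewrite /q /side_pole /next_point kn1.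
have q1 : q k.+1 = pole (x k.+1) (x k.+2) by rewrite /q /side_pole /next_point kn.
rewrite q0 q1; apply: det3_pole_decomp.
- by rewrite lt_eqF // x_incr.
- by rewrite lt_eqF // x_incr.
- exact: (point_neq_next (ltnW n_gt3) x_incr).
- by rewrite lt_eqF // (point_lt x_incr).
- exact: next_point_neq.
Qed.

(** By the critical equation at the contact point [x k.+1] of the side from
[q k] to [q k.+1], the tension that balances one end of the side balances the
other end as well. *)
Lemma face_slope_step k y : (0 < k)%N -> (k.+2 < n)%N ->
  dot (face_slope k.+1) y = dot (face_slope k) y.
Proof.
move=> k0 kn; have kn1 := ltnW kn.
have step := side_slope_step q c_chord y kn1.
have E : quad_eval (S k.+1) (x k.+2) * ((x k.+1 - x k) / ((x k.+2 - x k) * (x k.+2 - x k.+1)))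
   = rim_tension k.
  rewrite /rim_tension /next_point kn.
  have := x_critical (k := k.+1) k0 kn; rewrite /=.
  have d1 : x k.+1 - x k != 0 by rewrite subr_eq0 gt_eqF // x_incr.
  have d2 : x k.+2 - x k.+1 != 0 by rewrite subr_eq0 gt_eqF // x_incr.
  have d3 : x k.+2 - x k != 0 by rewrite subr_eq0 gt_eqF // (point_lt x_incr).
  move=> H.
  have -> : quad_eval (S k.+1) (x k.+2) = (x k.+2 - x k.+1) ^+ 2 *
     (quad_eval (S k) (x k) / (x k.+1 - x k) ^+ 2).
    by rewrite H; field.
  by field; rewrite d1 d2 d3.
rewrite /face_slope !dotDl !dotZl -!/(det3 _ _ _).
move: step; rewrite -/(S k.+1) det3_neighbour_sum // E; lra.
Qed.

Lemma face_slope_const k y : (0 < k)%N -> (k.+1 < n)%N ->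
  dot (face_slope k) y = dot (face_slope 1) y.
Proof.
elim: k => // -[_ _ _|k IH _ kn] //.
by rewrite face_slope_step // IH // ltnW.
Qed.

(** The slopes of all sides from 1 onwards are the same linear form, which
gives the values at all corners from 1 onwards.  The corner 0 is reached
through the side 0, whose [side_slope] differs from [face_slope 1] by a form
that vanishes at [q 0]. *)
Lemma roof_equilibrium k : (k < n)%N -> roof n q c (q k) = dot (face_slope 1) (q k).
Proof.
have tail m : (0 < m)%N -> (m.+1 < n)%N -> dot (face_slope 1) (q m) =
  dot (side_slope n q c m) (q m).
  move=> m0 mn; rewrite -(face_slope_const _ m0 mn) /face_slope dotDl dotZl.
  by rewrite -/(det3 _ _ _) det3_first mulr0 addr0.
move=> kn; have [k0|k0] := posnP k.
  rewrite k0 roof_side_slope //; last by lia.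
  have n1 : (1 < n)%N by lia.
  have := side_slope_step q c_chord (q 0%N) n1.
  rewrite -/(S 1%N) det3_neighbour_sum ?det3_first //; last by lia.
  rewrite /face_slope dotDl dotZl -/(det3 _ _ _); lra.
have [kn1|kn1] := ltnP k.+1 n; first by rewrite tail // roof_side_slope.
case: k k0 kn kn1 => // k _ kn kn1.
rewrite roof_side_slope_pred // -(@face_slope_const k) //; last by lia.
by rewrite /face_slope dotDl dotZl -/(det3 _ _ _) det3_second mulr0 addr0.
Qed.

End Equilibrium.

(** * Gaps of a configuration of bounded cost *)

(** What 3-connectivity says about the chords of a Hamiltonian cycle. *)
Definition linked (n : nat) (c : rel nat) := forall a b, is_chord n a b ->
  exists i j, c i j /\ ([&& a < i, i < b & b < j]%N || [&& i < a, a < j & j < b]%N).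

Section Cost.
Variables (R : realFieldType) (n : nat) (c : rel nat).
Hypothesis n_gt3 : (3 < n)%N.
Hypothesis c_chord : forall i j, c i j -> is_chord n i j.
Hypothesis c_linked : linked n c.
Implicit Types x y : nat -> R.

Definition chord_cratio x i j := cratio (x i) (next_point n x i) (x j) (next_point n x j).
Definition cost x := \sum_(p : 'I_n * 'I_n | c p.1 p.2) chord_cratio x p.1 p.2.

(** Up to a projective transformation of the conic, three contact points may be
prescribed. *)
Definition normalized x := [/\ x 0%N = - 2, x 1%N = 0 & x n.-1 = 2].
Definition increasing x := forall i, (i.+1 < n)%N -> x i < x i.+1.

Lemma cost_ext x y : (forall i, (i < n)%N -> x i = y i) -> cost x = cost y.
Proof.
move=> xy; apply: eq_bigr => -[[i i_n] [j jn]] _ /=.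
have nxy k : (k < n)%N -> next_point n x k = next_point n y k.
  by move=> kn; rewrite /next_point; case: ifP => h; apply: xy => //; lia.
by rewrite /chord_cratio !xy ?nxy.
Qed.

Lemma chord_cratio_le_cost x i j : increasing x -> c i j -> chord_cratio x i j <= cost x.
Proof.
move=> xi cij; have := c_chord cij; rewrite /is_chord => ijn.
have i_n : (i < n)%N by lia.
have jn : (j < n)%N by lia.
rewrite /cost (bigD1 ((Ordinal i_n, Ordinal jn) : 'I_n * 'I_n)) //= lerDl.
apply: sumr_ge0 => p /andP[cp _]; apply/ltW/(cratio_gt0 (ltnW n_gt3) xi).
exact: c_chord.
Qed.

(** Some chord interlaces [ab]; its cross-ratio is at most [M], and the product
with that of [ab] is at least 1. *)
Lemma chord_cratio_ge x M a b : increasing x -> cost x <= M -> is_chord n a b ->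
  1 <= M * chord_cratio x a b.
Proof.
move=> xi xM ab; have [i [j [cij cross]]] := c_linked ab.
have := c_chord cij; move: (ab); rewrite /is_chord => abn ijn.
have cM := le_trans (chord_cratio_le_cost xi cij) xM.
have ab0 : 0 < chord_cratio x a b by exact: (cratio_gt0 (ltnW n_gt3) xi).
have H : 1 <= chord_cratio x i j * chord_cratio x a b.
  case/orP: cross => /and3P[h1 h2 h3].
    by rewrite mulrC; apply: (cratio_crossing (ltnW n_gt3) xi) => //; lia.
  by apply: (cratio_crossing (ltnW n_gt3) xi) => //; lia.
by rewrite (le_trans H) // ler_wpM2r // ltW.
Qed.

Lemma point_range x i : increasing x -> normalized x -> (i < n)%N -> -2 <= x i <= 2.
Proof.
move=> xi [<- _ <-] i_n.
by rewrite !(point_le xi) //; lia.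
Qed.

Section Bounds.
Variables (M : R) (x : nat -> R).
Hypothesis M_gt0 : 0 < M.
Hypothesis x_incr : increasing x.
Hypothesis x_norm : normalized x.
Hypothesis x_cost : cost x <= M.

(** The side that ends the numbering and the side [b] are not too close, so the
contact points cannot jump close to the last one. *)
Lemma top_gap b : (0 < b)%N -> (b.+2 < n)%N -> 2 - x b <= (1 + M) * (2 - x b.+1).
Proof.
move=> b0 bn.
have ch : is_chord n b n.-1 by rewrite /is_chord; lia.
have := chord_cratio_ge x_incr x_cost ch.
have [e0 _ e2] := x_norm.
rewrite /chord_cratio /cratio /next_point (ltn_trans _ bn) // prednK; last by lia.
rewrite ltnn e0 e2.
have gap : 0 < x b.+1 - x b by rewrite subr_gt0 x_incr // ltnW.
have /andP[r1 r2] := @point_range x b x_incr x_norm ltac:(lia).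
have /andP[r3 r4] := @point_range x b.+1 x_incr x_norm ltac:(lia).
rewrite mulrA -[X in M * X]mulrNN.
rewrite (_ : _ / _ = (M * ((2 - x b.+1) * (x b + 2))) / ((x b.+1 - x b) * 4)); last first.
  by field; rewrite gt_eqF.
rewrite ler_pdivlMr ?mul1r; last by rewrite mulr_gt0.
move=> H.
have : 0 <= M * ((2 - x b.+1) * (2 - x b)) by rewrite !mulr_ge0 ?subr_ge0 // ltW.
lra.
Qed.

Lemma top_gap_iter k : (k.+2 < n)%N -> 2 <= (1 + M) ^+ k * (2 - x k.+1).
Proof.
elim: k => [|k IH] kn; first by have [_ -> _] := x_norm; rewrite expr0; lra.
have := IH (ltnW kn); have := @top_gap k.+1 isT kn.
move=> h /le_trans; apply; rewrite exprSr -mulrA ler_wpM2l //.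
by rewrite exprn_ge0 // addr_ge0 // ltW.
Qed.

(** If the side [a] is not too short, its distance to the side [b] bounds the
rate at which contact points move away from [x a.+1]. *)
Lemma gap_ratio a b d : 0 < d -> d <= x a.+1 - x a -> (a.+1 < b)%N -> (b.+1 < n)%N ->
  x b.+1 - x a.+1 <= (1 + 4 * M / d) * (x b - x a.+1).
Proof.
move=> d0 da ab bn.
have ch : is_chord n a b by rewrite /is_chord; lia.
have := chord_cratio_ge x_incr x_cost ch.
have a1 : (a.+1 < n)%N by lia.
rewrite /chord_cratio /cratio /next_point a1 bn.
have gapa : 0 < x a.+1 - x a by rewrite subr_gt0 x_incr.
have gapb : 0 < x b.+1 - x b by rewrite subr_gt0 x_incr.
have /andP[r1 r2] := @point_range x a x_incr x_norm ltac:(lia).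
have /andP[r3 r4] := @point_range x b.+1 x_incr x_norm ltac:(lia).
have xab : 0 < x b - x a.+1 by rewrite subr_gt0 (point_lt x_incr) //; lia.
rewrite mulrA ler_pdivlMr ?mul1r; last by rewrite mulr_gt0.
move=> H.
have H1 : d * (x b.+1 - x b) <= (x a.+1 - x a) * (x b.+1 - x b).
  by rewrite ler_wpM2r // ltW.
have H2 : M * ((x b - x a.+1) * (x b.+1 - x a)) <= M * ((x b - x a.+1) * 4).
  by apply: ler_wpM2l; [exact: ltW|apply: ler_wpM2l; [exact: ltW|lra]].
have H3 : x b.+1 - x b <= 4 * M / d * (x b - x a.+1).
  rewrite mulrAC ler_pdivlMr //; lra.
rewrite mulrDl mul1r; lra.
Qed.

Lemma gap_ratio_iter a l d : 0 < d -> d <= x a.+1 - x a -> (a + l.+2 < n)%N ->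
  x (a + l.+2)%N - x a.+1 <= (1 + 4 * M / d) ^+ l * (x a.+2 - x a.+1).
Proof.
move=> d0 da; elim: l => [|l IH] ln; first by rewrite expr0 mul1r addn2.
rewrite addnS in ln *; apply: le_trans (gap_ratio d0 da _ ln) _; first by lia.
rewrite exprS -[leRHS]mulrA ler_wpM2l ?IH //; last by lia.
by rewrite addr_ge0 // divr_ge0 ?ltW // mulr_gt0.
Qed.

(** Starting from [x a.+1], the contact points move away at a bounded rate and
yet have to reach the last point, which is not too close; hence the first step
is not too short. *)
Lemma gap_step a d : 0 < d -> d <= x a.+1 - x a -> (a.+2 < n)%N ->
  2 / ((1 + M) ^+ a * (1 + 4 * M / d) ^+ (n - a.+3)) <= x a.+2 - x a.+1.
Proof.
move=> d0 da an.
have h1 := top_gap_iter an.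
have h2 := @gap_ratio_iter a (n - a.+3) d d0 da ltac:(lia).
have L0 : 0 < (1 + 4 * M / d) ^+ (n - a.+3).
  by rewrite exprn_gt0 // addr_gt0 // divr_gt0 // mulr_gt0.
have M0 : 0 < (1 + M) ^+ a by rewrite exprn_gt0 // addr_gt0.
rewrite ler_pdivrMr ?mulr_gt0 // mulrCA (le_trans h1) // ler_pM2l // mulrC.
have [_ _ <-] := x_norm.
by move: h2; rewrite (_ : (a + (n - a.+3).+2)%N = n.-1) //; lia.
Qed.

End Bounds.

(** The first gap is prescribed, and each gap bounds the next one from below. *)
Lemma gap_lower_bound M : 0 < M -> exists2 d : R, 0 < d & forall x,
  increasing x -> normalized x -> cost x <= M ->
  forall k, (k.+1 < n)%N -> d <= x k.+1 - x k.
Proof.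
move=> M0.
suff [d d0 H] : exists2 d : R, 0 < d & forall x, increasing x -> normalized x ->
    cost x <= M -> forall k, (k <= n)%N -> (k.+1 < n)%N -> d <= x k.+1 - x k.
  by exists d => // x h1 h2 h3 k kn; apply: H => //; lia.
elim: {1}n => [|m [d d0 IH]].
  exists 2 => // x _ [e0 e1 _] _ k; rewrite leqn0 => /eqP -> _.
  by rewrite e0 e1; lra.
(* [gap_step] turns a lower bound for the gap [m] into one for the gap
[m.+1].  The induction goes by the number of gaps already bounded. *)
pose d' := 2 / ((1 + M) ^+ m * (1 + 4 * M / d) ^+ (n - m.+3)).
have d'0 : 0 < d'.
  by rewrite divr_gt0 // mulr_gt0 // exprn_gt0 // addr_gt0 // divr_gt0 // mulr_gt0.
exists (Num.min d d'); first by rewrite lt_min d0.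
move=> x h1 h2 h3 k; rewrite leq_eqVlt => /orP[/eqP ->|km] kn; last first.
  by rewrite ge_min IH.
rewrite ge_min; apply/orP; right.
by apply: (gap_step M0 h1 h2 h3 d0) => //; apply: IH => //; lia.
Qed.

End Cost.

(** * The configuration of least cost *)

Section Variation.
Variables (R : realFieldType) (n : nat) (c : rel nat) (x : nat -> R) (k : nat) (t : R).
Hypothesis n_gt2 : (2 < n)%N.
Hypothesis c_chord : forall i j, c i j -> is_chord n i j.
Hypothesis x_incr : increasing n x.
Hypothesis kn : (k.+2 < n)%N.
Hypothesis xt : x k < t < x k.+2.

Definition moved j := if j == k.+1 then t else x j.

Lemma moved_incr : increasing n moved.
Proof.
move=> i i1; case/andP: xt => t1 t2; rewrite /moved.
have [e|ne] := eqVneq i k.+1; first by rewrite e; have -> : (k.+2 == k.+1) = false by lia.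
have [e|ne'] := eqVneq i.+1 k.+1; first by have -> : i = k by lia.
exact: x_incr.
Qed.

Let q := side_pole n x.
Let q' := side_pole n moved.
Let S := neighbour_sum n q c.

Lemma side_pole_moved i : i != k -> i != k.+1 -> q' i = q i.
Proof.
move=> ik ik1; rewrite /q' /q /side_pole /next_point /moved (negPf ik1).
by have -> : (i.+1 == k.+1) = false by lia.
Qed.

(** Moving the contact point [x k.+1] affects the two poles on either side of
it, each by a multiple of an isotropic vector. *)
Lemma cost_moved : cost n c moved - cost n c x =
  quad_eval (S k) (x k) * ((t - x k)^-1 - (x k.+1 - x k)^-1) +
  quad_eval (S k.+1) (x k.+2) * ((x k.+2 - t)^-1 - (x k.+2 - x k.+1)^-1).
Proof.
pose D i := q' i - q i.
have D0 i : i != k -> i != k.+1 -> D i = 0.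
  by move=> h1 h2; rewrite /D side_pole_moved // subrr.
have crE (y : nat -> R) i j : increasing n y -> c i j ->
    chord_cratio n y i j = - (1 + bil (side_pole n y i) (side_pole n y j)) / 2.
  move=> yi cij; have := c_chord cij; rewrite /is_chord => ijn.
  have := bil_pole2 (@point_neq_next _ n y n_gt2 yi i ltac:(lia))
    (@point_neq_next _ n y n_gt2 yi j ltac:(lia)).
  by rewrite -/(side_pole n y i) -/(side_pole n y j) /chord_cratio => h; lra.
have diff i j : c i j -> chord_cratio n moved i j - chord_cratio n x i j =
    - 2^-1 * bil (D i) (q j) + - 2^-1 * bil (D j) (q i).
  move=> cij; rewrite (crE _ _ _ moved_incr cij) (crE _ _ _ x_incr cij).
  have := c_chord cij; rewrite /is_chord => ijn.
  have DD : bil (D i) (D j) = 0.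
    have [e|e] := boolP ((i != k) && (i != k.+1)).
      by case/andP: e => e1 e2; rewrite D0 // bil0l.
    by rewrite bilC D0 ?bil0l //; lia.
  have : bil (q' i) (q' j) = bil (q i) (q j) + bil (D i) (q j) + bil (D j) (q i) + bil (D i) (D j).
    by rewrite /D /bil !mxE; ring.
  by rewrite DD addr0 -/q' => ->; rewrite -/(q i) -/(q j); lra.
rewrite /cost -sumrB; under eq_bigr => p cp do rewrite (diff _ _ cp).
rewrite big_split /=.
rewrite (sum_chords n c (fun i j => - 2^-1 * bil (D i) (q j))).
rewrite (sum_chords n c (fun i j => - 2^-1 * bil (D j) (q i))).
rewrite [X in _ + X](exchange_big_dep xpredT) //= -big_split /=.
have k_n : (k < n)%N by lia.
have k1n : (k.+1 < n)%N by lia.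
have ne_k : Ordinal k1n != Ordinal k_n by rewrite -val_eqE /=; lia.
rewrite (bigD1 (Ordinal k_n)) //= [X in _ + X = _](bigD1 (Ordinal k1n)) //=.
rewrite [X in _ + (_ + X)]big1 ?addr0; last first.
  move=> i /andP[]; rewrite -!val_eqE /= => i1 i2.
  by rewrite !big1 ?addr0 // => j _; rewrite D0 // bil0l mulr0.
have sumS i : \sum_(j < n | c i j) - 2^-1 * bil (D i) (q j) +
   \sum_(j < n | c j i) - 2^-1 * bil (D i) (q j) = - 2^-1 * bil (D i) (S i).
  by rewrite -!mulr_sumr -mulrDr -!bil_sumr bilC (bilC _ (\sum_(i0 < n | c i0 i) _)) -bilDl bilC.
rewrite !sumS /D; case/andP: xt => t1 t2.
have qk : q k = pole (x k) (x k.+1) by rewrite /q /side_pole /next_point k1n.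
have qk1 : q k.+1 = pole (x k.+1) (x k.+2) by rewrite /q /side_pole /next_point kn.
have k_k1 : (k == k.+1) = false by lia.
have k2_k1 : (k.+2 == k.+1) = false by lia.
have q'k : q' k = pole (x k) t by rewrite /q' /side_pole /next_point k1n /moved eqxx k_k1.
have q'k1 : q' k.+1 = pole t (x k.+2) by rewrite /q' /side_pole /next_point kn /moved eqxx k2_k1.
have a1 := x_incr k1n; have a2 := x_incr kn.
rewrite qk qk1 q'k q'k1 !bilBl bil_pole_right ?lt_eqF // bil_pole_left ?lt_eqF //.
rewrite -/(S _); lra.
Qed.

End Variation.

(** The first-order condition, for a function of this particular shape, at a
minimum in the interior. *)
Lemma stationary_balance (R : realFieldType) (U V p w r : R) :
  0 < r -> r < p -> r < w ->
  (forall s, `|s| <= r -> 0 <= U * ((p + s)^-1 - p^-1) + V * ((w - s)^-1 - w^-1)) ->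
  U / p ^+ 2 = V / w ^+ 2.
Proof.
move=> r0 rp rw H.
pose E := V * p ^+ 2 - U * w ^+ 2; pose F := V * p + U * w.
have H' s : `|s| <= r -> 0 <= s * (E + s * F).
  move=> sr; have := H s sr; move: sr; rewrite ler_norml => /andP[s1 s2].
  have p0 : 0 < p by lra.
  have w0 : 0 < w by lra.
  have ps : 0 < p + s by lra.
  have ws : 0 < w - s by lra.
  have -> : U * ((p + s)^-1 - p^-1) + V * ((w - s)^-1 - w^-1) =
     (s * (E + s * F)) / (p * (p + s) * w * (w - s)).
    by rewrite /E /F; field; rewrite !gt_eqF.
  have den : 0 < (p * (p + s) * w * (w - s))^-1 by rewrite invr_gt0 !mulr_gt0.
  by rewrite (pmulr_lge0 _ den).
suff E0 : E = 0.
  have p0 : p != 0 by rewrite gt_eqF //; lra.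
  have w0 : w != 0 by rewrite gt_eqF //; lra.
  by apply/eqP; rewrite eqr_div ?expf_neq0 // eq_sym -subr_eq0; apply/eqP.
apply/eqP/negPn/negP => E0.
have aE : 0 < `|E| by rewrite normr_gt0.
(* If [E <> 0], a small step against the sign of [E] makes the product
negative, as the linear term dominates. *)
pose sg := Num.min (r / `|E|) ((2 * (`|F| + 1))^-1).
have F1 : 0 < 2 * (`|F| + 1) by have := normr_ge0 F; lra.
have sg0 : 0 < sg by rewrite lt_min divr_gt0 //= invr_gt0.
have sgE : sg * `|E| <= r by rewrite -ler_pdivlMr // ge_min lexx.
have sgF : sg * F < 1.
  apply: (@le_lt_trans _ _ (sg * `|F|)); first by rewrite ler_wpM2l ?ler_norm // ltW.
  have : sg * (2 * (`|F| + 1)) <= 1.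
    by rewrite -ler_pdivlMr // mul1r ge_min lexx orbT.
  have := normr_ge0 F; have : 0 <= sg * `|F| by rewrite mulr_ge0 // ltW.
  nra.
have := H' (- sg * E); rewrite normrM normrN (gtr0_norm sg0) => /(_ sgE).
have -> : - sg * E * (E + - sg * E * F) = - (sg * E ^+ 2 * (1 - sg * F)) by ring.
rewrite oppr_ge0 leNgt => /negP; apply.
have E2 : 0 < E ^+ 2 by rewrite exprn_even_gt0.
by apply: mulr_gt0; [exact: mulr_gt0|rewrite subr_gt0].
Qed.

Section Minimum.
Variables (R : realType) (n : nat) (c : rel nat).
Hypothesis n_gt3 : (3 < n)%N.
Hypothesis c_chord : forall i j, c i j -> is_chord n i j.
Hypothesis c_linked : linked n c.

Let seqn (v : 'rV[R]_n) (k : nat) : R := if insub k is Some i then v 0 i else 0.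
Let rown (x : nat -> R) : 'rV[R]_n := \row_i x i.

Let seqn_rown x k : (k < n)%N -> seqn (rown x) k = x k.
Proof. by move=> kn; rewrite /seqn insubT /= mxE. Qed.

Let seqn_continuous k : continuous (seqn ^~ k).
Proof.
rewrite /seqn; case: insub => [i|]; first exact: coord_continuous.
exact: cst_continuous.
Qed.

(** Gaps bounded below by [d] make the set of configurations compact. *)
Definition spaced (d : R) x := normalized n x /\
  forall k, (k.+1 < n)%N -> d <= x k.+1 - x k.

Lemma spaced_incr d x : 0 < d -> spaced d x -> increasing n x.
Proof. by move=> d0 [_ h] i i1; rewrite -subr_gt0 (lt_le_trans d0) // h. Qed.

Let spaced_ext d x y : (forall i, (i < n)%N -> x i = y i) -> spaced d x -> spaced d y.
Proof.
move=> xy [[h0 h1 h2] h]; split; first by split; rewrite -xy //; lia.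
by move=> k kn; rewrite -!xy //; [exact: h|lia].
Qed.

Let spaced_closed d : closed [set v | spaced d (seqn v)].
Proof.
have -> : [set v | spaced d (seqn v)] =
  (seqn ^~ 0%N @^-1` [set - 2]) `&` (seqn ^~ 1%N @^-1` [set 0]) `&`
  (seqn ^~ n.-1 @^-1` [set 2]) `&`
  \bigcap_(k in [set k | (k.+1 < n)%N]) ((fun v => seqn v k.+1 - seqn v k) @^-1` [set y | d <= y]).
  apply/seteqP; split=> v /=.
    by case=> -[h0 h1 h2] h; split; [split; [split|]|exact: h].
  by case=> -[[h0 h1] h2] h; split; [split|exact: h].
have closed_pre (f : 'rV[R]_n -> R) (A : set R) : continuous f -> closed A -> closed (f @^-1` A).
  by move=> cf; apply: closed_comp => v _; exact: cf.
apply: closedI; last first.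
  apply: closed_bigI => k _; apply: closed_pre; last exact: closed_ge.
  by move=> v; exact: (cvgB (@seqn_continuous _ v) (@seqn_continuous _ v)).
apply: closedI; [apply: closedI|].
- exact: (closed_pre _ _ (@seqn_continuous _) (@closed_eq R (- 2))).
- exact: (closed_pre _ _ (@seqn_continuous _) (@closed_eq R 0)).
- exact: (closed_pre _ _ (@seqn_continuous _) (@closed_eq R 2)).
Qed.

Let spaced_compact d : 0 < d -> compact [set v | spaced d (seqn v)].
Proof.
move=> d0; pose B := [set v : 'rV[R]_n | forall i, `[-2 : R, 2]%classic (v ord0 i)].
apply: (@subclosed_compact _ _ B); first exact: spaced_closed.
  by apply: (@rV_compact R n (fun=> `[-2 : R, 2]%classic)) => i; exact: segment_compact.
move=> v /= sv i; have := point_range n_gt3 (spaced_incr d0 sv) (proj1 sv) (ltn_ord i).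
by rewrite /= in_itv /seqn valK.
Qed.

Let cost_continuous d v : 0 < d -> spaced d (seqn v) ->
  {for v, continuous (fun v => cost n c (seqn v))}.
Proof.
move=> d0 sv.
have xi := spaced_incr d0 sv.
have Fv : Filter (nbhs v) := alias_nbhs_filter v.
have cs k : seqn w k @[w --> v] --> seqn v k := @seqn_continuous k v.
have cn k : next_point n (seqn w) k @[w --> v] --> next_point n (seqn v) k.
  by rewrite /next_point; case: ifP => _; exact: cs.
have neq i : (i < n)%N -> next_point n (seqn v) i - seqn v i != 0.
  by move=> i_n; rewrite subr_eq0 eq_sym (point_neq_next (ltnW n_gt3) xi i_n).
have cr (i j : 'I_n) :
    chord_cratio n (seqn w) i j @[w --> v] --> chord_cratio n (seqn v) i j.
  have num := cvgM (cvgB (cs j) (cn i)) (cvgB (cn j) (cs i)).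
  have den := cvgM (cvgB (cn i) (cs i)) (cvgB (cn j) (cs j)).
  have den0 := mulf_neq0 (neq i (ltn_ord i)) (neq j (ltn_ord j)).
  exact: (cvgM (num Fv Fv Fv) (cvgV den0 (den Fv Fv Fv))).
exact: (@cvg_big _ _ +%R 0 (fun p : 'I_n * 'I_n => c p.1 p.2) (@add_continuous _)
  _ (nbhs v) _ _ _ Fv (fun p _ => cr p.1 p.2)).
Qed.

Lemma cost_minimum d x0 : 0 < d -> spaced d x0 ->
  exists2 x, spaced d x & forall y, spaced d y -> cost n c x <= cost n c y.
Proof.
move=> d0 sx0; pose K := [set v | spaced d (seqn v)].
have K_rown y : spaced d y -> K (rown y).
  by apply: spaced_ext => i i_n; rewrite seqn_rown.
have [||v vK vmin] := @compact_EVT_min _ R (fun v => cost n c (seqn v)) K _ (spaced_compact d0) _.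
- by exists (rown x0); exact: K_rown.
- by apply: continuous_in_subspaceT => w; rewrite inE => sw; exact: (cost_continuous d0).
exists (seqn v); first by rewrite inE in vK.
move=> y sy; have := vmin (rown y); rewrite inE => /(_ (K_rown _ sy)).
by rewrite (@cost_ext _ _ _ n_gt3 (seqn (rown y)) y) // => i; exact: seqn_rown.
Qed.

Let reference_point k : R := if k == 0%N then - 2 else 2 * k.-1%:R / n.-2%:R.

Let reference_point_spaced : spaced (2 / n.-2%:R) reference_point.
Proof.
have n2 : 0 < n.-2%:R :> R by rewrite ltr0n; lia.
have n21 : 1 <= n.-2%:R :> R by rewrite ler1n; lia.
split; first split => //.
- by rewrite /reference_point /= mulr0 mul0r.
- rewrite /reference_point (_ : (n.-1 == 0%N) = false); last by lia.
  by rewrite mulfK // gt_eqF.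
- move=> [|k] kn; rewrite /reference_point /=.
    by rewrite mulr0 mul0r sub0r opprK ler_pdivrMr //; lra.
  by rewrite -mulrBl -mulrBr -natrB // subSnn mulr1.
Qed.

(** The minimum among configurations with gaps at least [d'] is interior, as its
cost forces gaps that are larger than [d']. *)
Theorem critical_configuration : exists x : nat -> R,
  [/\ increasing n x, normalized n x &
      forall k, (1 < k)%N -> (k.+1 < n)%N ->
        quad_eval (neighbour_sum n (side_pole n x) c k.-1) (x k.-1) / (x k - x k.-1) ^+ 2 =
        quad_eval (neighbour_sum n (side_pole n x) c k) (x k.+1) / (x k.+1 - x k) ^+ 2].
Proof.
pose x0 := reference_point; pose d0 : R := 2 / n.-2%:R.
have d00 : 0 < d0 by rewrite divr_gt0 // ltr0n; lia.
have sx0 : spaced d0 x0 := reference_point_spaced.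
have x0i := spaced_incr d00 sx0.
(* The added 1 makes the bound positive even for a vanishing cost. *)
pose M := cost n c x0 + 1.
have M0 : 0 < M.
  rewrite ltr_wpDl //; apply: sumr_ge0 => p cp.
  by apply/ltW/(cratio_gt0 (ltnW n_gt3) x0i)/c_chord.
have [d d_gt0 hd] := gap_lower_bound n_gt3 c_chord c_linked M0.
(* [d / 2] leaves room to move a contact point, and [d0] keeps the reference
configuration among the competitors. *)
pose d' := Num.min (d / 2) d0.
have d'0 : 0 < d' by rewrite lt_min d00 andbT divr_gt0.
have d'd : d' <= d / 2 by rewrite ge_min lexx.
have sx0' : spaced d' x0.
  by case: sx0 => h1 h2; split=> // k kn; rewrite (le_trans _ (h2 k kn)) // ge_min lexx orbT.
have [x [xn xs] xmin] := cost_minimum d'0 sx0'.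
have xi : increasing n x by apply: spaced_incr d'0 _; split.
have gap k : (k.+1 < n)%N -> d <= x k.+1 - x k.
  apply: hd => //; rewrite (le_trans (xmin _ sx0')) // /M; lra.
exists x; split=> // -[//|[//|k]] _ kn.
rewrite [k.+2.-1]/=.
have kn1 : (k.+2 < n)%N by exact: ltnW.
have g1 := gap _ kn1; have g2 := gap _ kn.
apply: (stationary_balance (r := d / 2)); [lra|lra|lra|] => s.
rewrite ler_norml => /andP[s1 s2].
pose t := x k.+2 + s.
have xt : x k.+1 < t < x k.+3 by rewrite /t; apply/andP; split; lra.
have smoved : spaced d' (moved x k.+1 t).
  split.
    case: xn => h0 h1 h2; rewrite /moved; split=> //.
    by rewrite (_ : (n.-1 == k.+2) = false) //; lia.
  move=> i i1; have := gap i i1; rewrite /moved.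
  have [e|e] := eqVneq i k.+2.
    rewrite e; have -> : (k.+3 == k.+2) = false by lia.
    rewrite /t; lra.
  have [e'|e'] := eqVneq i.+1 k.+2; last lra.
  have -> : i = k.+1 by lia.
  rewrite /t; lra.
have := xmin _ smoved; rewrite -subr_ge0 (cost_moved (ltnW n_gt3) c_chord xi kn xt).
rewrite /t.
have -> : x k.+2 + s - x k.+1 = x k.+2 - x k.+1 + s by ring.
by have -> : x k.+3 - (x k.+2 + s) = x k.+3 - x k.+2 - s by ring.
Qed.

End Minimum.

(** * Linear algebra in dimension 4 *)

Section Vec4.
Variable R : realType.
Implicit Types (x y a : 'rV[R]_4) (u m : 'rV[R]_3) (h t : R).

Definition vec4 u h : 'rV[R]_4 := \row_(i < 4) [:: u 0 0; u 0 1; u 0 2; h]`_i.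

Lemma vec4E u h : (vec4 u h 0 0 = u 0 0) * (vec4 u h 0 1 = u 0 1) *
  (vec4 u h 0 2 = u 0 2) * (vec4 u h 0 3 = h).
Proof. by rewrite !mxE. Qed.

Lemma row4P x y : x 0 0 = y 0 0 -> x 0 1 = y 0 1 -> x 0 2 = y 0 2 ->
  x 0 3 = y 0 3 -> x = y.
Proof.
move=> h0 h1 h2 h3; apply/rowP => -[[|[|[|[|//]]]] i4].
- by rewrite (_ : Ordinal i4 = 0) //; apply/val_inj.
- by rewrite (_ : Ordinal i4 = 1) //; apply/val_inj.
- by rewrite (_ : Ordinal i4 = 2) //; apply/val_inj.
- by rewrite (_ : Ordinal i4 = 3) //; apply/val_inj.
Qed.

Definition form_fun m t x : R^o :=
  m 0 0 * x 0 0 + m 0 1 * x 0 1 + m 0 2 * x 0 2 + t * x 0 3.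

Fact form_is_linear m t : linear (form_fun m t).
Proof. by move=> b x y; rewrite /form_fun !mxE /GRing.scale /=; ring. Qed.
HB.instance Definition _ m t :=
  GRing.isLinear.Build R 'rV[R]_4 R^o *:%R (form_fun m t) (form_is_linear m t).

Definition form4 m t : 'Hom('rV[R]_4, R^o) := linfun (form_fun m t).

Lemma form4E m t x : form4 m t x = m 0 0 * x 0 0 + m 0 1 * x 0 1 + m 0 2 * x 0 2 + t * x 0 3.
Proof. by rewrite lfunE. Qed.

Lemma form4_vec4 m t u h : form4 m t (vec4 u h) = dot m u + t * h.
Proof. by rewrite form4E !vec4E. Qed.

(** Writing a linear form through its first three coefficients and the last one
separates its slope over the polygon from its dependence on the height. *)
Lemma hom_form4 (l : 'Hom('rV[R]_4, R^o)) : exists m t, l = form4 m t.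
Proof.
exists (vec3 (l (delta_mx 0 0)) (l (delta_mx 0 1)) (l (delta_mx 0 2))), (l (delta_mx 0 3)).
apply/lfunP => x; rewrite form4E !vec3E.
have E : x = x 0 0 *: delta_mx 0 0 + x 0 1 *: delta_mx 0 1 + x 0 2 *: delta_mx 0 2 +
  x 0 3 *: delta_mx 0 3.
  by apply: row4P; rewrite !mxE /= ?mulr1 ?mulr0 ?addr0 ?add0r.
rewrite {1}E !linearD !linearZ /= /GRing.scale /=; ring.
Qed.

Lemma dim_rV4 : \dim {:'rV[R]_4} = 4%N.
Proof. by rewrite dimvf /dim /=. Qed.

Lemma dim_ker_lt4 (l : 'Hom('rV[R]_4, R^o)) x : l x != 0 -> (\dim (lker l) <= 3)%N.
Proof.
move=> lx; have := dimvS (subvf (lker l)).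
rewrite dim_rV4 leq_eqVlt => /orP[/eqP E|//]; case/negP: lx.
have : (lker l == fullv)%VS by rewrite eqEdim subvf dim_rV4 E.
by move/eqP => K; rewrite -memv_ker K memvf.
Qed.

(** Vectors over non-collinear points of the polygon are independent whatever
their heights. *)
Lemma dim_ge3 (U : {vspace 'rV[R]_4}) u1 u2 u3 h1 h2 h3 : det3 u1 u2 u3 != 0 ->
  vec4 u1 h1 \in U -> vec4 u2 h2 \in U -> vec4 u3 h3 \in U -> (3 <= \dim U)%N.
Proof.
move=> d0 U1 U2 U3.
pose X := [tuple vec4 u1 h1; vec4 u2 h2; vec4 u3 h3].
have fX : free X.
  apply/freeP => k; rewrite !big_ord_recl big_ord0 /= addr0 => E.
  have E3 : k ord0 *: u1 + (k (lift ord0 ord0) *: u2 + k (lift ord0 (lift ord0 ord0)) *: u3) = 0.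
    have e j := congr1 (fun x : 'rV[R]_4 => x 0 j) E.
    by move: (e 0) (e 1) (e 2); rewrite !mxE /= => *; apply: row3P; rewrite !mxE.
  have d (j : 'rV[R]_3 -> R) := congr1 j E3.
  have k0 : k ord0 = 0.
    have := d (dot (cross u2 u3)); rewrite dot0r !dotDr !dotZr -!/(det3 _ _ _).
    rewrite det3_first det3_second !mulr0 !addr0 -det3_rot => /eqP.
    by rewrite mulf_eq0 (negPf d0) orbF => /eqP.
  have k1 : k (lift ord0 ord0) = 0.
    have := d (dot (cross u3 u1)); rewrite dot0r !dotDr !dotZr -!/(det3 _ _ _).
    rewrite det3_first det3_second !mulr0 !addr0 add0r det3_rot => /eqP.
    by rewrite mulf_eq0 (negPf d0) orbF => /eqP.
  have k2 : k (lift ord0 (lift ord0 ord0)) = 0.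
    have := d (dot (cross u1 u2)); rewrite dot0r !dotDr !dotZr -!/(det3 _ _ _).
    rewrite det3_first det3_second !mulr0 !add0r => /eqP.
    by rewrite mulf_eq0 (negPf d0) orbF => /eqP.
  move=> -[[|[|[|//]]] i3].
  - by rewrite (_ : Ordinal i3 = ord0) //; apply/val_inj.
  - by rewrite (_ : Ordinal i3 = lift ord0 ord0) //; apply/val_inj.
  - by rewrite (_ : Ordinal i3 = lift ord0 (lift ord0 ord0)) //; apply/val_inj.
have XU : (<<X>> <= U)%VS.
  by apply/span_subvP => z; rewrite !inE => /or3P[] /eqP ->.
by have := dimvS XU; rewrite (eqnP fX).
Qed.

Lemma dim_le2 (u v : 'rV[R]_4) : (\dim (<[u]> + <[v]>)%VS <= 2)%N.
Proof.
rewrite (leq_trans (dimv_add_leqif _ _)) // !dim_vline.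
by case: (u != 0); case: (v != 0).
Qed.

Lemma ip22_form4 x : exists l : 'Hom('rV[R]_4, R^o), forall y, l y = ip22 x y.
Proof.
exists (form4 (vec3 (x 0 0) (x 0 1) (- x 0 2)) (- x 0 3)) => y.
by rewrite form4E !vec3E /ip22; ring.
Qed.

Lemma ip22_vec4 u h u' h' : ip22 (vec4 u h) (vec4 u' h') = bil u u' - h * h'.
Proof. by rewrite /ip22 !vec4E. Qed.

Lemma ip22Zl b x y : ip22 (b *: x) y = b * ip22 x y.
Proof. by rewrite /ip22 !mxE; ring. Qed.
Lemma ip22Zr b x y : ip22 x (b *: y) = b * ip22 x y.
Proof. by rewrite /ip22 !mxE; ring. Qed.

Lemma time_fieldZ b x : time_field (b *: x) = b *: time_field x.
Proof. by rewrite /time_field !mxE scalerBr !scalerA. Qed.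

Lemma form4_time_field m t x : form4 m t (time_field x) = x 0 2 * t - x 0 3 * m 0 2.
Proof. by rewrite form4E /time_field !mxE /=; ring. Qed.

Fact delta_neq0 : \dim <[delta_mx 0%R 0%R : 'rV[R]_4]>%VS == 1%N.
Proof.
rewrite dim_vline; suff -> : (delta_mx 0 0 : 'rV[R]_4) != 0 by [].
by apply/eqP => /rowP/(_ 0); rewrite !mxE /= => /eqP; rewrite oner_eq0.
Qed.

(** The value at [x = 0] is an arbitrary line. *)
Definition line x : RP3 R :=
  insubd (exist (fun L : {vspace 'rV[R]_4} => \dim L == 1%N) _ delta_neq0) <[x]>%VS.

Lemma val_line x : x != 0 -> val (line x) = <[x]>%VS.
Proof. by move=> x0; rewrite /line insubdK // unfold_in /= dim_vline x0. Qed.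

Lemma line_of (p : RP3 R) x : x \in val p -> x != 0 -> p = line x.
Proof.
move=> xp x0; apply/val_inj; rewrite val_line //; apply/esym/eqP.
by rewrite eqEdim -memvE xp dim_vline x0 (eqP (valP p)).
Qed.

End Vec4.

(** * The polytope over a convex polygon *)

Section Polytope.
Variables (R : realType) (n : nat) (q : nat -> 'rV[R]_3) (h : nat -> R).
Hypothesis n_gt3 : (3 < n)%N.
Hypothesis q_convex : forall i j k, (i < j)%N -> (j < k)%N -> (k < n)%N ->
  0 < det3 (q i) (q j) (q k).
Hypothesis q_front : forall k, (k < n)%N -> 0 < q k 0 2.

Definition vert k := vec4 (q k) (h k).
(** The third coordinate is positive at all corners, so it defines a chart that
contains the polytope. *)
Definition front : 'Hom('rV[R]_4, R^o) := form4 (vec3 0 0 1) 0.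

Lemma frontE x : front x = x 0 2.
Proof. by rewrite form4E !vec3E !mul0r !add0r mul1r addr0. Qed.

Lemma front_vert k : front (vert k) = q k 0 2.
Proof. by rewrite frontE vec4E. Qed.

(** Weights are functions on nat, of which only the values below [n] count;
this avoids ordinals in the definition of the body. *)
Definition vertex_comb (w : nat -> R) : 'rV[R]_4 := \sum_(k < n) w k *: vert k.

Definition delta_wt k (i : nat) : R := (i == k)%:R.

Lemma vertex_comb_delta k : (k < n)%N -> vertex_comb (delta_wt k) = vert k.
Proof.
move=> kn; rewrite /vertex_comb (bigD1 (Ordinal kn)) //= /delta_wt eqxx scale1r big1 ?addr0 //.
by move=> i; rewrite -val_eqE /= => /negPf ->; rewrite scale0r.
Qed.

Lemma hom_comb (l : 'Hom('rV[R]_4, R^o)) w : l (vertex_comb w) = \sum_(k < n) w k * l (vert k).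
Proof. by rewrite linear_sum; apply: eq_bigr => k _; rewrite linearZ. Qed.

Definition polytope_body : set (RP3 R) := [set p : RP3 R | exists w : nat -> R,
  [/\ forall k, (k < n)%N -> 0 <= w k, front (vertex_comb w) = 1 & vertex_comb w \in val p]].

Lemma vert_neq0 k : (k < n)%N -> vert k != 0.
Proof.
by move=> kn; apply/negP => /eqP E; have := q_front kn; rewrite -front_vert E linear0 ltxx.
Qed.

Definition vertex k := line (vert k).

Lemma val_vertex k : (k < n)%N -> val (vertex k) = <[vert k]>%VS.
Proof. by move=> kn; rewrite val_line // vert_neq0. Qed.

Lemma front1_neq0 (x : 'rV[R]_4) : front x = 1 -> x != 0.
Proof. by move=> F; apply/negP => /eqP E; move/eqP: F; rewrite E linear0 eq_sym oner_eq0. Qed.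

Lemma body_line (p : RP3 R) w : front (vertex_comb w) = 1 -> vertex_comb w \in val p -> val p =
  <[vertex_comb w]>%VS.
Proof. by move=> F wp; rewrite (line_of wp) ?val_line // front1_neq0. Qed.

Lemma polytope_body_vertex k : (k < n)%N -> polytope_body (vertex k).
Proof.
move=> kn; have c0 := q_front kn; rewrite -front_vert in c0.
have E : vertex_comb (fun i => (front (vert k))^-1 * delta_wt k i) = (front (vert k))^-1 *: vert k.
  by rewrite -(vertex_comb_delta kn) /vertex_comb scaler_sumr; apply: eq_bigr => i _;
    rewrite scalerA.
exists (fun i => (front (vert k))^-1 * delta_wt k i); split.
- by move=> i _; rewrite mulr_ge0 // ?invr_ge0 ?ltW // ler0n.
- by rewrite E linearZ /= /GRing.scale /= mulVf // gt_eqF.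
- by rewrite E val_vertex // memvZ // memv_line.
Qed.

Lemma polytope_in_chart : in_chart front polytope_body.
Proof.
move=> p [w [_ F wp]]; apply/negP => /subvP/(_ _ wp).
by rewrite memv_ker F oner_eq0.
Qed.

Lemma chart_polytope x : chart_image front polytope_body x <->
  exists w, [/\ forall k, (k < n)%N -> 0 <= w k, front (vertex_comb w) = 1 & x = vertex_comb w].
Proof.
split.
  move=> [Fx [p [w [w0 F wp]] xp]]; exists w; split=> //.
  move: xp; rewrite (body_line F wp) => /vlineP[b xb].
  move: Fx; rewrite xb linearZ /= F /GRing.scale /= mulr1 => ->.
  exact: scale1r.
move=> [w [w0 F ->]]; split=> //; exists (line (vertex_comb w)); last first.
  by rewrite val_line ?memv_line // front1_neq0.
by exists w; split=> //; rewrite val_line ?memv_line // front1_neq0.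
Qed.

Lemma polytope_convex : exists s : seq 'rV[R]_4,
  chart_image front polytope_body = convex_hull s.
Proof.
pose g k := (front (vert k))^-1 *: vert k.
have gE k : (k < n)%N -> front (vert k) *: g k = vert k.
  by move=> kn; rewrite /g scalerA divff ?scale1r // front_vert gt_eqF // q_front.
exists (mkseq g n); apply/seteqP; split=> x.
  move=> /chart_polytope[w [w0 F ->]].
  have sz := size_mkseq g n.
  exists (fun i => w i * front (vert i)); split.
  - move=> i; have i_n : (i < n)%N by rewrite -[X in (_ < X)%N]sz.
    by rewrite mulr_ge0 ?w0 // front_vert ltW // q_front.
  - rewrite -F hom_comb -(big_mkord xpredT (fun i => w i * front (vert i))).
    by rewrite sz big_mkord.
  - rewrite /vertex_comb -(big_mkord xpredT (fun i => (w i * front (vert i)) *: (mkseq g n)`_i)).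
    rewrite sz big_mkord; apply: eq_bigr => i _.
    by rewrite nth_mkseq // -scalerA gE.
move=> [w [w0 w1 ->]]; apply/chart_polytope.
pose w' (i : nat) := if insub i is Some j then w j else 0.
have w'E (i : 'I_(size (mkseq g n))) : w' i = w i by rewrite /w' valK.
exists (fun k => w' k * (front (vert k))^-1); split.
- move=> k kn; rewrite mulr_ge0 ?invr_ge0 //; last by rewrite front_vert ltW // q_front.
  by rewrite /w'; case: insub.
- rewrite hom_comb -w1; under [RHS]eq_bigr => i _ do rewrite -w'E.
  rewrite -(big_mkord xpredT (fun i => w' i)) size_mkseq big_mkord.
  by apply: eq_bigr => k _; rewrite mulfVK // front_vert gt_eqF // q_front.
- under eq_bigr => i _ do rewrite -w'E.
  rewrite -(big_mkord xpredT (fun i => w' i *: (mkseq g n)`_i)) size_mkseq big_mkord.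
  by apply: eq_bigr => k _; rewrite nth_mkseq // scalerA.
Qed.

(** The corners span everything as soon as some combination of them is
vertical. *)
Lemma polytope_solid : (exists w a, a != 0 /\ vertex_comb w = vec4 0 a) ->
  spans polytope_body fullv.
Proof.
move=> [w [a [a0 Ew]]]; split=> [p _|W HW]; first exact: subvf.
have vW k : (k < n)%N -> vert k \in W.
  by move=> kn; have := HW _ (polytope_body_vertex kn); rewrite val_vertex // -memvE.
have eW b : vec4 0 b \in W.
  have -> : vec4 0 b = (b / a) *: vertex_comb w.
    by rewrite Ew; apply: row4P; rewrite !mxE /= ?mulr0 ?mulfVK.
  by rewrite memvZ // memv_suml // => k _; rewrite memvZ // vW.
have d0 := det3_neq0 q_convex (i := 0) (j := 1) (k := 2) ltac:(lia) ltac:(lia) ltac:(lia)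
  isT isT isT.
set d := det3 _ _ _ in d0.
apply/subvP => x _.
pose u := vec3 (x 0 0) (x 0 1) (x 0 2).
pose c0 := det3 u (q 1%N) (q 2%N) / d.
pose c1 := det3 (q 0%N) u (q 2%N) / d.
pose c2 := det3 (q 0%N) (q 1%N) u / d.
have Eu : u = c0 *: q 0%N + c1 *: q 1%N + c2 *: q 2%N.
  apply: (scalerI d0); rewrite !scalerDr !scalerA /c0 /c1 /c2 !(mulrCA d) divff // !mulr1.
  exact: cramer3_expand.
have -> : x = c0 *: vert 0 + c1 *: vert 1 + c2 *: vert 2 +
    vec4 0 (x 0 3 - (c0 * h 0%N + c1 * h 1%N + c2 * h 2%N)).
  have e j := congr1 (fun y : 'rV[R]_3 => y 0 j) Eu.
  move: (e 0) (e 1) (e 2); rewrite /u !mxE /= => e0 e1 e2.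
  apply: row4P; rewrite !mxE /= ?addr0 //.
  by rewrite addrC subrK.
by apply: memvD; [apply: memvD; [apply: memvD|]|exact: eW]; rewrite memvZ // vW //; lia.
Qed.

Variable P : polyhedron R.
Hypothesis bodyP : body P = polytope_body.
Hypothesis chartP : chart P = front.
Implicit Types (l : 'Hom('rV[R]_4, R^o)) (F : set (RP3 R)) (U W : {vspace 'rV[R]_4}).

Definition zero_face l : set (RP3 R) := [set p : RP3 R | body P p /\ (val p <= lker l)%VS].
Definition nonneg l := forall k, (k < n)%N -> 0 <= l (vert k).

Lemma supports_vert l F : supports P l F -> nonneg l /\ F = zero_face l.
Proof.
move=> [pos ->]; split=> // k kn; have c0 := q_front kn; rewrite -front_vert in c0.
have := polytope_body_vertex kn; rewrite -bodyP => bk.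
have : chart_image (chart P) (body P) ((front (vert k))^-1 *: vert k).
  split; first by rewrite chartP linearZ /= /GRing.scale /= mulVf // gt_eqF.
  by exists (vertex k) => //; rewrite val_vertex // memvZ // memv_line.
by move/pos; rewrite linearZ /= /GRing.scale /= pmulr_rge0 // invr_gt0.
Qed.

Lemma nonneg_supports l : nonneg l -> supports P l (zero_face l).
Proof.
move=> l0; split=> // x; rewrite chartP bodyP => /chart_polytope[w [w0 _ ->]].
by rewrite hom_comb; apply: sumr_ge0 => k _; rewrite mulr_ge0 ?w0 ?l0.
Qed.

Lemma zero_face_comb l p : nonneg l -> zero_face l p -> exists w,
  [/\ forall k, (k < n)%N -> 0 <= w k, front (vertex_comb w) = 1, val p = <[vertex_comb w]>%VS &
      forall k, (k < n)%N -> w k * l (vert k) = 0].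
Proof.
move=> l0 []; rewrite bodyP => -[w [w0 Fw wp]] /subvP/(_ _ wp).
rewrite memv_ker hom_comb => /eqP S0; exists w; split=> //; first exact: body_line.
move=> k kn; move/psumr_eq0P: S0 => /(_ _ (Ordinal kn)) /= -> //.
by move=> i _; rewrite mulr_ge0 ?w0 ?l0.
Qed.

Lemma zero_face_vertex l k : (k < n)%N -> zero_face l (vertex k) <-> l (vert k) = 0.
Proof.
move=> kn; rewrite /zero_face /= val_vertex // -memvE memv_ker bodyP; split; first by case=> _ /eqP.
by move/eqP; split=> //; exact: polytope_body_vertex.
Qed.

Lemma zero_face_sub l p U : nonneg l -> zero_face l p ->
  (forall k, (k < n)%N -> l (vert k) = 0 -> vert k \in U) -> (val p <= U)%VS.
Proof.
move=> l0 /(zero_face_comb l0)[w [w0 _ -> wz]] HU; rewrite -memvE memv_suml // => k _.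
have := wz k (ltn_ord k) => /eqP; rewrite mulf_eq0 => /orP[/eqP ->|/eqP lk].
  by rewrite scale0r mem0v.
by rewrite memvZ // HU.
Qed.

Lemma zero_face_spans l U : nonneg l ->
  (forall k, (k < n)%N -> l (vert k) = 0 -> vert k \in U) ->
  (forall W, (forall k, (k < n)%N -> l (vert k) = 0 -> vert k \in W) -> (U <= W)%VS) ->
  spans (zero_face l) U.
Proof.
move=> l0 HU Umin; split=> [p /(zero_face_sub l0)|W HW]; first exact.
apply: Umin => k kn lk; rewrite memvE -val_vertex //.
by apply: HW; apply/zero_face_vertex.
Qed.

Lemma spans_vert l U k : spans (zero_face l) U -> (k < n)%N -> l (vert k) = 0 -> vert k \in U.
Proof.
by move=> [HU _] kn lk; rewrite memvE -val_vertex //; apply: HU; apply/zero_face_vertex.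
Qed.

Lemma spans_min l U W : nonneg l -> spans (zero_face l) U ->
  (forall k, (k < n)%N -> l (vert k) = 0 -> vert k \in W) -> (U <= W)%VS.
Proof. by move=> l0 [_ Umin] HW; apply: Umin => p Fp; exact: (zero_face_sub l0). Qed.

(** A face of dimension 2 does not fit in the plane spanned by two vertices. *)
Lemma face_third_vertex l U i j : nonneg l -> spans (zero_face l) U -> (2 < \dim U)%N ->
  (i < n)%N -> (j < n)%N -> exists k, [/\ (k < n)%N, k != i, k != j & l (vert k) = 0].
Proof.
move=> l0 sp d3 i_n jn; apply: contrapT => H.
have sub : (U <= <[vert i]> + <[vert j]>)%VS.
  apply: (spans_min l0 sp) => k kn lk.
  have [->|ki] := eqVneq k i; first by rewrite memvE addvSl.
  have [->|kj] := eqVneq k j; first by rewrite memvE addvSr.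
  by case: H; exists k.
by have := leq_trans d3 (leq_trans (dimvS sub) (dim_le2 _ _)).
Qed.

Lemma edge_two_vertices l U i j k : spans (zero_face l) U -> \dim U = 2%N ->
  (i < n)%N -> (j < n)%N -> (k < n)%N -> i != j -> k != i -> k != j ->
  l (vert i) = 0 -> l (vert j) = 0 -> l (vert k) != 0.
Proof.
move=> sp d2 i_n jn kn ij ki kj li lj; apply/eqP => lk.
have := dim_ge3 (det3_neq0 q_convex i_n jn kn ij _ _) (spans_vert sp i_n li)
  (spans_vert sp jn lj) (spans_vert sp kn lk).
by rewrite d2 !(eq_sym _ k) => /(_ ki kj).
Qed.

Lemma face_vertex l U : nonneg l -> spans (zero_face l) U -> (0 < \dim U)%N ->
  exists2 k, (k < n)%N & l (vert k) = 0.
Proof.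
move=> l0 sp d0; apply: contrapT => H.
have : (U <= 0)%VS.
  by apply: (spans_min l0 sp) => k kn lk; case: H; exists k.
by rewrite subv0 => /eqP E; rewrite E dimv0 in d0.
Qed.

Lemma edge_second_vertex l U i : nonneg l -> spans (zero_face l) U -> (1 < \dim U)%N ->
  exists k, [/\ (k < n)%N, k != i & l (vert k) = 0].
Proof.
move=> l0 sp d1; apply: contrapT => H.
have : (U <= <[vert i]>)%VS.
  apply: (spans_min l0 sp) => k kn lk.
  have [->|ki] := eqVneq k i; first exact: memv_line.
  by case: H; exists k.
by move/dimvS; rewrite dim_vline; case: (_ != 0) => /(leq_trans d1).
Qed.

Lemma vertex_inj i j : (i < n)%N -> (j < n)%N -> vertex i = vertex j -> i = j.
Proof.
move=> i_n jn E; apply/eqP/negPn/negP => ij.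
have : vert i \in <[vert j]>%VS by rewrite -val_vertex // -E val_vertex // memv_line.
have [k /and3P[kn ki kj]] : exists k, [&& (k < n)%N, k != i & k != j].
  have [e0|e0] := boolP ((0%N != i) && (0%N != j)); first by exists 0%N; lia.
  have [e1|e1] := boolP ((1%N != i) && (1%N != j)); first by exists 1%N; lia.
  by exists 2%N; lia.
move=> vij.
have := dim_ge3 (det3_neq0 q_convex i_n jn kn ij _ _)
  (U := (<[vert j]> + <[vert k]>)%VS) (h1 := h i) (h2 := h j) (h3 := h k).
rewrite !(eq_sym _ k) => /(_ ki kj); rewrite -!/(vert _).
have sub1 : (<[vert j]> <= <[vert j]> + <[vert k]>)%VS by exact: addvSl.
have sub2 : (<[vert k]> <= <[vert j]> + <[vert k]>)%VS by exact: addvSr.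
have := dim_le2 (vert j) (vert k); rewrite leqNgt => /negP d2 d3; apply: d2; apply: d3.
- by exact: (subvP sub1).
- by rewrite memvE.
- by rewrite memvE.
Qed.

Lemma is_vertex_vertex p : is_vertex P p -> exists2 k, (k < n)%N & p = vertex k.
Proof.
move=> [[l /supports_vert[l0 EF]] [U sp d1]].
have [k kn lk] : exists2 k, (k < n)%N & l (vert k) = 0.
  by apply: (face_vertex l0 (U := U)); [rewrite -EF|rewrite d1].
exists k => //; have : zero_face l (vertex k) by apply/zero_face_vertex.
by rewrite -EF => /= ->.
Qed.

Lemma vertex_is_vertex l k : (k < n)%N -> nonneg l -> l (vert k) = 0 ->
  (forall i, (i < n)%N -> i != k -> l (vert i) != 0) -> is_vertex P (vertex k).
Proof.
move=> kn l0 lk lne.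
have E : zero_face l = [set vertex k].
  apply/seteqP; split=> p; last by move=> /= ->; apply/zero_face_vertex.
  move=> /(zero_face_sub l0 (U := <[vert k]>%VS)) H; apply/val_inj.
  have {}H : (val p <= <[vert k]>)%VS.
    apply: H => i i_n li; have [->|ik] := eqVneq i k; first exact: memv_line.
    by move/eqP: (lne _ i_n ik).
  rewrite val_vertex //; apply/eqP.
  by rewrite eqEdim H (eqP (valP p)) dim_vline vert_neq0.
split; first by exists l; rewrite -E; exact: nonneg_supports.
exists <[vert k]>%VS; last by rewrite dim_vline vert_neq0.
rewrite -E; apply: zero_face_spans => // [i i_n li|W]; last by move=> H; rewrite -memvE H.
have [->|ik] := eqVneq i k; first exact: memv_line.
by move/eqP: (lne _ i_n ik).
Qed.

Lemma edge_is_edge l i j : (i < n)%N -> (j < n)%N -> i != j -> nonneg l ->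
  l (vert i) = 0 -> l (vert j) = 0 ->
  (forall k, (k < n)%N -> k != i -> k != j -> l (vert k) != 0) -> is_edge P (zero_face l).
Proof.
move=> i_n jn ij l0 li lj lne; split; first by exists l; exact: nonneg_supports.
have sub1 : (<[vert i]> <= <[vert i]> + <[vert j]>)%VS by exact: addvSl.
have sub2 : (<[vert j]> <= <[vert i]> + <[vert j]>)%VS by exact: addvSr.
exists (<[vert i]> + <[vert j]>)%VS.
  apply: zero_face_spans => // [k kn lk|W HW].
    have [->|ki] := eqVneq k i; first by rewrite memvE.
    have [->|kj] := eqVneq k j; first by rewrite memvE.
    by move/eqP: (lne _ kn ki kj).
  by rewrite subv_add -!memvE !HW.
apply/eqP; rewrite eqn_leq dim_le2 ltnNge; apply/negP => d1.
have E : (<[vert i]> == <[vert i]> + <[vert j]>)%VS.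
  by rewrite eqEdim sub1 dim_vline vert_neq0.
case/eqP: ij; apply: vertex_inj => //; rewrite /vertex.
have : vert j \in <[vert i]>%VS by rewrite (eqP E) memvE.
move=> ji; rewrite (@line_of _ (line (vert i)) (vert j)) ?vert_neq0 //.
by rewrite val_line // vert_neq0.
Qed.

Lemma three_zeros_is_face l x0 i j k : (i < n)%N -> (j < n)%N -> (k < n)%N -> i != j ->
  k != i -> k != j -> nonneg l -> l x0 != 0 ->
  l (vert i) = 0 -> l (vert j) = 0 -> l (vert k) = 0 -> is_face P (zero_face l).
Proof.
move=> i_n jn kn ij ki kj l0 lx li lj lk; split; first by exists l; exact: nonneg_supports.
have d0 : det3 (q i) (q j) (q k) != 0 by apply: (det3_neq0 q_convex) => //; rewrite eq_sym.
have dk := dim_ker_lt4 lx.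
have d3 : \dim (lker l) = 3%N.
  apply/eqP; rewrite eqn_leq dk.
  by apply: (dim_ge3 d0 (h1 := h i) (h2 := h j) (h3 := h k));
    rewrite memv_ker; apply/eqP.
exists (lker l) => //.
apply: zero_face_spans => // [m mn lm|W HW]; first by rewrite memv_ker lm.
have d : (3 <= \dim (lker l :&: W))%N.
  by apply: (dim_ge3 d0 (h1 := h i) (h2 := h j) (h3 := h k));
   rewrite memv_cap memv_ker -/(vert _) ?li ?lj ?lk eqxx /= HW.
have E : ((lker l :&: W) == lker l)%VS by rewrite eqEdim capvSl d3.
by rewrite -(eqP E) capvSr.
Qed.

End Polytope.

(** * Polytopes between two roofs *)

Section TwoRoofs.
Variables (R : realType) (n : nat) (q : nat -> 'rV[R]_3) (h : nat -> R) (A B : rel nat).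
Hypothesis n_gt3 : (3 < n)%N.
Hypothesis q_convex : forall i j k, (i < j)%N -> (j < k)%N -> (k < n)%N ->
  0 < det3 (q i) (q j) (q k).
Hypothesis q_front : forall k, (k < n)%N -> 0 < q k 0 2.
Hypothesis A_chord : forall i j, A i j -> is_chord n i j.
Hypothesis B_chord : forall i j, B i j -> is_chord n i j.
Hypothesis hullA : lower_hull n q A h.
Hypothesis hullB : lower_hull n q B (fun k => - h k).

Local Notation vert := (vert q h).
Local Notation vertex := (vertex q h).
Local Notation nonneg := (nonneg n q h).

Lemma form4_vert m t k : form4 m t (vert k) = dot m (q k) + t * h k.
Proof. exact: form4_vec4. Qed.

Lemma side_form i j : cyclic_next n i j -> exists m, [/\ dot m (q i) = 0, dot m (q j) = 0 &
  forall k, (k < n)%N -> k != i -> k != j -> 0 < dot m (q k)].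
Proof.
move=> ij; move: (ij); rewrite /cyclic_next => ij'.
have [e|e] := eqVneq j i.+1.
  exists (cross (q i) (q j)); rewrite -!/(det3 _ _ _) det3_first det3_second; split=> // k kn ki kj.
  by rewrite -/(det3 _ _ _) (det3_outside q_convex) //; lia.
exists (cross (q j) (q i)); rewrite -!/(det3 _ _ _) det3_first det3_second; split=> // k kn ki kj.
by rewrite -/(det3 _ _ _) det3_swapl oppr_gt0 (det3_inside q_convex) //; lia.
Qed.

Lemma side_form_at k o : cyclic_next n k o || cyclic_next n o k ->
  exists m, [/\ dot m (q k) = 0, dot m (q o) = 0 &
  forall i, (i < n)%N -> i != k -> i != o -> 0 < dot m (q i)].
Proof.
case/orP => /side_form[m [m1 m2 m3]]; exists m; split=> // i i_n ik io; exact: m3.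
Qed.

Lemma two_sides k : (k < n)%N -> exists o o', [/\ o != o', o != k, o' != k,
  cyclic_next n k o || cyclic_next n o k & cyclic_next n k o' || cyclic_next n o' k].
Proof.
move=> kn; have [->|k0] := eqVneq k 0%N.
  by exists 1%N, n.-1; rewrite /cyclic_next; split; lia.
have [->|k1] := eqVneq k n.-1.
  by exists 0%N, n.-2; rewrite /cyclic_next; split; lia.
by exists k.-1, k.+1; rewrite /cyclic_next; split; lia.
Qed.

(** The sum of the forms of the two sides at a corner. *)
Lemma vertex_form k : (k < n)%N -> exists m, dot m (q k) = 0 /\
  forall i, (i < n)%N -> i != k -> 0 < dot m (q i).
Proof.
move=> kn; have [o [o' [oo' ok o'k s s']]] := two_sides kn.
have [m [m1 m2 m3]] := side_form_at s; have [m' [m1' m2' m3']] := side_form_at s'.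
exists (m + m'); split; first by rewrite dotDl m1 m1' addr0.
move=> i i_n ik; rewrite dotDl.
have [->|io] := eqVneq i o.
  by rewrite m2 add0r m3' //; move: s; rewrite /cyclic_next; lia.
have [->|io'] := eqVneq i o'.
  by rewrite m2' addr0 m3 ?(eq_sym o') //; move: s'; rewrite /cyclic_next; lia.
by rewrite addr_gt0 ?m3 ?m3'.
Qed.

Definition adjacent i j := [|| cyclic_next n i j, A i j | B i j].

Lemma adjacent_lt i j : adjacent i j -> (i < j < n)%N.
Proof.
case/or3P => [|/A_chord|/B_chord]; rewrite /cyclic_next /is_chord; lia.
Qed.

(** Sides of the polygon are cut out by vertical planes, and the chords of [A]
and [B] by planes that touch the heights from below and from above. *)
Lemma edge_form i j : adjacent i j -> exists l, [/\ nonneg l, l (vert i) = 0, l (vert j) = 0 &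
  forall k, (k < n)%N -> k != i -> k != j -> l (vert k) != 0].
Proof.
move=> adj.
suff [l [li lj lk]] : exists l : 'Hom('rV[R]_4, R^o), [/\ l (vert i) = 0, l (vert j) = 0 &
   forall k, (k < n)%N -> k != i -> k != j -> 0 < l (vert k)].
  exists l; split=> // k kn; last by move=> ki kj; rewrite gt_eqF // lk.
  have [->|ki] := eqVneq k i; first by rewrite li.
  have [->|kj] := eqVneq k j; first by rewrite lj.
  exact/ltW/lk.
case/or3P: adj => [/side_form[m [mi mj mk]]|/(hull_edge hullA)[m [mi mj mk]]|
    /(hull_edge hullB)[m [mi mj mk]]].
- exists (form4 m 0); rewrite !form4_vert mi mj !mul0r !addr0; split=> // k kn ki kj.
  by rewrite form4_vert mul0r addr0 mk.
- exists (form4 (- 1 *: m) 1); rewrite !form4_vert !dotZl mi mj; split; [ring|ring|].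
  move=> k kn ki kj; rewrite form4_vert dotZl; have := mk k kn ki kj; lra.
- exists (form4 (- 1 *: m) (- 1)); rewrite !form4_vert !dotZl mi mj; split; [ring|ring|].
  move=> k kn ki kj; rewrite form4_vert dotZl; have := mk k kn ki kj; lra.
Qed.

(** A form with nonzero last coefficient compares the heights with a linear
function. *)
Lemma form_slope m t k : t != 0 -> form4 m t (vert k) = t * (h k - dot (- t^-1 *: m) (q k)).
Proof. by move=> t0; rewrite form4_vert dotZl; field. Qed.

(** The sign of the last coefficient tells whether the plane touches the heights
from below, from above, or is vertical.  In the first two cases the hull
properties apply, and no vertical plane supports the polygon along a
diagonal. *)
Lemma non_adjacent_third l i j : (i < j < n)%N -> ~~ adjacent i j -> nonneg l ->
  l (vert i) = 0 -> l (vert j) = 0 ->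
  exists k, [/\ (k < n)%N, k != i, k != j & l (vert k) = 0].
Proof.
move=> ijn; rewrite /adjacent !negb_or => /and3P[nc nA nB] l0 li lj.
have ch : is_chord n i j by move: nc; rewrite /cyclic_next /is_chord; lia.
have [m [t El]] := hom_form4 l; subst l.
have [t0|t0|t0] := ltgtP t 0.
- have tn0 : t != 0 by rewrite lt_eqF.
  move: li lj; rewrite !form_slope // => /eqP; rewrite mulf_eq0 (negPf tn0) subr_eq0 => /eqP li.
  move=> /eqP; rewrite mulf_eq0 (negPf tn0) subr_eq0 => /eqP lj.
  have [||| k [kn ki kj kE]] := @hull_no_edge _ _ _ _ _ hullB i j (t^-1 *: m) ch nB.
  + move=> k kn; have := l0 k kn; rewrite form_slope // nmulr_rge0 // subr_le0.
    by rewrite -scaleN1r scaleNr scale1r !dotZl mulNr; lra.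
  + by rewrite li dotZl dotZl; ring.
  + by rewrite lj dotZl dotZl; ring.
  exists k; split=> //; rewrite form_slope // dotZl mulNr -dotZl kE; ring.
- have tn0 : t != 0 by rewrite gt_eqF.
  move: li lj; rewrite !form_slope // => /eqP; rewrite mulf_eq0 (negPf tn0) subr_eq0 => /eqP li.
  move=> /eqP; rewrite mulf_eq0 (negPf tn0) subr_eq0 => /eqP lj.
  have [||| k [kn ki kj kE]] := @hull_no_edge _ _ _ _ _ hullA i j (- t^-1 *: m) ch nA.
  + by move=> k kn; have := l0 k kn; rewrite form_slope // pmulr_rge0 // subr_ge0.
  + by rewrite li.
  + by rewrite lj.
  by exists k; split=> //; rewrite form_slope // kE subrr mulr0.
- move: li lj; rewrite !form4_vert t0 !mul0r !addr0 => li lj.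
  have {}l0 k : (k < n)%N -> 0 <= dot m (q k).
    by move=> kn; have := l0 k kn; rewrite form4_vert t0 mul0r addr0.
  move: ch; rewrite /is_chord => ch.
  have [o oP] : exists o, (o < n)%N && ((o < i)%N || (j < o)%N).
    by case: (ltnP 0 i) => i0; [exists 0%N|exists j.+1]; lia.
  have [s [t1 [s' [t' [[s0 t10 s'0 t'0] E]]]]] :=
    crossing_point_sym q_convex (i := i) (j := j) (k := i.+1) (l := o)
     ltac:(lia) ltac:(lia) ltac:(lia) ltac:(lia) ltac:(lia).
  exists i.+1; split; [lia|lia|lia|].
  rewrite form4_vert mul0r addr0.
  have := congr1 (dot m) E; rewrite !dotDr !dotZr li lj !mulr0 addr0 => /esym/eqP.
  have a1 : 0 <= s' * dot m (q i.+1) by rewrite mulr_ge0 ?l0 // ?ltW //; lia.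
  have a2 : 0 <= t' * dot m (q o) by rewrite mulr_ge0 ?l0 // ?ltW //; lia.
  by rewrite paddr_eq0 // mulf_eq0 gt_eqF //= => /andP[/eqP].
Qed.

(** At a fold the diagonals of a quadrilateral meet at different heights. *)
Lemma vertical_combination : (exists i j, A i j || B i j) ->
  exists w a, a != 0 /\ vertex_comb n q h w = vec4 0 a.
Proof.
move=> [i [j ABij]].
have ch : is_chord n i j by case/orP: ABij => [/A_chord|/B_chord].
move: ch; rewrite /is_chord => ch.
have [o oP] : exists o, (o < n)%N && ((o < i)%N || (j < o)%N).
  by case: (ltnP 0 i) => i0; [exists 0%N|exists j.+1]; lia.
have [s [t [s' [t' [[s0 t0 s'0 t'0] E]]]]] :=
  crossing_point_sym q_convex (i := i) (j := j) (k := i.+1) (l := o)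
   ltac:(lia) ltac:(lia) ltac:(lia) ltac:(lia) ltac:(lia).
exists (fun k => s * delta_wt R i k + t * delta_wt R j k - s' * delta_wt R i.+1 k - t' *
  delta_wt R o k).
exists (s * h i + t * h j - s' * h i.+1 - t' * h o); split; last first.
  transitivity (s *: vert i + t *: vert j - s' *: vert i.+1 - t' *: vert o).
    have [i_n jn i1n on] : [/\ (i < n)%N, (j < n)%N, (i.+1 < n)%N & (o < n)%N] by split; lia.
    rewrite -(vertex_comb_delta q h i_n) -(vertex_comb_delta q h jn) -(vertex_comb_delta q h i1n)
      -(vertex_comb_delta q h on) /vertex_comb !scaler_sumr -!sumrN -!big_split /=.
    by apply: eq_bigr => k _; rewrite !scalerA !scalerBl scalerDl.
  have e a : (s *: q i + t *: q j - s' *: q i.+1 - t' *: q o) 0 a = 0.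
    by rewrite -addrA -opprD E subrr mxE.
  by move: (e 0) (e 1) (e 2); rewrite !mxE => e0 e1 e2; apply: row4P; rewrite !mxE /=.
have key m (g : nat -> R) : dot m (q i) = g i -> dot m (q j) = g j ->
    (forall k, (k < n)%N -> k != i -> k != j -> dot m (q k) < g k) ->
    s * g i + t * g j - s' * g i.+1 - t' * g o < 0.
  move=> <- <- lt; have := congr1 (dot m) E; rewrite !dotDr !dotZr => ->.
  have b1 : s' * dot m (q i.+1) < s' * g i.+1 by rewrite ltr_pM2l // lt //; lia.
  have b2 : t' * dot m (q o) < t' * g o by rewrite ltr_pM2l // lt //; lia.
  lra.
case/orP: ABij => [/(hull_edge hullA)|/(hull_edge hullB)] [m [mi mj mk]].
  by rewrite lt_eqF // (key m h).
rewrite gt_eqF //; have := key m _ mi mj mk; lra.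
Qed.

Hypothesis q_unit : forall k, (k < n)%N -> bil (q k) (q k) = 1.
Hypothesis q_far : forall i j, (i < j)%N -> (j < n)%N -> bil (q i) (q j) <= -1.
Hypothesis h_gt0 : forall k, (k < n)%N -> 0 < h k.
Hypothesis h_le1 : forall k, (k < n)%N -> h k ^+ 2 <= 1.
Hypothesis planes : forall m i j k, (i < n)%N -> (j < n)%N -> (k < n)%N ->
  i != j -> k != i -> k != j -> dot m (q i) = h i -> dot m (q j) = h j ->
  dot m (q k) = h k -> 0 <= m 0 2 /\ m 0 0 ^+ 2 + m 0 1 ^+ 2 < 1 + m 0 2 ^+ 2.

Variable P : polyhedron R.
Hypothesis bodyP : body P = polytope_body n q h.
Hypothesis chartP : chart P = front R.

Local Notation zero_face := (zero_face P).

Lemma vertices_of_polytope p : is_vertex P p <-> exists2 k, (k < n)%N & p = vertex k.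
Proof.
split; first exact: (is_vertex_vertex q_front bodyP chartP).
move=> [k kn ->]; have [m [mk mi]] := vertex_form kn.
apply: (vertex_is_vertex (l := form4 m 0) q_front bodyP chartP kn).
- move=> i i_n; rewrite form4_vert mul0r addr0.
  by have [->|ik] := eqVneq i k; [rewrite mk|exact/ltW/mi].
- by rewrite form4_vert mul0r addr0.
- by move=> i i_n ik; rewrite form4_vert mul0r addr0 gt_eqF // mi.
Qed.

Lemma adjacent_edge i j : adjacent i j -> exists l, [/\ nonneg l,
    edge_joins P (zero_face l) (vertex i) (vertex j), l (vert i) = 0, l (vert j) = 0 &
    forall k, (k < n)%N -> k != i -> k != j -> l (vert k) != 0].
Proof.
move=> adj; have ijn := adjacent_lt adj.
have [l [l0 li lj lk]] := edge_form adj; exists l; split=> //.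
have i_n : (i < n)%N by lia.
have jn : (j < n)%N by lia.
split.
- by apply: (edge_is_edge n_gt3 q_convex q_front bodyP chartP i_n jn) => //; lia.
- by split; apply/vertices_of_polytope; [exists i|exists j].
- by move/(vertex_inj n_gt3 q_convex q_front i_n jn); lia.
- by split; apply/(zero_face_vertex q_front bodyP).
Qed.

Lemma edge_adjacent E i j : (i < j < n)%N -> edge_joins P E (vertex i) (vertex j) ->
  adjacent i j.
Proof.
move=> ijn [[[l sup] [U sp d2]] _ _ [Ei Ej]].
have [l0 EE] := supports_vert q_front bodyP chartP sup; subst E.
have i_n : (i < n)%N by lia.
have jn : (j < n)%N by lia.
have li : l (vert i) = 0 by apply/(zero_face_vertex q_front bodyP).
have lj : l (vert j) = 0 by apply/(zero_face_vertex q_front bodyP).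
apply: contrapT => /negP nadj.
have [k [kn ki kj lk]] := non_adjacent_third ijn nadj l0 li lj.
have ij : i != j by lia.
by have := edge_two_vertices q_convex q_front bodyP sp d2 i_n jn kn ij ki kj li lj;
  rewrite lk eqxx.
Qed.

(** Here [bil (q i + q j) (q i + q j) <= 0], and the heights make the
inequality strict. *)
Lemma ip22_vert_sum_lt0 i j : (i < n)%N -> (j < n)%N -> i != j ->
  ip22 (vert i + vert j) (vert i + vert j) < 0.
Proof.
move=> i_n jn ij.
have far : bil (q i) (q j) <= -1.
  by case: (ltngtP i j) ij => // [h1|h1] _; [|rewrite bilC]; exact: q_far.
have := q_unit i_n; have := q_unit jn; have := h_gt0 i_n; have := h_gt0 jn.
have -> : ip22 (vert i + vert j) (vert i + vert j) = bil (q i) (q i) +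
   bil (q j) (q j) + 2 * bil (q i) (q j) - (h i + h j) ^+ 2.
  by rewrite /ip22 /bil !mxE /=; ring.
move=> h1 h2 -> ->.
have : 0 < (h i + h j) ^+ 2 by rewrite exprn_gt0 // addr_gt0.
lra.
Qed.

Lemma vert_sum_neq0 i j : (i < n)%N -> (j < n)%N -> vert i + vert j != 0.
Proof.
move=> i_n jn; apply/eqP => /(congr1 (@front R))/eqP.
by rewrite linearD linear0 /= !front_vert gt_eqF // addr_gt0 ?q_front.
Qed.

(** Midpoints of vertices provide the points of AdS on edges and faces. *)
Lemma zero_face_midpoint (l : 'Hom('rV[R]_4, R^o)) i j : (i < n)%N -> (j < n)%N -> l (vert i) = 0 ->
  l (vert j) = 0 -> zero_face l (line (vert i + vert j)).
Proof.
move=> i_n jn li lj; have z0 := vert_sum_neq0 i_n jn.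
split; last by rewrite val_line // -memvE memv_ker linearD /= li lj addr0.
rewrite bodyP.
pose c := (q i 0 2 + q j 0 2)^-1.
have qq : 0 < q i 0 2 + q j 0 2 by rewrite addr_gt0 ?q_front.
have combE : vertex_comb n q h (fun k => c * (delta_wt R i k + delta_wt R j k)) =
  c *: (vert i + vert j).
  rewrite -(vertex_comb_delta q h i_n) -(vertex_comb_delta q h jn) /vertex_comb -big_split
    scaler_sumr /=.
  by apply: eq_bigr => k _; rewrite -scalerDl scalerA.
exists (fun k => c * (delta_wt R i k + delta_wt R j k)); split.
- by move=> k _; rewrite mulr_ge0 ?invr_ge0 ?(ltW qq) // addr_ge0 // ler0n.
- by rewrite combE linearZ linearD /= !front_vert /GRing.scale /= mulVf // gt_eqF.
- by rewrite combE val_line // memvZ // memv_line.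
Qed.

(** Vertices have norm [1 - h ^ 2], and each edge contains the midpoint of two
vertices. *)
Lemma polytope_hyperideal : hyperideal_AdS_polyhedron P (body P `&` @AdS3 R).
Proof.
split=> // [p /vertices_of_polytope[k kn ->]|E [[l sup] [U sp d2]]].
  move=> [x]; rewrite (val_vertex _ q_front kn) => /vlineP[b ->].
  rewrite ip22Zl ip22Zr ip22_vec4 q_unit //.
  have := h_le1 kn; rewrite expr2 => hk.
  by rewrite mulrA ltNge mulr_ge0 ?subr_ge0 // -expr2 sqr_ge0.
have [l0 EE] := supports_vert q_front bodyP chartP sup; subst E.
have [i i_n li] : exists2 k, (k < n)%N & l (vert k) = 0.
  by apply: (face_vertex bodyP l0 sp); rewrite d2.
have [j [jn ji lj]] := edge_second_vertex bodyP i l0 sp ltac:(by rewrite d2).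
have lt0 := ip22_vert_sum_lt0 i_n jn ltac:(by rewrite eq_sym).
exists (line (vert i + vert j)); split; first exact: zero_face_midpoint.
by exists (vert i + vert j) => //; rewrite val_line ?memv_line // vert_sum_neq0.
Qed.

(** The supporting plane of a face determines its outward normal up to a
positive factor, so the time direction can be read off from the supporting form
at the midpoint of two vertices.  The heights and the third coefficient of the
slope are nonnegative, and then the sign of the last coefficient of the form
decides.  A vertical plane does not contain three vertices. *)
Lemma directed_face_form F (s : R) i j : (s = 1 \/ s = -1) ->
  (i < n)%N -> (j < n)%N -> i != j -> F (vertex i) -> F (vertex j) ->
  is_face P F -> (exists2 nu, outward_unit_normal P F nu &
    forall x, quadric_lift P F x -> 0 < s * ip22 nu (time_field x)) ->
  exists m t, [/\ 0 < s * t, nonneg (form4 m t), form4 m t (vert i) = 0 &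
    form4 m t (vert j) = 0].
Proof.
move=> s1 i_n jn ij Fi Fj [_ [U sp d3]] [nu [nu1 nuF [l sup lnu]] dir].
have [l0 EF] := supports_vert q_front bodyP chartP sup; subst F.
have [m [t El]] := hom_form4 l; subst l.
have li : form4 m t (vert i) = 0 by apply/(zero_face_vertex q_front bodyP).
have lj : form4 m t (vert j) = 0 by apply/(zero_face_vertex q_front bodyP).
exists m, t; split=> //.
have [k [kn ki kj lk]] := face_third_vertex bodyP l0 sp ltac:(by rewrite d3) i_n jn.
have U_sub : (U <= lker (form4 m t))%VS.
  by apply: (spans_min bodyP l0 sp) => a an la; rewrite memv_ker la.
have dk := dim_ker_lt4 (l := form4 m t) (x := nu) ltac:(by rewrite lt_eqF).
have UE : U = lker (form4 m t) by apply/eqP; rewrite eqEdim U_sub d3.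
have [g gE] := ip22_form4 nu.
have ker_sub : (lker (form4 m t) <= lker g)%VS.
  rewrite -UE; apply: (spans_min bodyP l0 sp) => a an la.
  rewrite memv_ker gE; apply/eqP; apply: (nuF (vertex a)).
    by apply/(zero_face_vertex q_front bodyP).
  by rewrite (val_vertex _ q_front an) memv_line.
have lE x : form4 m t x = - form4 m t nu * ip22 nu x.
  have : x - (form4 m t x / form4 m t nu) *: nu \in lker g.
    apply: (subvP ker_sub); rewrite memv_ker linearB linearZ /= /GRing.scale /=.
    by rewrite divfK ?subrr // lt_eqF.
  rewrite memv_ker linearB linearZ /= !gE nu1 /GRing.scale /= mulrN1 opprK.
  rewrite addrC addr_eq0 => /eqP E.
  by rewrite -[ip22 nu x]opprK -E; field; rewrite lt_eqF.
pose z := vert i + vert j.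
have zlt0 : ip22 z z < 0 := ip22_vert_sum_lt0 i_n jn ij.
have z2 : 0 < z 0 2 by rewrite mxE !vec4E addr_gt0 ?q_front.
have z3 : 0 < z 0 3 by rewrite mxE !vec4E addr_gt0 ?h_gt0.
have dirz : 0 < s * form4 m t (time_field z).
  (* The midpoint has to be scaled to the quadric before the hypothesis on the
time direction applies to it. *)
pose c := (Num.sqrt (- ip22 z z))^-1.
  have c0 : 0 < c by rewrite invr_gt0 sqrtr_gt0 oppr_gt0.
  have : 0 < s * ip22 nu (time_field (c *: z)).
    apply: dir; split.
    - rewrite ip22Zl ip22Zr mulrA -expr2 /c exprVn sqr_sqrtr ?oppr_ge0 ?ltW //.
      by rewrite invrN mulNr mulVf // lt_eqF.
    - by rewrite chartP frontE mxE mulr_gt0.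
    - exists (line z); first exact: zero_face_midpoint.
      by rewrite val_line ?vert_sum_neq0 // memvZ // memv_line.
  rewrite time_fieldZ ip22Zr mulrCA pmulr_rgt0 // => pos.
  by rewrite lE mulrCA pmulr_rgt0 // oppr_gt0.
move: dirz; rewrite form4_time_field.
have [t0|t0] := eqVneq t 0.
  have dm a : (a < n)%N -> form4 m t (vert a) = 0 -> dot m (q a) = 0.
    by move=> an; rewrite form4_vert t0 mul0r addr0.
  have m0 : m = 0.
    apply: (dot_three_eq0 (u := q i) (v := q j) (w := q k)); try exact: dm.
    by apply: (det3_neq0 q_convex) => //; rewrite eq_sym.
  by move: lnu; rewrite form4E t0 m0 !mxE !mul0r !addr0 ltxx.
have slope a : (a < n)%N -> form4 m t (vert a) = 0 -> dot (- t^-1 *: m) (q a) = h a.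
  move=> an /eqP; rewrite form_slope // mulf_eq0 (negPf t0) subr_eq0 => /eqP ->.
  by [].
have [] := planes i_n jn kn ij ki kj (slope _ i_n li) (slope _ jn lj) (slope _ kn lk).
rewrite mxE => m2 _.
have -> : m 0 2 = - (t * (- t^-1 * m 0 2)) by field.
set y := - t^-1 * m 0 2 in m2 *; move: m2 => y0.
have -> : s * (z 0 2 * t - z 0 3 * - (t * y)) = (s * t) * (z 0 2 + z 0 3 * y) by ring.
have pos : 0 < z 0 2 + z 0 3 * y by rewrite ltr_wpDr // mulr_ge0 // ltW.
by rewrite pmulr_lgt0.
Qed.

(** The converse construction: a plane through three vertices that touches the
heights from one side has a timelike normal, by the bound on its slope, and
normalizing this normal gives the outward unit normal. *)
Lemma directed_face (s : R) m i j k : (s = 1 \/ s = -1) ->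
  (i < n)%N -> (j < n)%N -> (k < n)%N -> i != j -> k != i -> k != j ->
  (forall a, (a < n)%N -> 0 <= s * (h a - dot m (q a))) ->
  dot m (q i) = h i -> dot m (q j) = h j -> dot m (q k) = h k ->
  exists F, [/\ is_face P F, F = zero_face (form4 (- s *: m) s) & exists2 nu,
     outward_unit_normal P F nu &
     forall x, quadric_lift P F x -> ip22 x nu = 0 /\ 0 < s * ip22 nu (time_field x)].
Proof.
move=> s1 i_n jn kn ij ki kj l0 mi mj mk.
have ss : s * s = 1 by case: s1 => ->; ring.
pose l := form4 (- s *: m) s.
have lv a : l (vert a) = s * (h a - dot m (q a)).
  by rewrite /l form4_vert dotZl; ring.
have l_nonneg : nonneg l by move=> a an; rewrite lv l0.
have [li lj lk] : [/\ l (vert i) = 0, l (vert j) = 0 & l (vert k) = 0].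
  by rewrite !lv mi mj mk !subrr mulr0.
have [m2 mlt] := planes i_n jn kn ij ki kj mi mj mk.
pose D := 1 + m 0 2 ^+ 2 - (m 0 0 ^+ 2 + m 0 1 ^+ 2).
have D0 : 0 < D by rewrite /D; lra.
pose r := Num.sqrt D.
have r0 : 0 < r by rewrite sqrtr_gt0.
have rr : r ^+ 2 = D by rewrite sqr_sqrtr // ltW.
pose nu := vec4 (vec3 (- s * m 0 0 / r) (- s * m 0 1 / r) (s * m 0 2 / r)) (- s / r).
have nuE x : l x = r * ip22 nu x.
  by rewrite /l form4E /ip22 /nu !vec4E !vec3E !mxE; field; rewrite gt_eqF.
have nu1 : ip22 nu nu = -1.
  have -> : ip22 nu nu = - (s * s) * D / r ^+ 2.
    by rewrite /ip22 /nu /D !vec4E !vec3E; field; rewrite gt_eqF.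
  by rewrite ss rr mulN1r mulNr divff // gt_eqF.
exists (zero_face l); split=> //.
  apply: (three_zeros_is_face (x0 := nu) q_convex q_front bodyP chartP i_n jn kn) => //.
  by rewrite nuE nu1 mulrN1 oppr_eq0 gt_eqF.
exists nu.
  split=> //.
  - move=> p y [_ pl] yp; have := subvP pl _ yp; rewrite memv_ker nuE mulf_eq0.
    by rewrite gt_eqF //= => /eqP.
  - exists l; first exact: (nonneg_supports bodyP chartP).
    by rewrite nuE nu1 mulrN1 oppr_lt0.
move=> x [x1 x2 [p pF xp]].
have lx : l x = 0.
  by case: pF => _ /subvP/(_ _ xp); rewrite memv_ker => /eqP.
split.
  have -> : ip22 x nu = ip22 nu x by rewrite /ip22; ring.
  by move/eqP: lx; rewrite nuE mulf_eq0 gt_eqF //= => /eqP.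
have x20 : 0 < x 0 2 by rewrite -frontE -chartP.
have x30 : 0 <= x 0 3.
  have [w [w0 Fw pw _]] := zero_face_comb bodyP l_nonneg pF.
  move: xp x20; rewrite pw => /vlineP[b ->]; rewrite -frontE linearZ /= Fw /GRing.scale /= mulr1.
  move=> b0; rewrite mxE; apply: mulr_ge0; first exact: ltW.
  rewrite /vertex_comb summxE; apply: sumr_ge0 => a _.
  by rewrite mxE mulr_ge0 ?w0 // vec4E ltW // h_gt0.
have : 0 < s * l (time_field x).
  rewrite /l form4_time_field mxE.
  have -> : s * (x 0 2 * s - x 0 3 * (- s * m 0 2)) = (s * s) * (x 0 2 + x 0 3 * m 0 2) by ring.
  by rewrite ss mul1r ltr_wpDr // mulr_ge0.
by rewrite nuE mulrCA pmulr_rgt0.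
Qed.

Lemma future_face_form F i j : (i < n)%N -> (j < n)%N -> i != j ->
  F (vertex i) -> F (vertex j) -> future_directed P F ->
  exists m t, [/\ t < 0, nonneg (form4 m t), form4 m t (vert i) = 0 & form4 m t (vert j) = 0].
Proof.
move=> i_n jn ij Fi Fj [fF [nu nuF dir]].
have [||m [t [st l0 li lj]]] := @directed_face_form F (-1) i j _ i_n jn ij Fi Fj fF.
- by right.
- exists nu => // x /dir[_]; lra.
by exists m, t; split=> //; lra.
Qed.

Lemma past_face_form F i j : (i < n)%N -> (j < n)%N -> i != j ->
  F (vertex i) -> F (vertex j) -> past_directed P F ->
  exists m t, [/\ 0 < t, nonneg (form4 m t), form4 m t (vert i) = 0 & form4 m t (vert j) = 0].
Proof.
move=> i_n jn ij Fi Fj [fF [nu nuF dir]].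
have [||m [t [st l0 li lj]]] := @directed_face_form F 1 i j _ i_n jn ij Fi Fj fF.
- by left.
- by exists nu => // x /dir[_]; rewrite mul1r.
by exists m, t; split=> //; lra.
Qed.

(** At an equator edge the heights have a supporting plane from below and one
from above, so no fold passes there; a side of the polygon is adjacent to a
face of each kind. *)
Lemma equator_of_polytope i j : (i < j < n)%N ->
  (exists2 E, equator_edge P E & edge_joins P E (vertex i) (vertex j)) <-> cyclic_next n i j.
Proof.
move=> ijn.
have [i_n jn ij] : [/\ (i < n)%N, (j < n)%N & i != j] by split; lia.
split.
  move=> [E [_ [F1 [F2 [fut past EF1 EF2]]]] joins].
  have [_ _ _ [Ei Ej]] := joins.
  have [m1 [t1 [t10 l10 l1i l1j]]] := future_face_form i_n jn ij (EF1 _ Ei) (EF1 _ Ej) fut.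
  have [m2 [t2 [t20 l20 l2i l2j]]] := past_face_form i_n jn ij (EF2 _ Ei) (EF2 _ Ej) past.
  have t1n : t1 != 0 by rewrite lt_eqF.
  have t2n : t2 != 0 by rewrite gt_eqF.
  case/or3P: (edge_adjacent ijn joins) => // adj; exfalso.
    apply: (hull_edge_lower hullA (m := - t1^-1 *: m1) adj).
    - move=> k kn; have := l10 k kn; rewrite form_slope // nmulr_rge0 //.
      by rewrite subr_le0.
    - by move/eqP: l1i; rewrite form_slope // mulf_eq0 (negPf t1n) subr_eq0 => /eqP.
    - by move/eqP: l1j; rewrite form_slope // mulf_eq0 (negPf t1n) subr_eq0 => /eqP.
  have neg k : dot (t2^-1 *: m2) (q k) = - dot (- t2^-1 *: m2) (q k).
    by rewrite !dotZl; ring.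
  apply: (hull_edge_lower hullB (m := t2^-1 *: m2) adj).
  - move=> k kn; have := l20 k kn; rewrite form_slope // pmulr_rge0 // subr_ge0 neg.
    by rewrite lerN2.
  - move/eqP: l2i; rewrite form_slope // mulf_eq0 (negPf t2n) subr_eq0 neg => /eqP ->.
    by [].
  - move/eqP: l2j; rewrite form_slope // mulf_eq0 (negPf t2n) subr_eq0 neg => /eqP ->.
    by [].
move=> cyc.
have adj : adjacent i j by rewrite /adjacent cyc.
have [l [l0 joins li lj lk]] := adjacent_edge adj.
exists (zero_face l) => //; split; first by case: joins.
have sub g : nonneg g -> g (vert i) = 0 -> g (vert j) = 0 -> zero_face l `<=` zero_face g.
  move=> g0 gi gj p pl; split; first by case: pl.
  apply: (zero_face_sub bodyP l0 pl) => k kn lk0.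
  rewrite memv_ker.
  have [->|ki] := eqVneq k i; first by rewrite gi.
  have [->|kj] := eqVneq k j; first by rewrite gj.
  by have := lk k kn ki kj; rewrite lk0 eqxx.
have gE s m k : form4 (- s *: m) s (vert k) = s * (h k - dot m (q k)).
  by rewrite form4_vert dotZl; ring.
have [mB [kB [[kBn kBi kBj] [leB eBi eBj eBk]]]] := hull_side_face hullB cyc.
have [mA [kA [[kAn kAi kAj] [leA eAi eAj eAk]]]] := hull_side_face hullA cyc.
pose m1 := -1 *: mB.
have m1E k : dot m1 (q k) = - dot mB (q k) by rewrite dotZl mulN1r.
have [||||F1 [fF1 EF1 [nu1 out1 dir1]]] :=
  @directed_face (-1) m1 i j kB (or_intror erefl) i_n jn kBn ij kBi kBj.
- by move=> a an; rewrite m1E; have := leB a an; lra.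
- by rewrite m1E eBi opprK.
- by rewrite m1E eBj opprK.
- by rewrite m1E eBk opprK.
have [||||F2 [fF2 EF2 [nu2 out2 dir2]]] :=
  @directed_face 1 mA i j kA (or_introl erefl) i_n jn kAn ij kAi kAj.
- by move=> a an; rewrite mul1r subr_ge0 leA.
- exact: eAi.
- exact: eAj.
- exact: eAk.
exists F1, F2; split.
- split=> //; exists nu1 => // x xF; have [x0 xt] := dir1 x xF.
  by split; [split=> //; have [-> _ _] := out1; rewrite ltrN10|lra].
- split=> //; exists nu2 => // x xF; have [x0 xt] := dir2 x xF.
  by split; [split=> //; have [-> _ _] := out2; rewrite ltrN10|lra].
- rewrite EF1; apply: sub => [a an||]; rewrite gE m1E.
  + by have := leB a an; lra.
  + by rewrite eBi; ring.
  + by rewrite eBj; ring.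
- rewrite EF2; apply: sub => [a an||]; rewrite gE.
  + by rewrite mul1r subr_ge0 leA.
  + by rewrite eAi subrr mulr0.
  + by rewrite eAj subrr mulr0.
Qed.

End TwoRoofs.

(** * Realization of two families of chords *)

(** Only finitely many linear forms interpolate the heights at three corners. *)
Lemma interpolation_bound (R : realFieldType) n (q : nat -> 'rV[R]_3) (g : nat -> R) :
  (forall i j k, (i < j)%N -> (j < k)%N -> (k < n)%N -> 0 < det3 (q i) (q j) (q k)) ->
  exists2 K : R, 0 <= K & forall m i j k, (i < n)%N -> (j < n)%N -> (k < n)%N ->
    i != j -> k != i -> k != j -> dot m (q i) = g i -> dot m (q j) = g j ->
    dot m (q k) = g k -> forall r, `|m 0 r| <= K.
Proof.
move=> qc.
pose M i j k : 'rV[R]_3 := (det3 (q i) (q j) (q k))^-1 *: (g i *: cross (q j) (q k) +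
  g j *: cross (q k) (q i) + g k *: cross (q i) (q j)).
exists (\sum_(p : 'I_n * 'I_n * 'I_n * 'I_3) `|M p.1.1.1 p.1.1.2 p.1.2 0 p.2|).
  by apply: sumr_ge0 => p _; exact: normr_ge0.
move=> m i j k i_n jn kn ij ki kj mi mj mk r.
have d0 : det3 (q i) (q j) (q k) != 0 by apply: (det3_neq0 qc) => //; rewrite eq_sym.
have -> : m = M i j k := interpolation3 d0 mi mj mk.
pose p0 : 'I_n * 'I_n * 'I_n * 'I_3 := (Ordinal i_n, Ordinal jn, Ordinal kn, r).
rewrite (bigD1 p0) //= lerDl; apply: sumr_ge0 => p _; exact: normr_ge0.
Qed.

(** The normalization of the contact points keeps all corners in the chart. *)
Lemma side_pole_front (R : realFieldType) n (x : nat -> R) : (3 < n)%N ->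
  increasing n x -> normalized n x -> forall k, (k < n)%N -> 0 < side_pole n x k 0 2.
Proof.
move=> n3 xi [x0 x1 xn] k kn; rewrite /side_pole /pole !vec3E /next_point.
have [->|k0] := eqVneq k 0%N.
  by rewrite (_ : (1 < n)%N) ?x0 ?x1; [rewrite mulr0 addr0 sub0r opprK; lra|lia].
case: ltnP => k1.
  have h0 : 0 <= x k by rewrite -x1; apply: (point_le xi); lia.
  have h1 := xi _ k1.
  have h2 : 0 <= x k * x k.+1 by rewrite mulr_ge0 //; lra.
  by rewrite divr_gt0 ?subr_gt0 // ltr_wpDr.
have -> : k = n.-1 by lia.
rewrite x0 xn (_ : _ / _ = 3 / 4); last by field.
lra.
Qed.

Section Realization.
Variables (R : realType) (n : nat) (c side : rel nat).
Hypothesis n_gt3 : (3 < n)%N.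
Hypothesis c_chord : forall i j, c i j -> is_chord n i j.
Hypothesis c_linked : linked n c.
Hypothesis c_side : forall i j k l, c i k -> c j l ->
  [&& i < j, j < k & k < l]%N -> side i k != side j l.

Let A i j := c i j && side i j.
Let B i j := c i j && ~~ side i j.

(** The roofs of the two sides provide the heights; the linear form
[up] and the factor [eps] make them positive and small and the planes through
three vertices nearly horizontal. *)
Theorem realization : exists (P : polyhedron R) (V : nat -> RP3 R),
  [/\ hyperideal_AdS_polyhedron P (body P `&` @AdS3 R),
      forall i j, (i < n)%N -> (j < n)%N -> V i = V j -> i = j,
      forall p, is_vertex P p <-> exists2 k, (k < n)%N & p = V k,
      forall i j, (i < j < n)%N -> (exists E, edge_joins P E (V i) (V j)) <->
        cyclic_next n i j || c i j &
      forall i j, (i < j < n)%N ->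
       (exists2 E, equator_edge P E & edge_joins P E (V i) (V j)) <-> cyclic_next n i j].
Proof.
have [x [xi xn xcrit]] := critical_configuration R n_gt3 c_chord c_linked.
pose q := side_pole n x.
have qc : forall i j k, (i < j)%N -> (j < k)%N -> (k < n)%N ->
  0 < det3 (q i) (q j) (q k) := side_pole_convex (ltnW n_gt3) xi.
have A_chord i j : A i j -> is_chord n i j by case/andP => /c_chord.
have B_chord i j : B i j -> is_chord n i j by case/andP => /c_chord.
have A_nc : noncrossing A.
  move=> i j k l /andP[cij sij] /andP[ckl skl]; apply/negP => cross.
  by have := c_side cij ckl cross; rewrite sij skl.
have B_nc : noncrossing B.
  move=> i j k l /andP[cij sij] /andP[ckl skl]; apply/negP => cross.
  by have := c_side cij ckl cross; rewrite (negPf sij) (negPf skl).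
have hullA := roof_lower_hull (ltnW n_gt3) qc A_chord A_nc.
have hullB := roof_lower_hull (ltnW n_gt3) qc B_chord B_nc.
pose g k := roof n q A (q k).
have [L LE] : exists L, forall k, (k < n)%N -> roof n q c (q k) = dot L (q k).
  by exists (face_slope n x c 1); exact: roof_equilibrium.
have gB k : (k < n)%N -> roof n q B (q k) = dot L (q k) - g k.
  move=> kn; rewrite -LE //.
  rewrite /g /roof [X in _ = X - _](bigID (fun p : 'I_n * 'I_n => side p.1 p.2)) /=.
  by rewrite [RHS]addrC addKr.
have front_q : forall k, (k < n)%N -> 0 < q k 0 2 := side_pole_front n_gt3 xi xn.
have [K K0 hK] := interpolation_bound g qc.
have g0 k : 0 <= g k by apply: sumr_ge0 => p _; exact: normr_ge0.
(* A plane through three of the unscaled vertices has slope at most [K] in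
each coordinate, so adding [K + 1] times the third coordinate makes its third
coefficient positive. *)
pose up : 'rV[R]_3 := (K + 1) *: vec3 0 0 1.
have upE y : dot up y = (K + 1) * y 0 2.
  by rewrite dotZl /dot !vec3E !mul0r !add0r mul1r.
pose g' k := g k + dot up (q k).
have g'0 k : (k < n)%N -> 0 < g' k.
  by move=> kn; rewrite /g' upE ltr_wpDl // mulr_gt0 ?front_q //; lra.
(* Dividing by [D] brings the heights to at most 1 and the first two
coefficients of the slopes below one half. *)
pose D := 1 + 2 * K + \sum_(k < n) g' k.
have sum0 : 0 <= \sum_(k < n) g' k by apply: sumr_ge0 => k _; exact/ltW/g'0.
have D1 : 1 + 2 * K <= D by rewrite /D; lra.
have g'D k : (k < n)%N -> g' k <= D.
  move=> kn; rewrite /D (bigD1 (Ordinal kn)) //=.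
  have : 0 <= \sum_(i < n | i != Ordinal kn) g' i by apply: sumr_ge0 => i _; exact/ltW/g'0.
  lra.
have D0 : 0 < D by lra.
pose eps := D^-1; have eps0 : 0 < eps by rewrite invr_gt0.
pose h k := eps * g' k.
have hA : lower_hull n q A h by apply: (lower_hull_affine eps0 _ A_chord hullA) => k _.
have hB : lower_hull n q B (fun k => - h k).
  apply: (lower_hull_affine (m0 := - 1 *: L + - 1 *: up) eps0 _ B_chord hullB) => k kn.
  by rewrite gB // /h /g' dotDl (dotZl (- 1) L) (dotZl (- 1) up); ring.
have q1 : forall k, (k < n)%N -> bil (q k) (q k) = 1 := bil_side_pole (ltnW n_gt3) xi.
have qfar : forall i j, (i < j)%N -> (j < n)%N -> bil (q i) (q j) <= -1 :=
  bil_side_pole_le (ltnW n_gt3) xi.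
have h0 k : (k < n)%N -> 0 < h k by move=> kn; rewrite mulr_gt0 // g'0.
have h1 k : (k < n)%N -> h k ^+ 2 <= 1.
  move=> kn; rewrite expr_le1 //; last exact/ltW/h0.
  by rewrite /h /eps mulrC ler_pdivrMr // mul1r g'D.
have planes m i j k : (i < n)%N -> (j < n)%N -> (k < n)%N ->
    i != j -> k != i -> k != j -> dot m (q i) = h i -> dot m (q j) = h j ->
    dot m (q k) = h k -> 0 <= m 0 2 /\ m 0 0 ^+ 2 + m 0 1 ^+ 2 < 1 + m 0 2 ^+ 2.
  move=> i_n jn kn ij ki kj mi mj mk.
  pose m' := D *: m - up.
  have m'E a : dot m (q a) = h a -> dot m' (q a) = g a.
    move=> ma; rewrite /m' dotDl dotZl -scaleN1r dotZl ma /h /g' /eps mulVKf ?gt_eqF //; ring.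
  have bound := hK m' i j k i_n jn kn ij ki kj (m'E _ mi) (m'E _ mj) (m'E _ mk).
  have m2 : D * m 0 2 = m' 0 2 + (K + 1) by rewrite /m' !mxE /=; ring.
  have m0 : D * m 0 0 = m' 0 0 by rewrite /m' !mxE /=; ring.
  have m1 : D * m 0 1 = m' 0 1 by rewrite /m' !mxE /=; ring.
  move: (bound 0) (bound 1) (bound 2); rewrite !ler_norml =>
    /andP[b0 b0'] /andP[b1 b1'] /andP[b2 b2'].
  have m20 : 0 <= m 0 2 by rewrite -(pmulr_rge0 _ D0) m2; lra.
  split=> //.
  have : 0 <= m 0 2 ^+ 2 by rewrite exprn_ge0.
  suff : m 0 0 ^+ 2 + m 0 1 ^+ 2 < 1 by lra.
  have sq y : - K <= D * y -> D * y <= K -> y ^+ 2 < 2^-1.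
    move=> y1 y2; rewrite -(ltr_pM2l (exprn_gt0 2 D0)) -exprMn.
    have : (D * y) ^+ 2 <= K ^+ 2.
      by rewrite -[leLHS]real_normK ?num_real // lerXn2r ?nnegrE // ler_norml y1 y2.
    have : (1 + 2 * K) ^+ 2 <= D ^+ 2 by rewrite lerXn2r ?nnegrE //; lra.
    have : 0 <= K ^+ 2 by rewrite exprn_ge0.
    rewrite !expr2; lra.
  have := sq (m 0 0); have := sq (m 0 1); rewrite m0 m1 => /(_ b1 b1') ? /(_ b0 b0') ?.
  lra.
have hasAB : exists i j, A i j || B i j.
  have [i [j [cij _]]] := c_linked (a := 0%N) (b := 2%N) ltac:(rewrite /is_chord; lia).
  by exists i, j; rewrite /A /B cij /=; case: (side i j).
have vc := vertical_combination n_gt3 qc A_chord B_chord hA hB hasAB.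
pose P := Polyhedron (polytope_in_chart (n := n) (q := q) (h := h))
  (polytope_convex h front_q) (polytope_solid n_gt3 qc front_q vc).
have adjE i j : adjacent n A B i j = cyclic_next n i j || c i j.
  by rewrite /adjacent /A /B; case: (c i j); case: (side i j).
exists P, (vertex q h); split.
- exact: (polytope_hyperideal n_gt3 qc front_q q1 qfar h0 h1 (P := P) erefl erefl).
- exact: (vertex_inj n_gt3 qc front_q).
- exact: (vertices_of_polytope n_gt3 qc front_q (P := P) erefl erefl).
- move=> i j ijn; rewrite -adjE; split.
    by move=> [E]; apply: (edge_adjacent n_gt3 qc front_q hA hB (P := P) erefl erefl ijn).
  move=> adj.
  have [l [_ joins _ _ _]] := adjacent_edge n_gt3 qc front_q A_chord B_chord hA hB (P := P) erefl
    erefl adj.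
  by eexists; exact: joins.
- exact: (equator_of_polytope n_gt3 qc front_q A_chord B_chord hA hB q1 qfar h0 planes (P := P)
  erefl erefl).
Qed.

End Realization.

(** * Hamiltonian 3-connected graphs *)

Section HamiltonianOrder.
Local Open Scope nat_scope.
Variables (T : finType) (e : rel T) (gamma : seq T) (x0 : T).
Hypothesis e_sym : symmetric e.
Hypothesis e3conn : three_connected e.
Hypothesis gammaH : hamiltonian_cycle e gamma.

Local Notation n := (size gamma).
Local Notation v := (nth x0 gamma).

Definition gamma_chord i j := is_chord n i j && e (v i) (v j).

Lemma gamma_uniq : uniq gamma.
Proof. by case: gammaH => _ /andP[]. Qed.

Lemma nth_gamma_eq i j : i < n -> j < n -> (v i == v j) = (i == j).
Proof. by move=> i_n jn; exact: nth_uniq gamma_uniq. Qed.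

Lemma next_nth_gamma i : i < n -> next gamma (v i) = v (if i.+1 < n then i.+1 else 0).
Proof. by move=> i_n; exact: next_nth_uniq gamma_uniq i_n. Qed.

Lemma index_nth_gamma i : i < n -> index (v i) gamma = i.
Proof. by move=> i_n; rewrite index_uniq // gamma_uniq. Qed.

Lemma index_lt_gamma u : index u gamma < n.
Proof. by rewrite index_mem; case: gammaH. Qed.

Lemma nth_index_gamma u : v (index u gamma) = u.
Proof. by rewrite nth_index //; case: gammaH. Qed.

(** A triangle is reduced to a single point by removing two vertices. *)
Lemma hamiltonian_size_gt3 : 3 < n.
Proof.
have [n2 _ all_g] := gammaH.
have card_T : #|T| = n.
  by rewrite -(card_uniqP gamma_uniq); apply: eq_card => u; rewrite all_g.
pose S := [set v 0; v 1]%SET.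
have S2 : #|S| = 2.
  by rewrite cards2 nth_gamma_eq //; lia.
have [] := e3conn (S := S); first by rewrite S2.
by have := cardsC S; rewrite S2 card_T; lia.
Qed.

Lemma cycle_edge_nth i j : i < j < n -> cycle_edge gamma (v i) (v j) = cyclic_next n i j.
Proof.
move=> /andP[ij jn]; have i_n := ltn_trans ij jn.
have i1n : i.+1 < n by lia.
rewrite /cycle_edge /= !mem_nth //= !next_nth_gamma // i1n nth_gamma_eq //.
by case: ifP => j1n; rewrite nth_gamma_eq // /cyclic_next; lia.
Qed.

Lemma cycle_edge_edge u w : cycle_edge gamma u w -> e u w.
Proof.
have [_ /andP[cyc _] _] := gammaH.
case/and3P => ug wg /orP[/eqP <-|/eqP <-]; last rewrite e_sym; exact: next_cycle.
Qed.

Lemma edge_nth i j : i < j < n -> e (v i) (v j) = cyclic_next n i j || gamma_chord i j.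
Proof.
move=> ij; rewrite /gamma_chord.
have [cyc|ncyc] := boolP (cyclic_next n i j).
  by apply: cycle_edge_edge; rewrite cycle_edge_nth.
suff -> : is_chord n i j by [].
by move: ij ncyc; rewrite /cyclic_next /is_chord; lia.
Qed.

(** If no chord interlaced [a] and [b], removing these two vertices would
disconnect the graph. *)
Lemma gamma_chord_linked : linked n gamma_chord.
Proof.
move=> a b ab; apply: contrapT => H.
have := ab; rewrite /is_chord => abn.
have nolink i j : a < i < b -> j < n -> (j < a) || (b < j) -> ~~ e (v i) (v j).
  move=> iab jn jab; apply/negP => eij; apply: H.
  case/orP: jab => h.
    exists j, i; rewrite /gamma_chord /is_chord e_sym eij; split; lia.
  exists i, j; rewrite /gamma_chord /is_chord eij; split; lia.
have [o /andP[on oab]] : exists o, (o < n) && ((o < a) || (b < o)).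
  by case: (ltnP 0 a) => a0; [exists 0|exists b.+1]; lia.
pose S := [set v a; v b]%SET.
have S2 : #|S| <= 2 by rewrite cards2; case: (_ != _).
have vS i : i < n -> i != a -> i != b -> v i \notin S.
  move=> i_n ia ib; rewrite !inE !nth_gamma_eq //; lia.
have [_ conn] := e3conn S2.
have := conn (v a.+1) (v o) ltac:(apply: vS; lia) ltac:(apply: vS; lia).
pose inside := [pred u | a < index u gamma < b].
suff cl : fingraph.closed [rel u w | [&& u \notin S, w \notin S & e u w]] inside.
  move=> /(closed_connect cl); rewrite !inE !index_nth_gamma //; lia.
move=> u w /= /and3P[uS wS euw]; rewrite !inE.
have out x : x \notin S -> (index x gamma != a) && (index x gamma != b).
  by apply: contraR; rewrite negb_and !negbK !inE => /orP[]/eqP <-;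
    rewrite nth_index_gamma eqxx ?orbT.
have := out _ uS; have := out _ wS.
have := @nolink (index u gamma) (index w gamma); rewrite !nth_index_gamma euw.
have := @nolink (index w gamma) (index u gamma); rewrite !nth_index_gamma e_sym euw.
have := index_lt_gamma u; have := index_lt_gamma w.
move: (index u gamma) (index w gamma) => i j jn i_n; rewrite jn i_n => h1 h2 hj hi.
case: (boolP (a < i < b)) => hiab; case: (boolP (a < j < b)) => hjab //; exfalso.
  by have := h2 hiab isT ltac:(clear h1 h2; lia).
by have := h1 hjab isT ltac:(clear h1 h2; lia).
Qed.

End HamiltonianOrder.

Theorem corollary1p4 (R : realType) (T : finType) (e : rel T) (gamma : seq T)
    (esym : symmetric e) (eirr : irreflexive e)
    (e3conn : three_connected e) (eplanar : planar R e)
    (gammaH : hamiltonian_cycle e gamma) :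
  exists (P' : polyhedron R) (P : set (RP3 R)),
    hyperideal_AdS_polyhedron P' P /\
    exists f : T -> RP3 R,
      skeleton_iso e P' f /\ carries_to_equator gamma P' f.
Proof.
have [x0 _] : exists x0, x0 \in gamma.
  by have [n2 _ _] := gammaH; case: (gamma) n2 => // x s _; exists x; rewrite inE eqxx.
have n_gt3 := hamiltonian_size_gt3 x0 e3conn gammaH.
have [side sideP] := hamiltonian_chord_sides esym x0 eplanar gammaH.
have c_chord i j : gamma_chord e gamma x0 i j -> is_chord (size gamma) i j by case/andP.
have c_side i j k l : gamma_chord e gamma x0 i k -> gamma_chord e gamma x0 j l ->
    [&& i < j, j < k & k < l]%N -> side i k != side j l.
  move=> /andP[_ eik] /andP[jl ejl] /and3P[ij jk kl]; apply: sideP => //.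
  by move: jl; rewrite /is_chord; lia.
have [P [V [hyp Vinj Vvert Vedge Veq]]] :=
  realization R n_gt3 c_chord (gamma_chord_linked x0 esym e3conn gammaH) c_side.
exists P, (body P `&` @AdS3 R); split=> //.
pose idx u := index u gamma.
have idx_lt u : (idx u < size gamma)%N := index_lt_gamma gammaH u.
have idxK u : nth x0 gamma (idx u) = u := nth_index_gamma x0 gammaH u.
have joinsC E p p' : edge_joins P E p p' -> edge_joins P E p' p.
  by case=> h1 [h2 h3] h4 [h5 h6]; split=> // h; apply: h4.
exists (V \o idx); split; first split.
- by move=> u w /= /(Vinj _ _ (idx_lt u) (idx_lt w)) E; rewrite -(idxK u) E idxK.
- apply/seteqP; split=> p /=.
    by move=> [u _ <-]; apply/Vvert; exists (idx u).
  move/Vvert => [k kn ->]; exists (nth x0 gamma k) => //.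
  by rewrite /idx /= (index_nth_gamma x0 gammaH kn).
- have main u w : (idx u < idx w)%N -> e u w <-> exists E, edge_joins P E (V (idx u)) (V (idx w)).
    move=> uw; have uwn : (idx u < idx w < size gamma)%N by rewrite uw idx_lt.
    have := edge_nth x0 esym gammaH uwn; rewrite !idxK => ->.
    by have [h1 h2] := Vedge _ _ uwn; split.
  move=> u w /=; case: (ltngtP (idx u) (idx w)) => [|wu|E]; first exact: main.
    rewrite esym; have [h1 h2] := main _ _ wu; split=> [/h1[E /joinsC]|[E /joinsC h]].
      by exists E.
    by apply: h2; exists E.
  rewrite -(idxK u) E idxK eirr; split=> // -[F [_ _ ne _]]; by case: ne.
- have main u w : (idx u < idx w)%N -> cycle_edge gamma u w <->
      exists2 E, equator_edge P E & edge_joins P E (V (idx u)) (V (idx w)).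
    move=> uw; have uwn : (idx u < idx w < size gamma)%N by rewrite uw idx_lt.
    have := cycle_edge_nth x0 gammaH uwn; rewrite !idxK => ->.
    by have [h1 h2] := Veq _ _ uwn; split.
  have cycC u w : cycle_edge gamma u w = cycle_edge gamma w u.
    by rewrite /cycle_edge /= andbCA; congr (_ && (_ && _)); rewrite orbC.
  move=> u w /=; case: (ltngtP (idx u) (idx w)) => [|wu|E]; first exact: main.
    rewrite cycC; have [h1 h2] := main _ _ wu; split=> [/h1[E Eeq /joinsC]|[E Eeq /joinsC h]].
      by exists E.
    by apply: h2; exists E.
  rewrite -(idxK u) E idxK; split; last by move=> [F _ [_ _ ne _]]; case: ne.
  by move/(cycle_edge_edge esym gammaH); rewrite eirr.
Qed.
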